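(* Let $k\ge 1$ be an integer, and consider, for $0<\varepsilon\le 1$, the problem $\dot{\mathbf u}=\frac1\varepsilon A\mathbf u+\mathbf F(\mathbf u,t)$ on $[0,T]$, $\mathbf u(0)=\varepsilon^\nu\mathbf u_{\mathrm{in}}$, with the assumptions on $A$, $\mathbf F$ given in the context. Assume that the solution $\mathbf u(t)$ satisfies the bounded oscillatory energy condition: there is a constant $C_0$ independent of $\varepsilon$ such that $\|\mathbf u(t)\|\le C_0\varepsilon$ for all $t\in[0,T]$. Let $h=T/N$ ($N$ a positive integer), $t_n=nh$, and let $\mathbf U_n$, $n=0,\dots,T/h$, be the numerical solution computed by the $k$-th order local linear extension exponential integrator (defined in the context). Then there is a constant $C$, independent of $h$ and $\varepsilon$, such that $$\|\mathbf U_n-\mathbf u(t_n)\|\le C h^{k+1},\qquad n=0,\dots,T/h.$$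
   Context: **Problem.** $d\ge1$; $\nu\in\mathbb R$; $\mathbf u_{\mathrm{in}}\in\mathbb C^d$; $T>0$ independent of $\varepsilon$; $A\in\mathbb C^{d\times d}$ is diagonalizable (not necessarily diagonal) with purely imaginary eigenvalues; the nonlinear term $\mathbf F(\mathbf u,t)\in\mathbb C^d$ is independent of $\varepsilon$, and $\mathbf F$ and its partial derivatives in all variables $u_1,\dots,u_d,t$ up to order $k$ are Lipschitz continuous with Lipschitz constants independent of $\varepsilon$. $\|\cdot\|$ is the Euclidean norm. **Augmented system.** Put $\mathbf x=[\mathbf u^\top,t]^\top$ (components $x_1,\dots,x_{d+1}$), $A_1=\operatorname{diag}\{A,0\}\in\mathbb C^{(d+1)\times(d+1)}$, $\mathbf f(\mathbf x)=[\mathbf F(\mathbf u,t)^\top,1]^\top$, so that $\dot{\mathbf x}=\frac1\varepsilon A_1\mathbf x+\mathbf f(\mathbf x)$, $\mathbf x(0)=[\varepsilon^\nu\mathbf u_{\mathrm{in}}^\top,0]^\top$. **Multi-indices.** For $j\ge0$ let $\tilde{\mathcal I}_{d+1}^{[[j]]}$ be the set of nondecreasing tuples $\alpha=(\alpha_1,\dots,\alpha_j)\in\{1,\dots,d+1\}^j$ (only the empty tuple if $j=0$). For a reference point $\hat{\mathbf x}$ and a tuple $\alpha$ of length $j$, $(\mathbf x-\hat{\mathbf x})^\alpha=\prod_{l=1}^j(x_{\alpha_l}-\hat x_{\alpha_l})$ (equal to $1$ if $j=0$); $\chi(\alpha;l)$ is $\alpha$ with its $l$-th entry removed; $\gamma(\alpha)=\prod_{q=1}^{d+1}\big(\#\{i:\alpha_i=q\}\big)!$;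 $\partial^\alpha/\partial\mathbf x^\alpha=\partial^j/\partial x_{\alpha_1}\cdots\partial x_{\alpha_j}$. Let $D^{[k]}=\sum_{j=0}^k|\tilde{\mathcal I}_{d+1}^{[[j]]}|$. The vector $\mathbf x^{[k,\hat{\mathbf x}]}$ of length $D^{[k]}$ lists all polynomials $(\mathbf x-\hat{\mathbf x})^\alpha$, $\alpha\in\bigcup_{j=0}^k\tilde{\mathcal I}_{d+1}^{[[j]]}$, once each; its first component is $1$, components $2,\dots,d+2$ are $\mathbf x-\hat{\mathbf x}$, and the remaining ones are in any fixed order. **Matrices.** $A_1^{[k]}(\hat{\mathbf x}),A_0^{[k]}(\hat{\mathbf x})\in\mathbb C^{D^{[k]}\times D^{[k]}}$ are the matrices such that, for every $\alpha$ of length $j\le k$, the component corresponding to $\alpha$ of $A_1^{[k]}(\hat{\mathbf x})\mathbf x^{[k,\hat{\mathbf x}]}$ is (identically in $\mathbf x$) $$\sum_{l=1}^j\sum_{m=1}^{d+1}(A_1)_{\alpha_l m}(\mathbf x-\hat{\mathbf x})^{\chi(\alpha;l)}\big((x_m-\hat x_m)+\hat x_m\big),$$ and that of $A_0^{[k]}(\hat{\mathbf x})\mathbf x^{[k,\hat{\mathbf x}]}$ is $$\sum_{l=1}^{j}\sum_{m=0}^{k-j+1}\sum_{\beta\in\tilde{\mathcal I}_{d+1}^{[[m]]}}\frac1{\gamma(\beta)}\frac{\partial^{\beta}f_{\alpha_l}(\hat{\mathbf x})}{\partial\mathbf x^{\beta}}(\mathbf x-\hat{\mathbf x})^{\chi(\alpha;l)}(\mathbf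 x-\hat{\mathbf x})^{\beta}.$$ (The rows of the empty tuple are zero.) **Scheme.** $\mathbf X_0=\mathbf x(0)$ and $$\mathbf X_{n+1}=\mathbf X_n+\Pi_2^{d+2}\,\mathrm e^{\left(\frac1\varepsilon A_1^{[k]}(\mathbf X_n)+A_0^{[k]}(\mathbf X_n)\right)h}e_1,$$ where $e_1$ is the first canonical basis vector of $\mathbb C^{D^{[k]}}$ and $\Pi_2^{d+2}$ extracts components $2,\dots,d+2$. $\mathbf U_n$ consists of the first $d$ components of $\mathbf X_n$. *)

(* Defs.v *)
From HB Require Import structures.
From mathcomp Require Import all_boot all_order all_algebra.
From mathcomp Require Import all_classical all_reals all_analysis.
From mathcomp Require Import complex.

Set Implicit Arguments.
Unset Strict Implicit.
Unset Printing Implicit Defensive.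

Import Order.TTheory GRing.Theory Num.Theory.
Import numFieldNormedType.Exports.

Local Open Scope classical_set_scope.
Local Open Scope ring_scope.
Local Open Scope complex_scope.

Definition enorm (R : realType) (m : nat) (v : 'cV[R[i]]_m) : R :=
  Num.sqrt (\sum_(j < m) ComplexField.Normc.normc (v j 0) ^+ 2).

Definition expmx (R : realType) (m : nat) (M : 'M[R[i]]_m) : 'M[R[i]]_m :=
  limn (series (fun j => (j`!%:R : R[i])^-1 *: M ^+ j)).

(* The derivative in the real variable [t] is taken relatively to [[0, T]], so
   it is one-sided at [0] and [T]; the derivatives in the entries of [u] are
   complex ones, since the scheme expands functions of [u] in powers of the
   (complex) entries of [u]. *)

Definition tslope (R : realType) (m : nat) (g : R -> 'cV[R[i]]_m) (t h : R) :
    ('cV[R[i]]_m : normedModType R[i]) :=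
  (h^-1)%:C *: (g (t + h) - g t).

Definition tnbhs (R : realType) (T t : R) : set_system R :=
  within [set h | 0 <= t + h <= T] (0 : R)^'.

(* The variables x_1, ..., x_(d+1) are indexed by ['I_(d + 1)]: [lshift 1 j] is
   the [j]-th entry of [u] and [rshift d ord0] is [t]. *)
Definition pderivable (R : realType) (T : R) (d m : nat) (q : 'I_(d + 1))
    (g : 'cV[R[i]]_d -> R -> 'cV[R[i]]_m) (u : 'cV[R[i]]_d) (t : R) : Prop :=
  match fintype.split q with
  | inl j => derivable (g^~ t) u (delta_mx j 0)
  | inr _ => cvg (tslope (g u) t h @[h --> tnbhs T t])
  end.

Definition pderive (R : realType) (T : R) (d m : nat) (q : 'I_(d + 1))
    (g : 'cV[R[i]]_d -> R -> 'cV[R[i]]_m) (u : 'cV[R[i]]_d) (t : R) :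
    'cV[R[i]]_m :=
  match fintype.split q with
  | inl j => 'D_(delta_mx j 0) (g^~ t) u
  | inr _ => lim (tslope (g u) t h @[h --> tnbhs T t])
  end.

Definition pderiven (R : realType) (T : R) (d m : nat) (a : seq 'I_(d + 1))
    (g : 'cV[R[i]]_d -> R -> 'cV[R[i]]_m) : 'cV[R[i]]_d -> R -> 'cV[R[i]]_m :=
  foldr (fun q => @pderive R T d m q) g a.

(* Lipschitz on each bounded subset of C^d x [0, T]. A uniform constant on C^d
   would be a special case, but too rigid for complex-differentiable functions:
   by Liouville's theorem it forces [g] to be affine in [u]. *)
Definition lipschitz_bounded (R : realType) (T : R) (d m : nat)
    (g : 'cV[R[i]]_d -> R -> 'cV[R[i]]_m) : Prop :=
  forall r : R, exists L : R,
  forall (u v : 'cV[R[i]]_d) (t s : R),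
    enorm u <= r -> enorm v <= r -> 0 <= t <= T -> 0 <= s <= T ->
    enorm (g u t - g v s) <= L * Num.sqrt (enorm (u - v) ^+ 2 + (t - s) ^+ 2).

Definition smooth_lipschitz (R : realType) (T : R) (d k : nat)
    (F : 'cV[R[i]]_d -> R -> 'cV[R[i]]_d) : Prop :=
  (forall (a : seq 'I_(d + 1)) (q : 'I_(d + 1)) u t,
     (size a < k)%N -> 0 <= t <= T ->
     pderivable T q (pderiven T a F) u t) /\
  (forall a : seq 'I_(d + 1), (size a <= k)%N ->
     lipschitz_bounded T (pderiven T a F)).

Definition is_solution (R : realType) (T nu : R) (d : nat) (A : 'M[R[i]]_d)
    (uin : 'cV[R[i]]_d) (F : 'cV[R[i]]_d -> R -> 'cV[R[i]]_d) (eps : R)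
    (u : R -> 'cV[R[i]]_d) : Prop :=
  u 0 = (eps `^ nu)%:C *: uin /\
  forall t : R, 0 <= t <= T ->
    tslope u t h @[h --> tnbhs T t] -->
      ((eps^-1)%:C *: (A *m u t) + F (u t) t : ('cV[R[i]]_d : normedModType R[i])).

Definition augmx (R : realType) (d : nat) (A : 'M[R[i]]_d) : 'M[R[i]]_(d + 1) :=
  block_mx A 0 0 0.

Definition augf (R : realType) (d : nat) (F : 'cV[R[i]]_d -> R -> 'cV[R[i]]_d)
    (u : 'cV[R[i]]_d) (t : R) : 'cV[R[i]]_(d + 1) :=
  col_mx (F u t) (const_mx 1).

(* [x] is a complex vector, but its last entry stands for the real time. *)
Definition pderivenf (R : realType) (T : R) (d : nat)
    (F : 'cV[R[i]]_d -> R -> 'cV[R[i]]_d) (b : seq 'I_(d + 1)) (q : 'I_(d + 1))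
    (x : 'cV[R[i]]_(d + 1)) : R[i] :=
  pderiven T b (augf F) (usubmx x) (complex.Re (x (rshift d ord0) 0)) q 0.

Definition nondecreasing_idx (n : nat) (a : seq 'I_n) : bool :=
  sorted leq [seq val q | q <- a].

Definition remove_nth (n : nat) (a : seq 'I_n) (l : nat) : seq 'I_n :=
  take l a ++ drop l.+1 a.

Definition gamma_idx (n : nat) (a : seq 'I_n) : nat :=
  (\prod_(q < n) (count_mem q a)`!)%N.

Definition mono (R : realType) (n : nat) (xh x : 'cV[R[i]]_n) (a : seq 'I_n) :
    R[i] :=
  \prod_(q <- a) (x q 0 - xh q 0).

(* [s] lists once each nondecreasing tuple of length at most [k]: the empty
   one, then those of length 1 in increasing order, then the others in any
   order. In particular [size s] is the dimension D^[k]. *)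
Definition is_listing (n k : nat) (s : seq (seq 'I_n)) : Prop :=
  [/\ uniq s,
      forall a, (a \in s) = (size a <= k)%N && nondecreasing_idx a &
      take n.+1 s = [::] :: [seq [:: q] | q <- enum 'I_n]].

Definition monovec (R : realType) (n : nat) (s : seq (seq 'I_n))
    (xh x : 'cV[R[i]]_n) : 'cV[R[i]]_(size s) :=
  \col_i mono xh x (nth [::] s i).

Definition A1_row (R : realType) (n : nat) (A1 : 'M[R[i]]_n)
    (xh x : 'cV[R[i]]_n) (a : seq 'I_n) : R[i] :=
  \sum_(l < size a) \sum_(m < n)
    A1 (tnth (in_tuple a) l) m * mono xh x (remove_nth a l)
    * ((x m 0 - xh m 0) + xh m 0).

Definition A0_row (R : realType) (T : R) (d k : nat)
    (F : 'cV[R[i]]_d -> R -> 'cV[R[i]]_d)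
    (xh x : 'cV[R[i]]_(d + 1)) (a : seq 'I_(d + 1)) : R[i] :=
  \sum_(l < size a) \sum_(0 <= m < (k - size a + 1).+1)
    \sum_(b : m.-tuple 'I_(d + 1) | nondecreasing_idx b)
      (gamma_idx b)%:R^-1 * pderivenf T F b (tnth (in_tuple a) l) xh
      * mono xh x (remove_nth a l) * mono xh x b.

Definition represents (R : realType) (n : nat) (s : seq (seq 'I_n))
    (xh : 'cV[R[i]]_n) (row : 'cV[R[i]]_n -> seq 'I_n -> R[i])
    (M : 'M[R[i]]_(size s)) : Prop :=
  forall (x : 'cV[R[i]]_n) (i : 'I_(size s)),
    (M *m monovec s xh x) i 0 = row x (nth [::] s i).

Definition e1 (R : realType) (D : nat) : 'cV[R[i]]_D :=
  \col_i (i == 0 :> nat)%:R.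

(* Extracts the components 2, ..., n + 1 of a vector. *)
Definition Pi2 (R : realType) (n D : nat) : 'M[R[i]]_(n, D) :=
  \matrix_(i < n, j < D) (j == i.+1 :> nat)%:R.

Fixpoint lleei (R : realType) (d D : nat) (A1k A0k : 'cV[R[i]]_(d + 1) -> 'M[R[i]]_D)
    (eps h : R) (X0 : 'cV[R[i]]_(d + 1)) (n : nat) : 'cV[R[i]]_(d + 1) :=
  match n with
  | 0%N => X0
  | n'.+1 =>
    let X := lleei A1k A0k eps h X0 n' in
    X + Pi2 R (d + 1) D
        *m expmx (h%:C *: ((eps^-1)%:C *: A1k X + A0k X)) *m e1 R D
  end.

Definition X_init (R : realType) (nu : R) (d : nat) (uin : 'cV[R[i]]_d)
    (eps : R) : 'cV[R[i]]_(d + 1) :=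
  col_mx ((eps `^ nu)%:C *: uin) 0.

Section Representation.
Variables (R : realType) (d k : nat) (s : seq (seq 'I_(d + 1))).
Hypothesis s_listing : is_listing k s.
Variable xh : 'cV[R[i]]_(d + 1).

Let spanned (g : 'cV[R[i]]_(d + 1) -> R[i]) : Prop :=
  exists c : 'I_(size s) -> R[i],
    forall x, g x = \sum_i c i * mono xh x (nth [::] s i).

Let spanned0 : spanned (fun=> 0).
Proof. by exists (fun=> 0) => x; rewrite big1 // => i _; rewrite mul0r. Qed.

Let spannedD f g : spanned f -> spanned g -> spanned (fun x => f x + g x).
Proof.
move=> [c cE] [c' c'E]; exists (fun i => c i + c' i) => x.
by rewrite cE c'E -big_split; apply: eq_bigr => i _; rewrite mulrDl.
Qed.

Let spannedZ a f : spanned f -> spanned (fun x => a * f x).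
Proof.
move=> [c cE]; exists (fun i => a * c i) => x.
by rewrite cE mulr_sumr; apply: eq_bigr => i _; rewrite mulrA.
Qed.

Let spanned_sum I (r : seq I) (P : pred I) (f : I -> 'cV[R[i]]_(d + 1) -> R[i]) :
  (forall j, P j -> spanned (f j)) ->
  spanned (fun x => \sum_(j <- r | P j) f j x).
Proof.
move=> fP; elim: r => [|j r IHr].
  by case: spanned0 => c cE; exists c => x; rewrite big_nil.
case: (boolP (P j)) => Pj; last first.
  by case: IHr => c cE; exists c => x; rewrite big_cons (negbTE Pj).
case: (spannedD (fP j Pj) IHr) => c cE; exists c => x.
by rewrite big_cons Pj.
Qed.

Let spanned_mono a : (size a <= k)%N -> spanned (fun x => mono xh x a).
Proof.
move=> ak; set b := sort (relpre val leq) a.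
have ba : perm_eq b a by rewrite perm_sort.
have bs : b \in s.
  case: s_listing => _ -> _; rewrite size_sort ak /nondecreasing_idx.
  rewrite sorted_map; apply: sort_sorted => p q; exact: leq_total.
exists (fun i => (i == Ordinal (etrans (index_mem b s) bs))%:R) => x.
rewrite (bigD1 (Ordinal (etrans (index_mem b s) bs))) //= eqxx mul1r nth_index //.
rewrite big1 ?addr0 => [|i /negbTE ->]; last by rewrite mul0r.
by apply: perm_big; rewrite perm_sym.
Qed.

Let represented (row : 'cV[R[i]]_(d + 1) -> seq 'I_(d + 1) -> R[i]) :
  (forall a, (size a <= k)%N -> spanned (fun x => row x a)) ->
  exists M, represents xh row (M : 'M[R[i]]_(size s)).
Proof.
move=> rowP.
have /choice[c cE] (i : 'I_(size s)) : exists c : 'I_(size s) -> R[i],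
    forall x, row x (nth [::] s i) = \sum_j c j * mono xh x (nth [::] s j).
  apply: rowP; have := mem_nth [::] (ltn_ord i).
  by case: s_listing => _ -> _ /andP[].
exists (\matrix_(i, j) c i j) => x i.
by rewrite mxE cE; apply: eq_bigr => j _; rewrite !mxE.
Qed.

Let size_remove_nth (a : seq 'I_(d + 1)) (l : 'I_(size a)) :
  (size (remove_nth a l)).+1 = size a.
Proof.
rewrite size_cat size_takel ?size_drop; last by rewrite ltnW.
by rewrite -addnS subnSK // subnKC // ltnW.
Qed.

Lemma A1_row_represented (A1 : 'M[R[i]]_(d + 1)) :
  exists M, represents xh (A1_row A1 xh) (M : 'M[R[i]]_(size s)).
Proof.
apply: represented => a ak; apply: spanned_sum => l _; apply: spanned_sum => m _.
have rk : (size (m :: remove_nth a l) <= k)%N by rewrite /= size_remove_nth.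
case: (spannedD (spannedZ (A1 (tnth (in_tuple a) l) m) (spanned_mono rk))
  (spannedZ (A1 (tnth (in_tuple a) l) m * xh m 0) (spanned_mono (ltnW rk)))).
move=> c cE; exists c => x; rewrite -cE /mono big_cons.
rewrite mulrDr -!mulrA; congr (_ * _ + _ * _); rewrite mulrC //.
Qed.

Lemma A0_row_represented (T : R) (F : 'cV[R[i]]_d -> R -> 'cV[R[i]]_d) :
  exists M, represents xh (A0_row T k F xh) (M : 'M[R[i]]_(size s)).
Proof.
apply: represented => a ak; apply: spanned_sum => l _.
rewrite /A0_row; under boolp.eq_fun do rewrite big_seq_cond.
apply: spanned_sum => m; rewrite andbT mem_index_iota /= => mk.
apply: spanned_sum => b _.
have rk : (size (remove_nth a l ++ b) <= k)%N.
  rewrite ltnS in mk; rewrite size_cat size_tuple.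
  rewrite (leq_trans (leq_add (leqnn _) mk)) // addnCA (addn1 (size _)) size_remove_nth.
  by rewrite subnK.
case: (spannedZ ((gamma_idx b)%:R^-1
  * pderivenf T F b (tnth (in_tuple a) l) xh) (spanned_mono rk)) => c cE.
by exists c => x; rewrite -cE [mono _ _ (_ ++ _)]big_cat mulrA.
Qed.

Let code (a : seq 'I_(d + 1)) := (\sum_(q < d + 1) count_mem q a * expn k.+1 q)%N.

Let digits_inj m (f g : nat -> nat) :
  (forall q, f q <= k)%N -> (forall q, g q <= k)%N ->
  (\sum_(q < m) f q * expn k.+1 q = \sum_(q < m) g q * expn k.+1 q)%N ->
  forall q, (q < m)%N -> f q = g q.
Proof.
elim: m f g => // m IHm f g fk gk.
have shift (h : nat -> nat) : (\sum_(q < m.+1) h q * expn k.+1 q =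
    (\sum_(q < m) h q.+1 * expn k.+1 q) * k.+1 + h 0)%N.
  rewrite big_ord_recl expn0 muln1 addnC big_distrl /=; congr (_ + _)%N.
  by apply: eq_bigr => q _; rewrite /bump /= expnSr mulnA.
rewrite !shift => fg [_|q qm].
  have := congr1 (modn^~ k.+1) fg.
  by rewrite /= !modnMDl !modn_small // ltnS.
have fg' := congr1 (divn^~ k.+1) fg.
rewrite /= !divnMDl // !(divn_small (d := k.+1)) ?ltnS // !addn0 in fg'.
exact: (IHm (fun q => f q.+1) (fun q => g q.+1)).
Qed.

Let code_inj : {in s &, injective code}.
Proof.
case: s_listing => _ sE _ a b; rewrite !sE => /andP[ak asort] /andP[bk bsort].
move=> ab; apply: (inj_map val_inj).
apply: (sorted_eq leq_trans anti_leq) => //; apply: perm_map.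
apply/allP => q _ /=; apply/eqP.
pose cnt (a : seq 'I_(d + 1)) (q : nat) := count_mem q [seq val p | p <- a].
have cntE a' (p : 'I_(d + 1)) : cnt a' p = count_mem p a'.
  by rewrite /cnt count_map; apply: eq_count => p' /=; rewrite val_eqE.
have cntk a' p : (size a' <= k)%N -> (cnt a' p <= k)%N.
  by move=> a'k; rewrite (leq_trans (count_size _ _)) ?size_map.
rewrite -!cntE; apply: (@digits_inj (d + 1)) => // [p|p|]; try exact: cntk.
have codeE a' : (\sum_(p < d + 1) cnt a' p * expn k.+1 p = code a')%N.
  by apply: eq_bigr => p _; rewrite cntE.
by rewrite !codeE ab.
Qed.

Lemma represents_unique row (M M' : 'M[R[i]]_(size s)) :
  represents xh row M -> represents xh row M' -> M = M'.
Proof.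
move=> MP M'P; apply/matrixP => i j; apply/eqP; rewrite -subr_eq0; apply/eqP.
pose p := \sum_(l < size s) (M i l - M' i l) *: 'X^(code (nth [::] s l)).
have pz (z : R[i]) : p.[z] = 0.
  pose x : 'cV[R[i]]_(d + 1) := \col_q (xh q 0 + z ^+ expn k.+1 q).
  have := congr1 (fun c => c - row x (nth [::] s i)) (MP x i).
  rewrite -{1}(M'P x i) subrr => E; rewrite -E !mxE -sumrB horner_sum.
  apply: eq_bigr => l _; rewrite hornerZ hornerXn -mulrBl !mxE; congr (_ * _).
  rewrite /mono /code -prodrXr.
  elim: (nth _ _ _) => [|q a IHa].
    by rewrite big_nil big1.
  rewrite big_cons -IHa mxE addrC addKr (bigD1 q) //= eqxx.
  rewrite [in RHS](bigD1 q) //= mulrA -exprD add1n mulSn; congr (_ * _).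
  by apply: eq_bigr => q' /negbTE q'q; rewrite eq_sym q'q.
have p0 : p = 0.
  apply: (@roots_geq_poly_eq0 _ p [seq m%:R | m <- iota 0 (size p)]).
  - by apply/allP => _ /mapP[m _ ->]; apply/eqP/pz.
  - rewrite map_inj_uniq ?iota_uniq //.
    by move=> m m' /eqP; rewrite eqr_nat => /eqP.
  - by rewrite size_map size_iota.
have := congr1 (fun r : {poly R[i]} => r`_(code (nth [::] s j))) p0.
rewrite coef0 coef_sum (bigD1 j) //= coefZ coefXn eqxx mulr1 big1 ?addr0 //.
move=> l lj; rewrite coefZ coefXn; case: eqP => [/code_inj|]; last by rewrite mulr0.
case: s_listing => us _ _.
move=> /(_ (mem_nth _ (ltn_ord _)) (mem_nth _ (ltn_ord _)))/eqP.
by rewrite nth_uniq // eq_sym val_eqE (negbTE lj).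
Qed.

End Representation.

(* Main.v *)
Require Import Defs.
From HB Require Import structures.
From mathcomp Require Import all_boot all_order all_algebra.
From mathcomp Require Import all_classical all_reals all_analysis.
From mathcomp Require Import complex.
From mathcomp Require Import ring lra.

Set Implicit Arguments.
Unset Strict Implicit.
Unset Printing Implicit Defensive.

Import Order.TTheory GRing.Theory Num.Theory.
Import numFieldNormedType.Exports.

Local Open Scope classical_set_scope.
Local Open Scope ring_scope.
Local Open Scope complex_scope.

(** Let [e] be the error at the beginning of a step. The exact solution shifted by
the free flow [exp (A1 t / eps) e] starts at the numerical value, so its monomials
satisfy the linear system of the scheme up to a remainder [O (|e| + h^(k+1))],
uniformly in [eps]. In the tensor powers of eigen-coordinates of [A1] the stiff part
of that system consists of imaginary diagonal terms and of terms which the factor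
[|X| = O(eps)] compensates, so that Gronwall's inequality is uniform in [eps].

This needs [U_n = O(eps)] along the iteration. The remainder is bounded by
[O (|e| + eps h)], except for the time Taylor remainder of the forcing at [u = 0].
Its resonant components vanish: over a fixed interval the mean of the forcing in
the kernel of [A] is the increment of a solution of size [O(eps)], for every [eps].
The other components oscillate and are absorbed by a corrector of size
[O(eps h^2)]. Hence the error is [O(eps h)] for small [h]; when [h] is bounded
below the number of steps is bounded and a crude estimate of each step is enough.

Taylor sums are expanded one variable at a time, in the order of the nondecreasing
words, so no symmetry of mixed partial derivatives is involved. *)

(** * Complex modulus and derivatives along a real interval *)

(** A comparison with the unshifted exact solution would fail: the scheme expands at [X], so an
    initial error [e] enters the stiff coefficients and costs [|e| / eps]. The free flow solves the
    stiff part exactly with initial value [e]. After the shift, [e] is felt only through the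
    Lipschitz constant of the forcing, and in eigen-coordinates its own propagation multiplies by
    numbers of modulus 1.

    All words up to length [k] are compared at once, because the exponential couples them. Where the
    removal of a letter leaves a word [c], the forcing is truncated at order [k - size c]; the
    [size c] remaining increments supply the missing powers of the step.

    A bound [h ^+ k.+1] on the error does not keep the iterates of size [eps], since [h] may be much
    larger than [eps]. Hence two estimates of each step with the same stability part: [step_E2]
    confines the iterates, then [step_E1] gives the order. The local constants depend on the radius
    [K], so [K] is fixed before the threshold on the step. The corrector divides by single
    eigenvalues only, never by sums of them. *)

Definition nc (R : realType) (z : R[i]) : R := ComplexField.Normc.normc z.
Arguments nc {R} z : simpl never.

Section ComplexModulus.
Variable R : realType.
Implicit Types x y z : R[i].

Lemma normE z : `|z| = (nc z)%:C.
Proof. by []. Qed.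

Lemma nc_ge0 z : 0 <= nc z.
Proof. by case: z => a b; exact: sqrtr_ge0. Qed.

Lemma nc0 : nc 0 = 0 :> R.
Proof. exact: ComplexField.Normc.normc0. Qed.

Lemma nc1 : nc 1 = 1 :> R.
Proof. exact: ComplexField.Normc.normc1. Qed.

Lemma ncD x y : nc (x + y) <= nc x + nc y.
Proof. exact: le_normcD. Qed.

Lemma ncN x : nc (- x) = nc x.
Proof. exact: normcN. Qed.

Lemma ncB x y : nc (x - y) <= nc x + nc y.
Proof. by rewrite -(ncN y) ncD. Qed.

Lemma ncBC x y : nc (x - y) = nc (y - x).
Proof. by rewrite -ncN opprB. Qed.

Lemma ncM x y : nc (x * y) = nc x * nc y.
Proof. exact: ComplexField.Normc.normcM. Qed.

Lemma ncV x : nc x^-1 = (nc x)^-1.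
Proof. exact: ComplexField.Normc.normcV. Qed.

Lemma ncR (a : R) : nc a%:C = `|a|.
Proof. by rewrite /nc /= expr0n addr0 sqrtr_sqr. Qed.

Lemma ncJ x : nc x^* = nc x.
Proof. by case: x => a b; rewrite /nc /= sqrrN. Qed.

Lemma nc_nat (n : nat) : nc (n%:R : R[i]) = n%:R.
Proof. by rewrite -(rmorph_nat (real_complex R)) ncR ger0_norm. Qed.

Lemma nc_eq0 x : nc x <= 0 -> x = 0.
Proof.
move=> x0; apply: ComplexField.Normc.eq0_normc.
by apply/eqP; rewrite eq_le x0 nc_ge0.
Qed.

Lemma nc_sum I (r : seq I) (P : pred I) (f : I -> R[i]) :
  nc (\sum_(i <- r | P i) f i) <= \sum_(i <- r | P i) nc (f i).
Proof.
elim/big_ind2: _ => [|a b c e ab ce|//]; first by rewrite nc0.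
exact: (le_trans (ncD _ _) (lerD ab ce)).
Qed.

Lemma ncX x n : nc (x ^+ n) = nc x ^+ n.
Proof. by elim: n => [|n IH]; rewrite ?expr0 ?nc1 // !exprS ncM IH. Qed.

Lemma ler_Re_nc x : complex.Re x <= nc x.
Proof.
case: x => a b; rewrite /nc /=; apply: (le_trans (ler_norm a)).
by rewrite -sqrtr_sqr ler_wsqrtr // lerDl sqr_ge0.
Qed.

Lemma ReD x y : complex.Re (x + y) = complex.Re x + complex.Re y.
Proof. by case: x y => a b [c d]. Qed.

Lemma ReB x y : complex.Re (x - y) = complex.Re x - complex.Re y.
Proof. by case: x y => a b [c d]. Qed.

Lemma ReRM (a : R) x : complex.Re (a%:C * x) = a * complex.Re x.
Proof. by case: x => c d /=; rewrite mul0r subr0. Qed.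

Lemma Re_mulJ z : z * z^* = ((nc z) ^+ 2)%:C.
Proof. by rewrite rmorphXn /= -normE sqr_normc. Qed.

Lemma addJ x : x + x^* = (2 * complex.Re x)%:C.
Proof. by rewrite addcJ rmorphM /= rmorph_nat. Qed.

End ComplexModulus.

Section Derivatives.
Variable R : realType.
Implicit Types (H t s : R) (f g df dg : R -> R[i]).

(** Derivability on the closed interval, one-sided at its ends. The undivided form needs no limit of
    quotients and restricts at once to shorter intervals. *)
Record hasder H f df : Prop := HasDer { hasder_near : forall t, 0 <= t <= H ->
  forall e : R, 0 < e -> exists2 D : R, 0 < D &
  forall s, 0 <= s <= H -> `|s - t| < D ->
  nc (f s - f t - (s - t)%:C * df t) <= e * `|s - t| }.

Lemma eq_hasder H f f' df df' :
  hasder H f df ->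
  (forall t, 0 <= t <= H -> f t = f' t) ->
  (forall t, 0 <= t <= H -> df t = df' t) ->
  hasder H f' df'.
Proof.
move=> fP ff' dff'; split=> t tH e e0; have [D D0 DP] := hasder_near fP tH e0.
by exists D => // s sH st; rewrite -!ff' // -dff' // DP.
Qed.

Lemma hasder_cst H c : hasder H (fun=> c) (fun=> 0).
Proof.
split=> t tH e e0; exists 1 => // s _ _.
by rewrite subrr mulr0 subr0 nc0 mulr_ge0 // ltW.
Qed.

Lemma hasder_id H : hasder H (fun t => t%:C) (fun=> 1).
Proof.
split=> t tH e e0; exists 1 => // s _ _.
by rewrite mulr1 rmorphB subrr nc0 mulr_ge0 // ltW.
Qed.

Lemma hasderD H f g df dg : hasder H f df -> hasder H g dg ->
  hasder H (fun t => f t + g t) (fun t => df t + dg t).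
Proof.
move=> fP gP; split=> t tH e e0.
have e2 : 0 < e / 2 by rewrite divr_gt0.
have [D D0 DP] := hasder_near fP tH e2; have [D' D'0 DP'] := hasder_near gP tH e2.
exists (Num.min D D'); first by rewrite lt_min D0.
move=> s sH; rewrite lt_min => /andP[sD sD'].
rewrite (_ : _ - _ = (f s - f t - (s - t)%:C * df t)
  + (g s - g t - (s - t)%:C * dg t)); last by ring.
apply: (le_trans (ncD _ _)); apply: (le_trans (lerD (DP _ sH sD) (DP' _ sH sD'))).
by rewrite -mulrDl -splitr.
Qed.

Lemma hasder_lip H f df t : hasder H f df -> 0 <= t <= H ->
  exists2 D, 0 < D & forall s, 0 <= s <= H -> `|s - t| < D ->
  nc (f s - f t) <= (nc (df t) + 1) * `|s - t|.
Proof.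
move=> fP tH; have [D D0 DP] := hasder_near fP tH ltr01; exists D => // s sH sD.
rewrite -[f s - f t](subrK ((s - t)%:C * df t)).
apply: (le_trans (ncD _ _)); rewrite ncM ncR mulrDl addrC.
by rewrite lerD // ?DP // mulrC.
Qed.

Lemma hasderM H f g df dg : hasder H f df -> hasder H g dg ->
  hasder H (fun t => f t * g t) (fun t => df t * g t + f t * dg t).
Proof.
move=> fP gP; split=> t tH e e0.
pose m := nc (f t) + nc (g t) + nc (dg t) + nc (df t) + 2.
have m0 : 0 < m by rewrite !(addr_ge0, ltr_wpDl, nc_ge0).
have e4 : 0 < e / (4 * m) by rewrite divr_gt0 // mulr_gt0.
have [D1 D10 DP1] := hasder_near fP tH e4; have [D2 D20 DP2] := hasder_near gP tH e4.
have [D3 D30 DP3] := hasder_lip fP tH.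
have e5 : 0 < e / (4 * m * m) by rewrite divr_gt0 // !mulr_gt0.
pose D4 := Num.min 1 (e / (4 * m * m)).
exists (Num.min (Num.min D1 D2) (Num.min D3 D4)).
  by rewrite !lt_min D10 D20 D30 e5 ltr01.
move=> s sH; rewrite !lt_min -!andbA => /and5P[s1 s2 s3 s4 s5].
(* Each of the four terms receives a quarter of [e]. The last one is quadratic in the increment,
   whence the radius [e / (4 * m * m)]; the radius 1 gives [nc (f s - f t) <= m] for the second
   one. *)
rewrite (_ : _ - _ = f t * (g s - g t - (s - t)%:C * dg t)
  + (f s - f t) * (g s - g t - (s - t)%:C * dg t)
  + (f s - f t - (s - t)%:C * df t) * g t
  + (s - t)%:C * ((f s - f t) * dg t)); last by ring.
have st0 : 0 <= `|s - t| by [].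
have q1 := DP1 _ sH s1; have q2 := DP2 _ sH s2; have q3 := DP3 _ sH s3.
have [df0 dg0 f0 g0] := And4 (nc_ge0 (df t)) (nc_ge0 (dg t)) (nc_ge0 (f t)) (nc_ge0 (g t)).
have em : e / (4 * m) * m = e / 4 by field; rewrite gt_eqF.
have emm : e / (4 * m * m) * (m * m) = e / 4 by field; rewrite gt_eqF.
have fst : nc (f s - f t) <= m * `|s - t|.
  by apply: (le_trans q3); rewrite ler_wpM2r // /m; lra.
have fst1 : nc (f s - f t) <= m.
  by apply: (le_trans fst); rewrite -[leRHS]mulr1 ler_wpM2l ?(ltW m0) ?(ltW s4).
have b1 : nc (f t) * nc (g s - g t - (s - t)%:C * dg t) <= e / 4 * `|s - t|.
  rewrite -em [e / _ * m]mulrC -mulrA ler_pM ?nc_ge0 // /m; lra.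
have b2 : nc (f s - f t) * nc (g s - g t - (s - t)%:C * dg t) <= e / 4 * `|s - t|.
  by rewrite -em [e / _ * m]mulrC -mulrA ler_pM ?nc_ge0.
have b3 : nc (f s - f t - (s - t)%:C * df t) * nc (g t) <= e / 4 * `|s - t|.
  rewrite -em mulrAC ler_pM ?nc_ge0 // /m; lra.
have b4 : `|s - t| * (nc (f s - f t) * nc (dg t)) <= e / 4 * `|s - t|.
  rewrite mulrC ler_wpM2r //.
  apply: (@le_trans _ _ (m * `|s - t| * m)).
    by rewrite ler_pM ?nc_ge0 // /m; lra.
  by rewrite -emm mulrAC mulrC ler_wpM2r ?mulr_ge0 ?(ltW m0) ?(ltW s5).
apply: (le_trans (ncD _ _)); rewrite [e * _](_ : _ = (e / 4 * `|s - t| + e / 4 * `|s - t|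
  + e / 4 * `|s - t|) + e / 4 * `|s - t|); last by field.
apply: lerD; last by rewrite !ncM ncR.
apply: (le_trans (ncD _ _)); apply: lerD; last by rewrite ncM.
by apply: (le_trans (ncD _ _)); apply: lerD; rewrite ncM.
Qed.

Lemma hasderZ H c f df : hasder H f df ->
  hasder H (fun t => c * f t) (fun t => c * df t).
Proof.
move=> fP; apply: (eq_hasder (hasderM (hasder_cst H c) fP) _ _) => // t _.
by rewrite mul0r add0r.
Qed.

Lemma hasderN H f df : hasder H f df -> hasder H (fun t => - f t) (fun t => - df t).
Proof.
by move=> fP; apply: (eq_hasder (hasderZ (-1) fP) _ _) => // t _; rewrite mulN1r.
Qed.

Lemma hasderB H f g df dg : hasder H f df -> hasder H g dg ->
  hasder H (fun t => f t - g t) (fun t => df t - dg t).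
Proof. by move=> fP gP; exact: hasderD fP (hasderN gP). Qed.

Lemma hasder_sum H I (r : seq I) (P : pred I) (f df : I -> R -> R[i]) :
  (forall i, P i -> hasder H (f i) (df i)) ->
  hasder H (fun t => \sum_(i <- r | P i) f i t) (fun t => \sum_(i <- r | P i) df i t).
Proof.
move=> fP; elim: r => [|i r IH].
  by apply: (eq_hasder (hasder_cst H 0) _ _) => // t _; rewrite big_nil.
case: (boolP (P i)) => Pi.
  by apply: (eq_hasder (hasderD (fP i Pi) IH) _ _) => // t _; rewrite big_cons Pi.
by apply: (eq_hasder IH _ _) => t _; rewrite big_cons (negbTE Pi).
Qed.

Lemma hasderJ H f df : hasder H f df -> hasder H (fun t => (f t)^*) (fun t => (df t)^*).
Proof.
move=> fP; split=> t tH e e0; have [D D0 DP] := hasder_near fP tH e0.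
exists D => // s sH st; rewrite -ncJ.
have cE : ((s - t)%:C)^* = (s - t)%:C by rewrite conjc_real.
move: ((s - t)%:C) cE (DP s sH st) => c cE.
by rewrite !rmorphB rmorphM /= !conjcK cE.
Qed.

Lemma hasderX H f df n : hasder H f df ->
  hasder H (fun t => f t ^+ n) (fun t => n%:R * f t ^+ n.-1 * df t).
Proof.
move=> fP; elim: n => [|n IH].
  by apply: (eq_hasder (hasder_cst H 1) _ _) => // t _; rewrite !mul0r.
apply: (eq_hasder (hasderM fP IH) _ _) => t _; first by rewrite exprS.
case: n {IH} => [|n] /=; first by rewrite expr0 !mulr1 !mul0r mulr0 addr0 mul1r.
by rewrite (mulrS 1 n.+1) exprS; ring.
Qed.

Lemma hasder_le H H' f df : H' <= H -> hasder H f df -> hasder H' f df.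
Proof.
move=> HH fP; split=> t /andP[t0 tH] e e0.
have tH' : 0 <= t <= H by rewrite t0 (le_trans tH).
have [D D0 DP] := hasder_near fP tH' e0.
by exists D => // s /andP[s0 sH] st; rewrite DP // s0 (le_trans sH).
Qed.

Lemma hasder_shift H a f df : 0 <= a -> hasder (a + H) f df ->
  hasder H (fun t => f (a + t)) (fun t => df (a + t)).
Proof.
move=> a0 fP; split=> t /andP[t0 tH] e e0.
have tH' : 0 <= a + t <= a + H by rewrite addr_ge0 //= lerD2l.
have [D D0 DP] := hasder_near fP tH' e0.
exists D => // s /andP[s0 sH] st.
have E : s - t = (a + s) - (a + t) by ring.
by rewrite [in (s - t)%:C]E [in leRHS]E DP -?E // addr_ge0 //= lerD2l.
Qed.

Lemma hasder_unique H f df df' : 0 < H -> hasder H f df -> hasder H f df' ->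
  forall t, 0 <= t <= H -> df t = df' t.
Proof.
move=> H0 fP fP' t tH; apply/eqP; rewrite -subr_eq0; apply/eqP/nc_eq0.
apply/ler_addgt0Pl => e e0; rewrite addr0.
have e2 : 0 < e / 2 by rewrite divr_gt0.
have [D D0 DP] := hasder_near fP tH e2; have [D' D'0 DP'] := hasder_near fP' tH e2.
have [s sH [sD sD' st]] : exists2 s, 0 <= s <= H & [/\ `|s - t| < D, `|s - t| < D' & s != t].
  (* The interval has length at least [2 * m], so it leaves room for a step [m] on one side of
     [t]. *)
  pose m : R := Num.min (Num.min D D') H / 2.
  have m0 : 0 < m by rewrite divr_gt0 // !lt_min D0 D'0.
  have mE : 2 * m = Num.min (Num.min D D') H by rewrite /m mulrC divfK // pnatr_eq0.
  have [mD mD' mH] : [/\ 2 * m <= D, 2 * m <= D' & 2 * m <= H].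
    by rewrite mE !ge_min !lexx ?orbT.
  move: tH => /andP[t0 tH].
  have [tm|tm] := lerP t m.
    exists (t + m); first by apply/andP; split; lra.
    rewrite addrAC subrr add0r gtr0_norm //; split; try lra.
  exists (t - m); first by apply/andP; split; lra.
  rewrite addrAC subrr add0r normrN gtr0_norm //; split; try lra.
have st0 : 0 < `|s - t| by rewrite normr_gt0 subr_eq0.
rewrite -(ler_pM2r st0) -ncR -ncM.
rewrite (_ : _ * _ = (f s - f t - (s - t)%:C * df' t) - (f s - f t - (s - t)%:C * df t));
  last by ring.
apply: (le_trans (ncB _ _)); apply: (le_trans (lerD (DP' _ sH sD') (DP _ sH sD))).
by rewrite ncR -mulrDl -splitr.
Qed.

(** The mean value theorem for the real part. The growth bounds below, Gronwall and Taylor included,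
    reduce to it. *)
Lemma hasder_le0 H f df : 0 <= H -> hasder H f df ->
  (forall t, 0 <= t <= H -> complex.Re (df t) <= 0) ->
  complex.Re (f H) <= complex.Re (f 0).
Proof.
move=> H0 fP df0.
pose g t := complex.Re (f t).
have gP t : 0 <= t <= H -> forall e : R, 0 < e -> exists2 D : R, 0 < D &
    forall s, 0 <= s <= H -> `|s - t| < D ->
    `|g s - g t - (s - t) * complex.Re (df t)| <= e * `|s - t|.
  move=> tH e e0; have [D D0 DP] := hasder_near fP tH e0; exists D => // s sH sD.
  rewrite /g -ReRM -!ReB; apply: le_trans (DP _ sH sD).
  rewrite ler_norml ler_Re_nc andbT lerNl -ncN.
  apply: le_trans (ler_Re_nc _).
  by case: (_ - _ * _).
have cont : {within `[0, H], continuous g}.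
  apply/subspace_continuousP => t; rewrite /= in_itv /= => tH.
  apply/cvgrPdist_le => e e0.
  have [D D0 DP] := gP t tH 1 ltr01.
  pose m := `|complex.Re (df t)| + 1.
  have m0 : 0 < m by rewrite ltr_wpDl.
  have em : 0 < e / m by rewrite divr_gt0.
  apply/nbhs_ballP; exists (Num.min D (e / m)); first by rewrite /= lt_min D0.
  move=> s; rewrite /ball /= lt_min distrC => /andP[sD se]; rewrite in_itv /= => sH.
  rewrite distrC -[g s - g t](subrK ((s - t) * complex.Re (df t))).
  apply: (le_trans (ler_normD _ _)); rewrite normrM.
  apply: (le_trans (lerD (DP _ sH sD) (lexx _))).
  rewrite [_ * `|complex.Re _|]mulrC -mulrDl addrC -/m mulrC -ler_pdivlMr //.
  exact: ltW.
have der t : t \in `]0, H[%R -> is_derive t 1 g (complex.Re (df t)).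
  rewrite in_itv /= => /andP[t0 tH].
  have tH' : 0 <= t <= H by rewrite !ltW.
  have lim : h^-1 *: (g (h *: 1 + t) - g t) @[h --> 0^'] --> complex.Re (df t).
    apply/cvgrPdist_le => e e0.
    have [D D0 DP] := gP t tH' e e0.
    apply/nbhs_ballP; exists (Num.min D (Num.min t (H - t))).
      by rewrite /= !lt_min D0 t0 subr_gt0.
    move=> h; rewrite /ball /= sub0r normrN !lt_min => /and3P[hD ht hH] h0.
    have hE : h *: 1 + t - t = h by rewrite addrK /GRing.scale /= mulr1.
    move: ht hH; rewrite !ltr_norml => /andP[h1 h2] /andP[h3 h4].
    have sH : 0 <= h *: 1 + t <= H.
      by rewrite /GRing.scale /= mulr1; apply/andP; split; lra.
    have := DP (h *: 1 + t); rewrite hE.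
    move=> /(_ sH hD) B; have hp : 0 < `|h| by rewrite normr_gt0.
    rewrite -(ler_pM2r hp) -normrM; apply: le_trans B; rewrite distrC.
    by rewrite mulrBl /GRing.scale /= mulrAC mulVf // mul1r [h * _]mulrC.
  split; last exact: cvg_lim lim.
  by apply/cvg_ex; exists (complex.Re (df t)).
have [c cH E] := MVT_segment H0 der cont; rewrite -subr_le0 -/(g H) -/(g 0) E.
by rewrite subr0 mulr_le0_ge0 ?df0.
Qed.

(* Applied to [f - B t] rotated by the conjugate of the increment. *)
Lemma hasder_bound H f df B : 0 <= H -> hasder H f df ->
  (forall t, 0 <= t <= H -> nc (df t) <= B) -> nc (f H - f 0) <= B * H.
Proof.
move=> H0 fP dfB; set w := f H - f 0.
have [w0|w0] := lerP (nc w) 0.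
  apply: (le_trans w0); apply: mulr_ge0 => //; apply: le_trans (dfB 0 _); rewrite ?nc_ge0 //.
  by rewrite lexx.
have P : hasder H (fun t => w^* * f t - (nc w * B)%:C * t%:C)
    (fun t => w^* * df t - (nc w * B)%:C * 1).
  by apply: hasderB; apply: hasderZ => //; exact: hasder_id.
have := hasder_le0 H0 P; rewrite mulr0 subr0.
have Bt t : 0 <= t <= H -> complex.Re (w^* * df t - (nc w * B)%:C * 1) <= 0.
  move=> tH; rewrite mulr1 ReB subr_le0 /=; apply: (le_trans (ler_Re_nc _)).
  by rewrite ncM ncJ ler_wpM2l ?nc_ge0 ?dfB.
move=> /(_ Bt); rewrite -subr_le0 -ReB (_ : _ - _ = w * w^* - (nc w * B * H)%:C); last first.
  by rewrite [(nc w * B * H)%:C]rmorphM /w; ring.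
by rewrite Re_mulJ -rmorphB /= expr2 -mulrA -mulrBr pmulr_rle0 // subr_le0.
Qed.

Lemma hasder_const H f df : hasder H f df ->
  (forall t, 0 <= t <= H -> df t = 0) -> forall t, 0 <= t <= H -> f t = f 0.
Proof.
move=> fP df0 t /andP[t0 tH]; apply/eqP; rewrite -subr_eq0; apply/eqP/nc_eq0.
rewrite -[leRHS](mul0r t); apply: (hasder_bound t0 (hasder_le tH fP)) => s /andP[s0 st].
by rewrite df0 ?nc0 // s0 (le_trans st).
Qed.

Lemma hasder_real H (g dg : R -> R) : (forall t : R, is_derive t 1 g (dg t)) ->
  hasder H (fun t => (g t)%:C) (fun t => (dg t)%:C).
Proof.
move=> gP; split=> t _ e e0.
have [+ <-] := gP t; move=> dP.
have : h^-1 *: (g (h *: 1 + t) - g t) @[h --> 0^'] --> 'D_1 g t := dP.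
move=> /cvgrPdist_le /(_ e e0) /nbhs_ballP[D /= D0 DP].
exists D => // s _ st.
have -> : (g s)%:C - (g t)%:C - (s - t)%:C * ('D_1 g t)%:C =
    (g s - g t - (s - t) * 'D_1 g t)%:C.
  by rewrite [RHS]rmorphB rmorphM /= [in RHS]rmorphB.
rewrite ncR.
have [->|st0] := eqVneq s t; first by rewrite !subrr mul0r subrr normr0 mulr0.
have := DP (s - t); rewrite /ball /= sub0r normrN [(s - t)%:A]mulr1 subrK => /(_ st).
rewrite subr_eq0 => /(_ st0); have st1 : 0 < `|s - t| by rewrite normr_gt0 subr_eq0.
rewrite -(ler_pM2r st1) -normrM; apply: le_trans.
have -> : (s - t)^-1 *: (g s - g t) = (s - t)^-1 * (g s - g t) by [].
set D1 := 'D_1 g t.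
have -> : (D1 - (s - t)^-1 * (g s - g t)) * (s - t) = - (g s - g t - (s - t) * D1).
  by field; rewrite subr_eq0.
by rewrite normrN.
Qed.

End Derivatives.

(** * Gronwall and Taylor estimates *)

Section Gronwall.
Variable R : realType.
Implicit Types (H t s : R) (f g df dg : R -> R[i]).

(** With the integrating factor [expR (- c * t)], which is at most 1, the real part of the product
    minus [g * t] does not increase. *)
Lemma gronwall H f df (c g : R) : 0 <= H -> 0 <= c -> 0 <= g -> hasder H f df ->
  (forall t, 0 <= t <= H -> complex.Re (df t) <= c * complex.Re (f t) + g) ->
  complex.Re (f 0) <= 0 -> complex.Re (f H) <= g * H * expR (c * H).
Proof.
move=> H0 c0 g0 fP dfP f0.
have eP : hasder H (fun t => (expR (- c * t))%:C) (fun t => (- c * expR (- c * t))%:C).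
  by apply: hasder_real => t; apply: is_derive_eq; rewrite !scaler1 mulrC.
have P := hasderB (hasderM eP fP) (hasderZ g%:C (hasder_id H)).
have := hasder_le0 H0 P; rewrite mulr0 expR0 mul1r mulr0 subr0.
have dle t : 0 <= t <= H -> complex.Re ((- c * expR (- c * t))%:C * f t +
    (expR (- c * t))%:C * df t - g%:C * 1) <= 0.
  move=> tH; rewrite mulr1 ReB ReD !ReRM /=.
  have e0 : 0 < expR (- c * t) by exact: expR_gt0.
  have e1 : expR (- c * t) <= 1.
    by rewrite -expR0 ler_expR mulNr oppr_le0 mulr_ge0 //; case/andP: tH.
  have := ler_wpM2l (ltW e0) (dfP t tH); have := ler_wpM2r g0 e1.
  rewrite mul1r mulrDr [in X in _ -> X -> _]mulrCA => h1 h2.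
  by rewrite mulNr mulNr -mulrA; lra.
move=> /(_ dle) h; have {f0} h := le_trans h f0.
have gH : 0 <= g * H by rewrite mulr_ge0.
move: h; rewrite ReB -rmorphM ReRM /= subr_le0 => h.
rewrite -[leLHS]mul1r -(expRxMexpNx_1 (c * H)) -mulrA [leRHS]mulrC ler_wpM2l ?expR_ge0 //.
by rewrite -mulNr.
Qed.

(* The purely imaginary [th j] do not contribute to the growth of the sum of the
   [nc (z j t) ^+ 2]. *)
Lemma gronwall_skew (J : finType) H (z S : J -> R -> R[i]) (th : J -> R[i]) (c r : R) :
  0 < H -> 0 <= c -> 0 <= r -> (forall j, complex.Re (th j) = 0) ->
  (forall j, hasder H (z j) (fun t => th j * z j t + S j t)) ->
  (forall j, z j 0 = 0) ->
  (forall t B, 0 <= t <= H -> (forall j, nc (z j t) <= B) ->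
    forall j, nc (S j t) <= c * B + r) ->
  forall j, nc (z j H) <= H * r * (#|J|%:R * expR (#|J|%:R * c * H + 1)).
Proof.
move=> H0 c0 r0 thP zP z0 SP j.
set n : R := #|J|%:R; have n0 : 0 <= n by rewrite ler0n.
pose Q t := \sum_i z i t * (z i t)^*.
pose q t := \sum_i nc (z i t) ^+ 2.
have QE t : Q t = (q t)%:C.
  by rewrite /Q /q rmorph_sum; apply: eq_bigr => i _; rewrite Re_mulJ.
have q0 t : 0 <= q t by apply: sumr_ge0 => i _; rewrite sqr_ge0.
have zq t i : nc (z i t) <= Num.sqrt (q t).
  rewrite -(ler_pXn2r (n := 2)) ?nnegrE ?nc_ge0 ?sqrtr_ge0 // sqr_sqrtr // /q.
  by rewrite (bigD1 i) //= lerDl sumr_ge0 // => l _; rewrite sqr_ge0.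
pose dQ t := \sum_i ((th i * z i t + S i t) * (z i t)^* + z i t * (th i * z i t + S i t)^*).
have QP : hasder H Q dQ.
  by apply: hasder_sum => i _; apply: hasderM => //; apply: hasderJ.
have dQP t : 0 <= t <= H ->
    complex.Re (dQ t) <= (2 * n * c + H^-1) * complex.Re (Q t) + n ^+ 2 * r ^+ 2 * H.
  move=> tH; rewrite QE /=; set b := Num.sqrt (q t).
  have b0 : 0 <= b by rewrite sqrtr_ge0.
  have qb : q t = b ^+ 2 by rewrite sqr_sqrtr.
  have term i : complex.Re ((th i * z i t + S i t) * (z i t)^* +
      z i t * (th i * z i t + S i t)^*) <= 2 * ((c * b + r) * b).
    have -> : z i t * (th i * z i t + S i t)^* = ((th i * z i t + S i t) * (z i t)^*)^*.
      by rewrite rmorphM /= conjcK mulrC.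
    rewrite addJ /= ler_pM2l // mulrDl -mulrA Re_mulJ ReD [th i * _]mulrC ReRM thP mulr0 add0r.
    apply: (le_trans (ler_Re_nc _)); rewrite ncM ncJ ler_pM ?nc_ge0 ?zq //.
    exact: (SP _ _ tH (zq t)).
  apply: (@le_trans _ _ (n * (2 * ((c * b + r) * b)))).
    have -> : complex.Re (dQ t) = \sum_i complex.Re ((th i * z i t + S i t) * (z i t)^* +
      z i t * (th i * z i t + S i t)^*).
      by rewrite /dQ; elim/big_rec2: _ => //= i x y _ <-; rewrite ReD.
    by rewrite /n mulr_natl -sumr_const; apply: ler_sum.
  (* Young's inequality for [2 * n * r * b] with weight [H^-1]: over a time [H] this weight only
     costs a factor [expR 1], and the final bound stays proportional to [H * r]. *)
  rewrite qb -subr_ge0 (_ : _ - _ = H * (b / H - n * r) ^+ 2).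
    by rewrite mulr_ge0 ?sqr_ge0 // ltW.
  by field; rewrite gt_eqF.
have cc : 0 <= 2 * n * c + H^-1 by rewrite addr_ge0 ?mulr_ge0 // invr_ge0 ltW.
have gg : 0 <= n ^+ 2 * r ^+ 2 * H by rewrite !mulr_ge0 ?sqr_ge0 // ltW.
have Q0 : complex.Re (Q 0) <= 0.
  by rewrite QE /= /q big1 // => i _; rewrite z0 nc0 expr0n.
have := gronwall (ltW H0) cc gg QP dQP Q0; rewrite QE /= => qH.
apply: (le_trans (zq H j)).
have rhs0 : 0 <= H * r * (n * expR (n * c * H + 1)).
  by rewrite !mulr_ge0 ?expR_ge0 // ltW.
rewrite -(ler_pXn2r (n := 2)) ?nnegrE ?sqrtr_ge0 // sqr_sqrtr //.
apply: (le_trans qH).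
rewrite (_ : (H * r * _) ^+ 2 = n ^+ 2 * r ^+ 2 * H * H * expR (n * c * H + 1) ^+ 2); last by ring.
rewrite ler_wpM2l ?mulr_ge0 ?sqr_ge0 ?(ltW H0) //.
rewrite -expRM_natl ler_expR mulrDl mulVf ?gt_eqF // -[2%:R]/(2 : R).
lra.
Qed.

Lemma hasder_texp H M (c : nat -> R[i]) :
  hasder H (fun t => \sum_(e < M.+1) t%:C ^+ e / e`!%:R * c e)
    (fun t => \sum_(e < M) t%:C ^+ e / e`!%:R * c e.+1).
Proof.
have sP := hasder_sum (index_enum _) (fun (e : 'I_M.+1) (_ : xpredT e) =>
  hasderZ (c e / e`!%:R) (hasderX e (hasder_id H))).
apply: (eq_hasder sP) => t _; first by apply: eq_bigr => e _; ring.
rewrite big_ord_recl /= !mul0r mulr0 add0r; apply: eq_bigr => e _.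
rewrite /bump /= add1n mulr1 factS natrM invfM; field.
by rewrite nat1r !pnatr_eq0 -lt0n fact_gt0.
Qed.

(** The variation of the last derivative stands in for a derivative of order [M + 1], which
    Lipschitz data do not give. The induction applies the estimate to the derivative and integrates
    it, without keeping the factorial. *)
Lemma taylor1 M H (psi : nat -> R -> R[i]) L : 0 <= H ->
  (forall e, (e < M)%N -> hasder H (psi e) (psi e.+1)) ->
  (forall t, 0 <= t <= H -> nc (psi M t - psi M 0) <= L) ->
  nc (psi 0%N H - \sum_(e < M.+1) H%:C ^+ e / e`!%:R * psi e 0) <= L * H ^+ M.
Proof.
elim: M H psi => [|M IH] H psi H0 psiP psiL.
  rewrite big_ord1 !expr0 divr1 mul1r mulr1; apply: psiL.
  by rewrite lexx H0.
pose g t := psi 0%N t - \sum_(e < M.+2) t%:C ^+ e / e`!%:R * psi e 0.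
pose dg t := psi 1%N t - \sum_(e < M.+1) t%:C ^+ e / e`!%:R * psi e.+1 0.
have gP : hasder H g dg.
  by apply: hasderB; [exact: psiP | exact: (hasder_texp H M.+1 (fun e => psi e 0))].
have g0 : g 0 = 0.
  rewrite /g big_ord_recl !expr0 divr1 mul1r big1 ?addr0 ?subrr // => i _.
  by rewrite /bump /= exprS !mul0r.
have -> : psi 0%N H - \sum_(e < M.+2) H%:C ^+ e / e`!%:R * psi e 0 = g H - g 0.
  by rewrite g0 subr0.
rewrite exprSr mulrA; apply: (hasder_bound H0 gP) => t /andP[t0 tH].
have L0 : 0 <= L.
  by apply: le_trans (psiL 0 _); rewrite ?nc_ge0 // lexx.
apply: (@le_trans _ _ (L * t ^+ M)); last by rewrite ler_wpM2l // lerXn2r ?nnegrE.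
apply: (IH t (fun e => psi e.+1) t0) => [e eM|s /andP[s0 st]].
  by apply: hasder_le tH (psiP _ _).
by apply: psiL; rewrite s0 (le_trans st).
Qed.

Definition cis (w : R) (t : R) : R[i] := (cos (w * t))%:C + 'i * (sin (w * t))%:C.

Lemma cis0 w : cis w 0 = 1.
Proof. by rewrite /cis mulr0 cos0 sin0 mulr0 addr0. Qed.

Lemma nc_cis w t : nc (cis w t) = 1.
Proof.
have -> : cis w t = (cos (w * t)) +i* (sin (w * t)).
  by rewrite /cis; apply/eqP; rewrite eq_complex /=; apply/andP; split; apply/eqP; ring.
by rewrite /nc /= cos2Dsin2 sqrtr1.
Qed.

Lemma hasder_cis H w : hasder H (cis w) (fun t => 'i * w%:C * cis w t).
Proof.
have cP : hasder H (fun t => (cos (w * t))%:C) (fun t => (- w * sin (w * t))%:C).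
  by apply: hasder_real => t; apply: is_derive_eq; rewrite !scaler1 mulrC mulrN mulNr.
have sP : hasder H (fun t => (sin (w * t))%:C) (fun t => (w * cos (w * t))%:C).
  by apply: hasder_real => t; apply: is_derive_eq; rewrite !scaler1 mulrC.
apply: (eq_hasder (hasderD cP (hasderZ 'i sP))) => t _ //.
rewrite /cis !rmorphM rmorphN /=.
have i2 : 'i * 'i = -1 :> R[i] by rewrite -expr2 sqr_i.
transitivity ('i * 'i * w%:C * (sin (w * t))%:C + 'i * (w%:C * (cos (w * t))%:C)).
  by rewrite i2 !mulN1r !mulNr.
by ring.
Qed.

End Gronwall.

(** * Tensor powers of a change of coordinates *)

Section Tensors.
Variables (C : comNzRingType) (I : finType).
Implicit Types (N : I -> I -> C) (H G : seq I -> C) (E : I -> seq I -> C).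
Implicit Types (a b c : seq I) (p q : I).

(* The sum over the positions of [a] of [E] applied to the entry there and to
   the remaining word. *)
Fixpoint dsum E a : C :=
  if a is q :: c then E q c + dsum (fun q' c' => E q' (q :: c')) c else 0.

(* The action of the tensor powers of [N]. *)
Fixpoint tens N H b : C :=
  if b is p :: b' then \sum_m N p m * tens N (fun c => H (m :: c)) b' else H [::].

(** Symmetry expressed by adjacent transpositions at any depth; this form passes through [tens] by
    induction on the prefix. *)
Definition swapinv G := forall s p q c, G (s ++ p :: q :: c) = G (s ++ q :: p :: c).

Lemma eq_dsum E E' a :
  (forall q c, (size c).+1 = size a -> E q c = E' q c) -> dsum E a = dsum E' a.
Proof.
elim: a E E' => //= q a IH E E' EE'; rewrite EE' //; congr (_ + _).
by apply: IH => q' c' sc; apply: EE'; rewrite /= sc.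
Qed.

Lemma dsum0 a : dsum (fun _ _ => 0) a = 0.
Proof. by elim: a => //= q a ->; rewrite addr0. Qed.

Lemma dsumD E E' a : dsum (fun q c => E q c + E' q c) a = dsum E a + dsum E' a.
Proof. by elim: a E E' => [|q a IH] E E' /=; rewrite ?addr0 // IH addrACA. Qed.

Lemma dsumZ k E a : dsum (fun q c => k * E q c) a = k * dsum E a.
Proof. by elim: a E => [|q a IH] E /=; rewrite ?mulr0 // IH mulrDr. Qed.

Lemma dsumB E E' a : dsum (fun q c => E q c - E' q c) a = dsum E a - dsum E' a.
Proof.
rewrite -mulN1r -dsumZ -dsumD; apply: eq_dsum => q c _; by rewrite mulN1r.
Qed.

Lemma dsum_sum (J : finType) (k : J -> C) (E : J -> I -> seq I -> C) a :
  dsum (fun q c => \sum_j k j * E j q c) a = \sum_j k j * dsum (E j) a.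
Proof.
elim: a E => [|q a IH] E /=; first by rewrite big1 // => j _; rewrite mulr0.
by rewrite IH -big_split; apply: eq_bigr => j _; rewrite mulrDr.
Qed.

Lemma eq_tens N H G b : (forall c, size c = size b -> H c = G c) ->
  tens N H b = tens N G b.
Proof.
elim: b H G => [|p b IH] H G HG /=; first exact: HG.
apply: eq_bigr => m _; congr (_ * _); apply: IH => c sc.
by apply: HG; rewrite /= sc.
Qed.

Lemma tensD N H G b : tens N (fun c => H c + G c) b = tens N H b + tens N G b.
Proof.
elim: b H G => [//|p b IH] H G /=; rewrite -big_split; apply: eq_bigr => m _.
by rewrite IH mulrDr.
Qed.

Lemma tensZ N k H b : tens N (fun c => k * H c) b = k * tens N H b.
Proof.
elim: b H => [//|p b IH] H /=; rewrite mulr_sumr; apply: eq_bigr => m _.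
by rewrite IH mulrCA.
Qed.

Lemma tens_sum (J : finType) N (k : J -> C) (H : J -> seq I -> C) b :
  tens N (fun c => \sum_j k j * H j c) b = \sum_j k j * tens N (H j) b.
Proof.
elim: b H => [//|p b IH] H /=.
under eq_bigr do rewrite IH mulr_sumr.
rewrite exchange_big; apply: eq_bigr => j _; rewrite mulr_sumr.
by apply: eq_bigr => m _; rewrite mulrCA.
Qed.

(** [N] acts on the letter taken out, and a lower tensor power on the word that is left. This
    carries a system written with [dsum] over to other coordinates. *)
Lemma tens_dsum N E b :
  tens N (dsum E) b =
  dsum (fun p c => tens N (fun c' => \sum_q N p q * E q c') c) b.
Proof.
elim: b E => [//|p b IH] E /=.
under eq_bigr do rewrite tensD mulrDr.
rewrite big_split /= tens_sum; congr (_ + _).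
under eq_bigr do rewrite IH.
by rewrite -dsum_sum.
Qed.

Lemma tens_comp N N' H b :
  tens N' (tens N H) b = tens (fun q m => \sum_r N' q r * N r m) H b.
Proof.
elim: b H => [//|p b IH] H /=.
under eq_bigr do rewrite tens_sum.
under [RHS]eq_bigr do rewrite -IH mulr_suml.
rewrite [RHS]exchange_big; apply: eq_bigr => r _; rewrite mulr_sumr.
by apply: eq_bigr => m _; rewrite mulrA.
Qed.

Lemma tens_id H b : tens (fun q m => (q == m)%:R) H b = H b.
Proof.
elim: b H => [//|p b IH] H /=; rewrite (bigD1 p) //= eqxx mul1r IH.
by rewrite big1 ?addr0 // => m /negbTE; rewrite eq_sym => ->; rewrite mul0r.
Qed.

Lemma tens_inv N N' H b : (forall q m, \sum_r N' q r * N r m = (q == m)%:R) ->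
  tens N' (tens N H) b = H b.
Proof.
move=> NN'; rewrite tens_comp -[RHS]tens_id; congr (tens _ H b).
by apply/funext => q; apply/funext => m; exact: NN'.
Qed.

Lemma tens_prod N (v : I -> C) b :
  tens N (fun c => \prod_(q <- c) v q) b = \prod_(p <- b) \sum_m N p m * v m.
Proof.
elim: b => [|p b IH] /=; first by rewrite !big_nil.
rewrite big_cons -IH mulr_suml; apply: eq_bigr => m _.
by rewrite -mulrA; congr (_ * _); rewrite -tensZ; apply: eq_tens => c _; rewrite big_cons.
Qed.

Lemma swapinv_tens N H : swapinv H -> swapinv (tens N H).
Proof.
move=> HP s; elim: s H HP => [|r s IH] H HP p q c /=.
  under eq_bigr do rewrite mulr_sumr.
  rewrite exchange_big; apply: eq_bigr => m _; rewrite mulr_sumr.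
  apply: eq_bigr => m' _; rewrite mulrCA; congr (_ * (_ * _)).
  by apply: eq_tens => c' _; exact: (HP [::]).
apply: eq_bigr => m _; congr (_ * _); apply: IH => s' p' q' c'.
exact: (HP (m :: s')).
Qed.

(** By symmetry the letter taken out can be put back at its place. So a diagonal matrix acts on the
    component [b] as multiplication by the sum of its eigenvalues over the letters. *)
Lemma dsum_eigen G (w : I -> C) b : swapinv G ->
  dsum (fun p c => w p * G (p :: c)) b = (\sum_(p <- b) w p) * G b.
Proof.
elim: b G => [|q b IH] G GP /=; first by rewrite big_nil mul0r.
rewrite big_cons mulrDl; congr (_ + _).
rewrite -(IH (fun c => G (q :: c))); last by move=> s; exact: (GP (q :: s)).
by apply: eq_dsum => p c _; rewrite (GP [::]).
Qed.

(** The total weight of [b] moves inside the sum, where it splits into the letter taken out and the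
    rest. The offset [w0] holds the letters already passed in the induction. *)
Lemma dsum_weight E (w : I -> C) w0 b :
  (w0 + \sum_(p <- b) w p) * dsum E b =
  dsum (fun p c => (w0 + (w p + \sum_(q <- c) w q)) * E p c) b.
Proof.
elim: b E w0 => [|q b IH] E w0 /=; first by rewrite mulr0.
rewrite big_cons mulrDr; congr (_ + _); rewrite addrA IH; apply: eq_dsum => p c _.
by rewrite big_cons; congr (_ * _); rewrite -!addrA; congr (_ + _); rewrite addrCA.
Qed.

Lemma dsum_rem E a : (forall q c c', perm_eq c c' -> E q c = E q c') ->
  dsum E a = \sum_(q <- a) E q (rem q a).
Proof.
elim: a E => [|q a IH] E EP /=; first by rewrite big_nil.
rewrite big_cons /= eqxx IH => [|p c c' cc']; last by apply: EP; rewrite perm_cons.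
congr (_ + _); rewrite big_seq [RHS]big_seq; apply: eq_bigr => p pa.
move: pa; case: eqVneq => [->|_] // pa; apply: EP; rewrite perm_sym; exact: perm_to_rem.
Qed.

Lemma dsum_perm E a b : (forall q c c', perm_eq c c' -> E q c = E q c') ->
  perm_eq a b -> dsum E a = dsum E b.
Proof.
move=> EP ab; rewrite !dsum_rem // (perm_big _ ab) /= big_seq [RHS]big_seq.
apply: eq_bigr => q qb; apply: EP; rewrite -(perm_cons q).
have qa : q \in a by rewrite (perm_mem ab).
by rewrite -(permPl (perm_to_rem qa)) -(permPr (perm_to_rem qb)).
Qed.

End Tensors.

Lemma dsum_remove_nth (C : comNzRingType) n (E : 'I_n -> seq 'I_n -> C) a :
  \sum_(l < size a) E (tnth (in_tuple a) l) (remove_nth a l) = dsum E a.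
Proof.
elim: a E => [|q a IH] E /=; first by rewrite big_ord0.
rewrite big_ord_recl /= {1}/remove_nth /= drop0; congr (_ + _).
rewrite -IH; apply: eq_bigr => l _; congr (E _ _).
by rewrite !(tnth_nth q) /=.
Qed.

Section TensorBounds.
Variables (R : realType) (I : finType).
Implicit Types (N : I -> I -> R[i]) (H : seq I -> R[i]) (E : I -> seq I -> R[i]).

Lemma nc_dsum E a B : (forall q c, (size c).+1 = size a -> q \in a -> nc (E q c) <= B) ->
  nc (dsum E a) <= (size a)%:R * B.
Proof.
elim: a E => [|q a IH] E EB /=; first by rewrite nc0 mul0r.
rewrite mulrSr mulrDl mul1r [leRHS]addrC; apply: (le_trans (ncD _ _)); apply: lerD.
  by apply: EB; rewrite // mem_head.
by apply: IH => p c sc pa; apply: EB; rewrite /= ?sc // inE pa orbT.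
Qed.

Lemma nc_tens N H b B nu : (forall p, \sum_m nc (N p m) <= nu) ->
  (forall c, size c = size b -> nc (H c) <= B) -> nc (tens N H b) <= nu ^+ size b * B.
Proof.
move=> Nnu; elim: b H => [|p b IH] H HB /=; first by rewrite expr0 mul1r HB.
have P m : nc (tens N (fun c => H (m :: c)) b) <= nu ^+ size b * B.
  by apply: IH => c sc; apply: HB; rewrite /= sc.
apply: (le_trans (nc_sum _ _ _)).
have B0 : 0 <= nu ^+ size b * B by exact: le_trans (nc_ge0 _) (P p).
rewrite exprS -mulrA; apply: le_trans (ler_wpM2r B0 (Nnu p)).
by rewrite mulr_suml; apply: ler_sum => m _; rewrite ncM ler_wpM2l ?nc_ge0.
Qed.

Lemma hasder_tens T N (H dH : R -> seq I -> R[i]) b :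
  (forall c, size c = size b -> hasder T (H^~ c) (dH^~ c)) ->
  hasder T (fun t => tens N (H t) b) (fun t => tens N (dH t) b).
Proof.
elim: b H dH => [|p b IH] H dH HP /=; first exact: HP.
apply: hasder_sum => m _; apply: hasderZ.
apply: (IH (fun t c => H t (m :: c)) (fun t c => dH t (m :: c))) => c sc.
by apply: HP; rewrite /= sc.
Qed.

Lemma hasder_dsum T (E dE : R -> I -> seq I -> R[i]) a :
  (forall q c, (size c).+1 = size a -> hasder T (fun t => E t q c) (fun t => dE t q c)) ->
  hasder T (fun t => dsum (E t) a) (fun t => dsum (dE t) a).
Proof.
elim: a E dE => [|q a IH] E dE EP /=; first exact: hasder_cst.
apply: hasderD; first exact: EP.
apply: (IH (fun t q' c' => E t q' (q :: c')) (fun t q' c' => dE t q' (q :: c'))) => p c sc.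
by apply: EP; rewrite /= sc.
Qed.

Lemma hasder_mono T (x dx : I -> R -> R[i]) a : (forall q, hasder T (x q) (dx q)) ->
  hasder T (fun t => \prod_(q <- a) x q t)
    (fun t => dsum (fun q c => \prod_(p <- c) x p t * dx q t) a).
Proof.
move=> xP; elim: a => [|q a IH] /=.
  by apply: (eq_hasder (hasder_cst T 1)) => t _ //; rewrite big_nil.
apply: (eq_hasder (hasderM (xP q) IH)) => t _; first by rewrite big_cons.
rewrite mulrC -dsumZ; congr (_ + _); apply: eq_dsum => p c _.
by rewrite big_cons mulrA.
Qed.

End TensorBounds.

(** * The matrix exponential *)

Section MatrixTopology.
Variable R : realType.

Lemma pos_complexP (e : R[i]) : 0 < e -> exists2 r : R, 0 < r & e = r%:C.
Proof.
case: e => a b; rewrite ltcE /= => /andP[/eqP b0 a0]; exists a => //.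
by rewrite b0.
Qed.

(** Radii of balls over [R[i]] are positive complex numbers, hence real; this is the entrywise form
    with a radius in [R]. *)
Lemma cvg_mxP (T : Type) (F : set_system T) (FF : Filter F) m n
    (f : T -> ('M[R[i]]_(m, n) : normedModType R[i]))
    (l : ('M[R[i]]_(m, n) : normedModType R[i])) :
  (f x @[x --> F] --> l) <->
  (forall i j (e : R), 0 < e -> \forall x \near F, nc (f x i j - l i j) <= e).
Proof.
split=> [fl i j e e0|fl].
  have eC : (0 : R[i]) < e%:C by rewrite ltcR.
  move/cvg_ballP: fl => /(_ e%:C eC); apply: filterS => x [_ /(_ i j)].
  by rewrite /ball /= normE ltcR ncBC => /ltW.
apply/cvg_ballP => e /pos_complexP[r r0 ->].
have r2 : 0 < r / 2 by rewrite divr_gt0.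
have : \forall x \near F, forall ij : 'I_m * 'I_n, nc (f x ij.1 ij.2 - l ij.1 ij.2) <= r / 2.
  by apply: filter_forall => -[i j]; apply: fl.
apply: filterS => x xP; split; first by rewrite ltcR.
move=> i j; rewrite /ball /= normE ltcR ncBC.
apply: (le_lt_trans (xP (i, j))); lra.
Qed.

Lemma near_nc_unique (T : Type) (F : set_system T) (FF : ProperFilter F) (f : T -> R[i]) a b :
  (forall e : R, 0 < e -> \forall x \near F, nc (f x - a) <= e) ->
  (forall e : R, 0 < e -> \forall x \near F, nc (f x - b) <= e) -> a = b.
Proof.
move=> fa fb; apply/eqP; rewrite -subr_eq0; apply/eqP/nc_eq0.
apply/ler_addgt0Pl => e e0; rewrite addr0.
have e2 : 0 < e / 2 by rewrite divr_gt0.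
have [x [xa xb]] := filter_ex (filterI (fa _ e2) (fb _ e2)).
have -> : a - b = (f x - b) - (f x - a) by ring.
by apply: (le_trans (ncB _ _)); apply: (le_trans (lerD xb xa)); lra.
Qed.

End MatrixTopology.

Section PowerSeries.
Variable R : realType.
Implicit Types (c : nat -> R[i]) (A mu t : R).

Lemma is_cvg_pseries_fact (a : R^nat) A mu t : 0 <= mu ->
  (forall j, `|a j| <= A * mu ^+ j / j`!%:R) -> cvgn (pseries a t).
Proof.
move=> mu0 aP; apply: normed_cvg.
have eP := is_cvg_seriesZ (k := A) (is_cvg_series_exp_coeff (mu * `|t|)).
have A0 : 0 <= A.
  by have := le_trans (normr_ge0 _) (aP 0%N); rewrite expr0 fact0 mulr1 divr1.
apply: (series_le_cvg _ _ _ eP) => n /=.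
- by rewrite normr_ge0.
- by apply: mulr_ge0 => //; rewrite exp_coeff_ge0 // mulr_ge0.
rewrite [leRHS](_ : _ = A * ((mu * `|t|) ^+ n / n`!%:R)) // exprMn normrM normrX.
apply: (@le_trans _ _ (A * mu ^+ n / n`!%:R * `|t| ^+ n)).
  by rewrite ler_wpM2r // exprn_ge0.
by rewrite -!mulrA [_^-1 * _]mulrC lexx.
Qed.

(** Exponential-type coefficients: the class is stable under termwise differentiation and its power
    series converge everywhere. *)
Definition factbnd c := exists A mu, 0 <= mu /\ forall j, nc (c j) <= A * mu ^+ j / j`!%:R.

Definition cdiffs c : nat -> R[i] := fun j => j.+1%:R * c j.+1.

Lemma factbnd_diffs c : factbnd c -> factbnd (cdiffs c).
Proof.
move=> [A [mu [mu0 cP]]]; exists (A * mu), mu; split=> // j.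
rewrite ncM nc_nat; apply: (le_trans (ler_wpM2l _ (cP j.+1))) => //.
rewrite factS natrM exprS; rewrite le_eqVlt; apply/predU1P; left; field.
by rewrite nat1r !pnatr_eq0 -lt0n fact_gt0.
Qed.

Lemma norm_Re_le (z : R[i]) : `|complex.Re z| <= nc z.
Proof.
rewrite ler_norml ler_Re_nc andbT lerNl -ncN; apply: le_trans (ler_Re_nc _).
by case: z.
Qed.

Lemma norm_Im_le (z : R[i]) : `|complex.Im z| <= nc z.
Proof.
by case: z => a b; rewrite /nc /= -sqrtr_sqr ler_wsqrtr // lerDr sqr_ge0.
Qed.

Lemma nc_le_ReIm (z : R[i]) : nc z <= `|complex.Re z| + `|complex.Im z|.
Proof.
case: z => a b /=; have -> : a +i* b = a%:C + 'i * b%:C.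
  by apply/eqP; rewrite eq_complex /=; apply/andP; split; apply/eqP; ring.
apply: (le_trans (ncD _ _)); rewrite ncM !ncR.
have -> : nc ('i : R[i]) = 1 by rewrite /nc /= expr0n expr1n add0r sqrtr1.
by rewrite mul1r.
Qed.

(** Real and imaginary parts are summed separately because the termwise differentiation theorem used
    below concerns real series. *)
Definition cpseries c t : R[i] :=
  limn (pseries (fun j => complex.Re (c j)) t) +i*
  limn (pseries (fun j => complex.Im (c j)) t).

Lemma cpseries_cvg c t : factbnd c -> forall e : R, 0 < e ->
  \forall n \near \oo, nc (\sum_(0 <= j < n) t%:C ^+ j * c j - cpseries c t) <= e.
Proof.
move=> [A [mu [mu0 cP]]] e e0.
have cR : cvgn (pseries (fun j => complex.Re (c j)) t).
  by apply: (is_cvg_pseries_fact mu0 (A := A)) => j; exact: le_trans (norm_Re_le _) (cP j).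
have cI : cvgn (pseries (fun j => complex.Im (c j)) t).
  by apply: (is_cvg_pseries_fact mu0 (A := A)) => j; exact: le_trans (norm_Im_le _) (cP j).
have e2 : 0 < e / 2 by rewrite divr_gt0.
move/cvgrPdist_le: cR => /(_ _ e2) hR; move/cvgrPdist_le: cI => /(_ _ e2) hI.
near=> n; apply: (le_trans (nc_le_ReIm _)).
have -> : \sum_(0 <= j < n) t%:C ^+ j * c j =
    (pseries (fun j => complex.Re (c j)) t n) +i* (pseries (fun j => complex.Im (c j)) t n).
  rewrite /pseries /series /=; elim/big_rec3: _ => // j x y z _ ->.
  rewrite -rmorphXn /=; case: (c j) => a b; rewrite [a * _]mulrC [b * _]mulrC.
  by apply/eqP; rewrite eq_complex /=; apply/andP; split; apply/eqP; ring.
rewrite [leRHS](splitr e) /=; apply: lerD.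
  by rewrite distrC; near: n.
by rewrite distrC; near: n.
Unshelve. all: by end_near.
Qed.

Lemma is_derive_pseries_fact (a : R^nat) A mu t : 0 <= mu ->
  (forall j, `|a j| <= A * mu ^+ j / j`!%:R) ->
  is_derive t (1 : R) (fun x => limn (pseries a x)) (limn (pseries (pseries_diffs a) t)).
Proof.
move=> mu0 aP.
have dP (b : R^nat) B : (forall j, `|b j| <= B * mu ^+ j / j`!%:R) ->
    forall j, `|pseries_diffs b j| <= B * mu * mu ^+ j / j`!%:R.
  move=> bP j; rewrite /pseries_diffs normrM ger0_norm //.
  apply: (le_trans (ler_wpM2l _ (bP j.+1))) => //.
  rewrite factS natrM exprS; rewrite le_eqVlt; apply/predU1P; left; field.
  by rewrite nat1r !pnatr_eq0 -lt0n fact_gt0.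
apply: (@pseries_snd_diffs _ _ (`|t| + 1)).
- exact: is_cvg_pseries_fact aP.
- exact: is_cvg_pseries_fact (dP _ _ aP).
- exact: is_cvg_pseries_fact (dP _ _ (dP _ _ aP)).
- by rewrite [ltRHS]ger0_norm ?ltrDl // addr_ge0.
Qed.

Lemma hasder_cpseries H c : factbnd c -> hasder H (cpseries c) (cpseries (cdiffs c)).
Proof.
move=> [A [mu [mu0 cP]]].
have cE (x y : R) : x +i* y = x%:C + 'i * y%:C.
  by apply/eqP; rewrite eq_complex /=; apply/andP; split; apply/eqP; ring.
have hR := hasder_real H (fun t => is_derive_pseries_fact t mu0
  (fun j => le_trans (norm_Re_le (c j)) (cP j))).
have hI := hasder_real H (fun t => is_derive_pseries_fact t mu0
  (fun j => le_trans (norm_Im_le (c j)) (cP j))).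
apply: (eq_hasder (hasderD hR (hasderZ 'i hI))) => t _.
  by rewrite -cE.
rewrite -cE /cpseries /cdiffs; congr (limn (pseries _ t) +i* limn (pseries _ t)); apply/funext => j.
  rewrite /pseries_diffs -(rmorph_nat (real_complex R)).
  by case: (c j.+1) => a b /=; ring.
rewrite /pseries_diffs -(rmorph_nat (real_complex R)).
by case: (c j.+1) => a b /=; ring.
Qed.

End PowerSeries.

Section MatrixExponential.
Variables (R : realType) (D : nat).
Implicit Types (M : 'M[R[i]]_D) (t : R).

Let coef M i l j : R[i] := (M ^+ j) i l / j`!%:R.

Let coef_bnd M i l : factbnd (coef M i l).
Proof.
pose mu := 1 + \sum_i \sum_l nc (M i l).
have s0 : 0 <= \sum_i \sum_l nc (M i l).
  by apply: sumr_ge0 => ? _; apply: sumr_ge0 => ? _; exact: nc_ge0.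
have mu0 : 0 <= mu by rewrite addr_ge0.
exists 1, mu; split=> // j; rewrite ncM ncV nc_nat mul1r ler_wpM2r ?invr_ge0 //.
elim: j i => [|j IH] i.
  by rewrite !expr0 mxE; case: eqP; rewrite ?nc1 ?nc0 ?ler01.
rewrite exprS mxE; apply: (le_trans (nc_sum _ _ _)).
apply: (@le_trans _ _ (\sum_r nc (M i r) * mu ^+ j)).
  by apply: ler_sum => r _; rewrite ncM ler_wpM2l ?nc_ge0 // IH.
rewrite -mulr_suml exprS ler_wpM2r ?exprn_ge0 // /mu [in leRHS](bigD1 i) //=.
rewrite addrCA lerDl addr_ge0 // sumr_ge0 // => ? _.
by apply: sumr_ge0 => ? _; exact: nc_ge0.
Qed.

Lemma expmx_entry M t i l : expmx (t%:C *: M) i l = cpseries (coef M i l) t.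
Proof.
suff /cvg_lim : series (fun j => (j`!%:R : R[i])^-1 *: (t%:C *: M) ^+ j) n @[n --> \oo]
    --> (\matrix_(i, l) cpseries (coef M i l) t : ('M[R[i]]_D : normedModType R[i])).
  by rewrite /expmx => ->; rewrite ?mxE //; exact: norm_hausdorff.
apply/cvg_mxP => i' l' e e0; rewrite mxE.
apply: filterS (cpseries_cvg t (coef_bnd M i' l') e0) => n.
suff -> : (series (fun j => (j`!%:R : R[i])^-1 *: (t%:C *: M) ^+ j) n) i' l' =
  \sum_(0 <= j < n) t%:C ^+ j * coef M i' l' j by [].
rewrite /series /= summxE; apply: eq_bigr => j _.
have -> : (t%:C *: M) ^+ j = t%:C ^+ j *: M ^+ j.
  elim: j => [|j IH]; first by rewrite !expr0 scale1r.
  by rewrite !exprS IH -!mulmxE -scalemxAl -scalemxAr scalerA.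
rewrite !mxE /coef; ring.
Qed.

Lemma hasder_expmx H M (w : 'cV[R[i]]_D) i :
  hasder H (fun t => (expmx (t%:C *: M) *m w) i 0)
    (fun t => (M *m (expmx (t%:C *: M) *m w)) i 0).
Proof.
have P l : hasder H (fun t => expmx (t%:C *: M) i l)
    (fun t => (M *m expmx (t%:C *: M)) i l).
  apply: (eq_hasder (hasder_cpseries H (coef_bnd M i l))) => t _.
    by rewrite expmx_entry.
  (* The differentiated series and [M] times the series have the same partial sums, hence the same
     limit. *)
  apply: (@near_nc_unique _ _ \oo _ (fun n => \sum_(0 <= j < n) t%:C ^+ j * cdiffs (coef M i l) j)).
    exact: cpseries_cvg (factbnd_diffs (coef_bnd M i l)).
  move=> e e0; pose m := 1 + \sum_r nc (M i r).
  have m0 : 0 < m by rewrite ltr_wpDr ?ltr01 // sumr_ge0 // => r _; exact: nc_ge0.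
  have em : 0 < e / m by rewrite divr_gt0.
  have : \forall n \near \oo, forall r, nc (\sum_(0 <= j < n) t%:C ^+ j * coef M r l j
      - cpseries (coef M r l) t) <= e / m.
    by apply: filter_forall => r; exact: cpseries_cvg (coef_bnd M r l) _ em.
  apply: filterS => n nP.
  have -> : \sum_(0 <= j < n) t%:C ^+ j * cdiffs (coef M i l) j =
      \sum_r M i r * \sum_(0 <= j < n) t%:C ^+ j * coef M r l j.
    under [RHS]eq_bigr do rewrite mulr_sumr.
    rewrite exchange_big /=; apply: eq_bigr => j _.
    rewrite /cdiffs /coef exprS mxE mulr_suml !mulr_sumr; apply: eq_bigr => r _.
    rewrite factS natrM; field.
    by rewrite nat1r !pnatr_eq0 -lt0n fact_gt0.
  rewrite mxE -sumrB; apply: (le_trans (nc_sum _ _ _)).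
  apply: (@le_trans _ _ (\sum_r nc (M i r) * (e / m))).
    by apply: ler_sum => r _; rewrite expmx_entry -mulrBr ncM ler_wpM2l ?nc_ge0.
  rewrite -mulr_suml mulrA ler_pdivrMr // mulrC ler_wpM2l ?(ltW e0) //.
  by rewrite lerDr.
apply: (eq_hasder (hasder_sum (index_enum 'I_D) (P := xpredT)
  (f := fun l t => w l 0 * expmx (t%:C *: M) i l)
  (fun l _ => hasderZ (w l 0) (P l)))) => t _.
  by rewrite mxE; apply: eq_bigr => l _; rewrite mulrC.
by rewrite mulmxA [RHS]mxE; apply: eq_bigr => l _; rewrite mulrC.
Qed.

Lemma expmx0 M : expmx ((0 : R)%:C *: M) = 1%:M.
Proof.
rewrite scale0r; have : series (fun j => (j`!%:R : R[i])^-1 *: (0 : 'M[R[i]]_D) ^+ j) n @[n --> \oo]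
    --> (1%:M : ('M[R[i]]_D : normedModType R[i])).
  apply/cvg_mxP => i l e e0; exists 1%N => // -[//|n] _.
  rewrite /series /= big_nat_recl // expr0 fact0 invr1 scale1r big1 ?addr0.
    by rewrite subrr nc0 ltW.
  by move=> j _; rewrite exprS mul0r scaler0.
by move/cvg_lim; apply; exact: norm_hausdorff.
Qed.

End MatrixExponential.

(** * Listings of words *)

Section Functional.
Variables (R : realType) (d k : nat) (s : seq (seq 'I_(d + 1))).
Hypothesis s_listing : is_listing k s.
Local Notation I := 'I_(d + 1).
Implicit Types (v : 'cV[R[i]]_(size s)) (a b c : seq I) (xh x : 'cV[R[i]]_(d + 1)).

Definition wsort a : seq I := sort (relpre val leq) a.

Lemma perm_wsort a : perm_eq (wsort a) a.
Proof. by rewrite perm_sort. Qed.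

Lemma wsort_perm a b : perm_eq a b -> wsort a = wsort b.
Proof.
move=> ab; apply/perm_sortP => // [p q|p q r|p q].
- exact: leq_total.
- exact: leq_trans.
- by move=> /anti_leq/val_inj.
Qed.

Lemma wsort_in_listing a : (size a <= k)%N -> wsort a \in s.
Proof.
move=> ak; case: s_listing => _ -> _; rewrite size_sort ak /nondecreasing_idx sorted_map.
by apply: sort_sorted => p q; exact: leq_total.
Qed.

Lemma wsort_listing a : a \in s -> wsort a = a.
Proof.
case: s_listing => _ -> _ /andP[_]; rewrite /nondecreasing_idx sorted_map => sa.
by apply: sorted_sort => // p q r; exact: leq_trans.
Qed.

(* A vector indexed by the listing, read as a symmetric function of words. *)
Definition ext v a : R[i] := \sum_(i < size s) (nth [::] s i == wsort a)%:R * v i 0.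

Lemma ext_perm v a b : perm_eq a b -> ext v a = ext v b.
Proof. by move=> /wsort_perm ab; rewrite /ext ab. Qed.

Lemma ext_nth v (i : 'I_(size s)) : ext v (nth [::] s i) = v i 0.
Proof.
have us : uniq s by case: s_listing.
rewrite /ext wsort_listing ?mem_nth // (bigD1 i) //= eqxx mul1r big1 ?addr0 // => j ji.
by rewrite nth_uniq // val_eqE (negbTE ji) mul0r.
Qed.

Lemma ext_index v a (ak : (size a <= k)%N) :
  ext v a = v (Ordinal (etrans (index_mem (wsort a) s) (wsort_in_listing ak))) 0.
Proof.
rewrite -ext_nth /= nth_index ?wsort_in_listing //.
by apply: ext_perm; rewrite perm_sym perm_wsort.
Qed.

Lemma ext_monovec xh x a : (size a <= k)%N -> ext (monovec s xh x) a = mono xh x a.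
Proof.
move=> ak; rewrite (ext_index _ ak) mxE /= nth_index ?wsort_in_listing //.
by apply: perm_big; exact: perm_wsort.
Qed.

Variable xh : 'cV[R[i]]_(d + 1).

(** The matrices are specified only through monomial vectors. The matrix built from the linear word
    operator [L] represents the same rows, so [represents_unique] identifies the two, and [M] acts
    as [L] on every vector, in particular on the flow of the scheme. *)
Lemma represents_ext (row : 'cV[R[i]]_(d + 1) -> seq I -> R[i])
    (L : (seq I -> R[i]) -> seq I -> R[i]) M v (i : 'I_(size s)) :
  represents xh row M ->
  (forall x a, (size a <= k)%N -> row x a = L (mono xh x) a) ->
  (forall H G a, (size a <= k)%N -> (forall b, (size b <= k)%N -> H b = G b) -> L H a = L G a) ->
  (forall (J : finType) (c : J -> R[i]) (H : J -> seq I -> R[i]) a,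
    L (fun b => \sum_j c j * H j b) a = \sum_j c j * L (H j) a) ->
  (M *m v) i 0 = L (ext v) (nth [::] s i).
Proof.
move=> MP rowL Lext Lsum.
have sk (j : 'I_(size s)) : (size (nth [::] s j) <= k)%N.
  by have := mem_nth [::] (ltn_ord j); case: s_listing => _ -> _ /andP[].
pose M' : 'M[R[i]]_(size s) := \matrix_(i, j) L (ext (delta_mx j 0)) (nth [::] s i).
have M'E w j : (M' *m w) j 0 = L (ext w) (nth [::] s j).
  rewrite mxE (eq_bigr (fun l => w l 0 * L (ext (delta_mx l 0)) (nth [::] s j))); last first.
    by move=> l _; rewrite mxE mulrC.
  rewrite -Lsum; apply: Lext => // b _; rewrite /ext.
  apply: eq_bigr => l _; rewrite mulrC (bigD1 l) //= mxE !eqxx mulr1 big1 ?addr0 // => r rl.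
  by rewrite mxE (negbTE rl) mulr0.
suff -> : M = M' by exact: M'E.
apply: (represents_unique s_listing (row := row) (xh := xh)) => // x j.
rewrite M'E rowL //; apply: Lext => // b bk.
by rewrite ext_monovec.
Qed.

(** [stiff] and [jet] are the summands of [A1_row] and [A0_row] at a removed letter [q], with the
    monomials replaced by an arbitrary function [H] of words. *)
Definition stiff (A1 : 'M[R[i]]_(d + 1)) (H : seq I -> R[i]) (q : I) (c : seq I) : R[i] :=
  \sum_m A1 q m * (H (m :: c) + xh m 0 * H c).

Definition jet (coef : seq I -> I -> R[i]) (H : seq I -> R[i]) (q : I) (c : seq I) : R[i] :=
  \sum_(0 <= m < (k - size c).+1) \sum_(b : m.-tuple I | nondecreasing_idx b)
    coef b q * H (c ++ b).

Lemma A1_row_ext A1 M v i : represents xh (A1_row A1 xh) M ->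
  (M *m v) i 0 = dsum (stiff A1 (ext v)) (nth [::] s i).
Proof.
move=> MP; apply: (represents_ext v i MP (L := fun H => dsum (stiff A1 H))).
- move=> x a ak; rewrite -dsum_remove_nth; apply: eq_bigr => l _.
  apply: eq_bigr => m _; rewrite -mulrA; congr (_ * _); rewrite /mono big_cons; ring.
- move=> H G a ak HG; apply: eq_dsum => q c sc; apply: eq_bigr => m _.
  by rewrite !HG //= ?sc // -ltnS sc ltnW.
move=> J c H a; rewrite -dsum_sum; apply: eq_dsum => q b _.
under [RHS]eq_bigr do rewrite mulr_sumr.
rewrite exchange_big; apply: eq_bigr => m _ /=.
rewrite mulrDr !mulr_sumr -big_split; apply: eq_bigr => j _ /=; ring.
Qed.

Lemma jet_sum coef (J : finType) (c : J -> R[i]) (H : J -> seq I -> R[i]) q a :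
  jet coef (fun b => \sum_j c j * H j b) q a = \sum_j c j * jet coef (H j) q a.
Proof.
rewrite /jet.
under [RHS]eq_bigr do rewrite mulr_sumr.
rewrite exchange_big; apply: eq_bigr => m _ /=.
under [RHS]eq_bigr do rewrite mulr_sumr.
rewrite exchange_big; apply: eq_bigr => b _ /=.
by rewrite mulr_sumr; apply: eq_bigr => j _; ring.
Qed.

Lemma eq_jet coef H G q c : (size c <= k)%N ->
  (forall b, (size b <= k)%N -> H b = G b) -> jet coef H q c = jet coef G q c.
Proof.
move=> ck HG; rewrite /jet big_nat [RHS]big_nat; apply: eq_bigr => m /andP[_ mk].
apply: eq_bigr => b _; rewrite HG // size_cat size_tuple -(subnKC ck) leq_add2l.
by rewrite -ltnS.
Qed.

Lemma A0_row_ext T F M v i : represents xh (A0_row T k F xh) M ->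
  (M *m v) i 0 = dsum (jet (fun b q => (gamma_idx b)%:R^-1 * pderivenf T F b q xh) (ext v))
    (nth [::] s i).
Proof.
set coef := fun b q => _.
move=> MP; apply: (represents_ext v i MP (L := fun H => dsum (jet coef H))).
- move=> x a ak; rewrite /A0_row.
  pose E q c := \sum_(0 <= m < (k - size a + 1).+1)
    \sum_(b : m.-tuple I | nondecreasing_idx b) coef b q * mono xh x c * mono xh x b.
  rewrite (dsum_remove_nth E); apply: eq_dsum => q c sc.
  have -> : E q c = \sum_(0 <= m < (k - size c).+1)
    \sum_(b : m.-tuple I | nondecreasing_idx b) coef b q * mono xh x c * mono xh x b.
    by rewrite /E -sc addn1 subnSK // sc.
  apply: eq_bigr => m _; apply: eq_bigr => b _.
  by rewrite -mulrA /mono big_cat.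
- move=> H G a ak HG; apply: eq_dsum => q c sc; apply: eq_jet => //.
  by rewrite -ltnS sc ltnW.
by move=> J c H a; rewrite -dsum_sum; apply: eq_dsum => q b _; exact: jet_sum.
Qed.

Lemma stiff_perm A1 H q c c' : (forall a b, perm_eq a b -> H a = H b) ->
  perm_eq c c' -> stiff A1 H q c = stiff A1 H q c'.
Proof.
move=> HP cc'; apply: eq_bigr => m _.
by rewrite (HP _ _ cc') (HP (m :: c) (m :: c')) // perm_cons.
Qed.

Lemma jet_perm coef H q c c' : (forall a b, perm_eq a b -> H a = H b) ->
  perm_eq c c' -> jet coef H q c = jet coef H q c'.
Proof.
move=> HP cc'; rewrite /jet (perm_size cc'); apply: eq_bigr => m _.
by apply: eq_bigr => b _; congr (_ * _); apply: HP; rewrite perm_cat2r.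
Qed.

Lemma hasder_ext T0 T F A1 A1k A0k (e : R[i]) (w : 'cV[R[i]]_(size s)) a :
  represents xh (A1_row A1 xh) A1k -> represents xh (A0_row T k F xh) A0k ->
  (size a <= k)%N ->
  let y t := expmx (t%:C *: (e *: A1k + A0k)) *m w in
  hasder T0 (fun t => ext (y t) a)
    (fun t => dsum (fun q c => e * stiff A1 (ext (y t)) q c
      + jet (fun b q => (gamma_idx b)%:R^-1 * pderivenf T F b q xh) (ext (y t)) q c) a).
Proof.
move=> A1P A0P ak y.
apply: (eq_hasder (hasder_expmx T0 (e *: A1k + A0k) w
  (Ordinal (etrans (index_mem (wsort a) s) (wsort_in_listing ak))))) => t _.
  by rewrite (ext_index _ ak).
rewrite mulmxDl -scalemxAl mxE [in X in X + _]mxE (A1_row_ext _ _ A1P) (A0_row_ext _ _ A0P).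
rewrite -dsumZ -dsumD /= nth_index ?wsort_in_listing //.
apply: dsum_perm => [q c c' cc'|]; last exact: perm_wsort.
by rewrite (stiff_perm _ _ _ cc') ?(jet_perm _ _ _ cc') // => b b'; exact: ext_perm.
Qed.

End Functional.

(** * Multivariate Taylor polynomials *)

Section Words.
Variable n : nat.
Local Notation I := 'I_n.
Implicit Types (a b : seq I) (vs : seq I) (q : I).

(* The nondecreasing words of length at most [M] over the letters of the
   decreasing sequence [vs]. *)
Fixpoint words vs M : seq (seq I) :=
  if vs is q :: vs' then
    [seq a ++ nseq e q | e <- iota 0 M.+1, a <- words vs' (M - e)%N]
  else [:: [::]].

Definition decreasing_idx vs := sorted (fun p q : I => (q < p)%N) vs.

Lemma decreasing_idx_cons q vs : decreasing_idx (q :: vs) ->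
  decreasing_idx vs /\ forall p, p \in vs -> (p < q)%N.
Proof.
rewrite /decreasing_idx /= => qP; split; first exact: path_sorted qP.
move: qP; rewrite path_sortedE; last by move=> x y z yx xz; exact: ltn_trans xz yx.
by move=> /andP[/allP].
Qed.

Lemma nondecreasing_idxE a : nondecreasing_idx a = sorted (relpre val leq) a.
Proof. by rewrite /nondecreasing_idx sorted_map. Qed.

(** The head of [vs] is its largest letter, so in a nondecreasing word its occurrences form the
    final block; [e] is the length of that block. *)
Lemma mem_words vs M a : decreasing_idx vs ->
  (a \in words vs M) = [&& (size a <= M)%N, nondecreasing_idx a & all (mem vs) a].
Proof.
have tr : transitive (relpre (val : I -> nat) leq) by move=> ? ? ?; exact: leq_trans.
have cat_sorted (e : nat) (q : I) (ws b : seq I) : (forall p, p \in ws -> (p < q)%N) ->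
    nondecreasing_idx b -> all (mem ws) b -> sorted (relpre (val : I -> nat) leq) (b ++ nseq e q).
  move=> qvs; rewrite nondecreasing_idxE => bP bA.
  move: bP; rewrite !(sorted_pairwise tr) pairwise_cat => ->; apply/andP; split.
    apply/allrelP => x y xb /nseqP[-> _] /=; apply: ltnW; apply: qvs.
    exact: (allP bA).
  rewrite -(sorted_pairwise tr); case: e => //= e; elim: e => //= e ->.
  by rewrite leqnn.
elim: vs M a => [|q vs IH] M a.
  move=> _; rewrite /= inE; case: a => //= p a; rewrite !andbF //.
move=> /decreasing_idx_cons[vsP qvs].
apply/allpairsPdep/and3P => [[e [b [eM bP ->]]]|[aM aP aA]].
  move: eM bP; rewrite mem_iota /= add0n ltnS IH // => eM /and3P[bM bP bA].
  have S := cat_sorted e _ _ _ qvs bP bA.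
  split=> //.
  - by rewrite size_cat size_nseq -(subnK eM) leq_add2r.
  - by rewrite nondecreasing_idxE.
  - rewrite all_cat; apply/andP; split.
      by apply/allP => x /(allP bA) /= xvs; rewrite inE xvs orbT.
    by apply/allP => x /nseqP[-> _]; rewrite /= mem_head.
pose e := count_mem q a; pose b := seq.filter (predC1 q) a.
have qE : seq.filter (predC (predC1 q)) a = nseq e q.
  have -> : e = size (seq.filter (predC (predC1 q)) a).
    by rewrite size_filter; apply: eq_count => x /=; rewrite negbK.
  apply/all_pred1P; rewrite (eq_all (a2 := predC (predC1 q))) ?filter_all // => x /=.
  by rewrite negbK.
have pE : perm_eq (b ++ nseq e q) a by rewrite -qE perm_filterC.
have bA : all (mem vs) b.
  apply/allP => x; rewrite mem_filter /= => /andP[xq] /(allP aA) /=.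
  by rewrite inE (negbTE xq).
have bP : nondecreasing_idx b.
  by rewrite nondecreasing_idxE; apply: sorted_filter; rewrite -?nondecreasing_idxE.
have eM : (e <= M)%N by rewrite (leq_trans _ aM) // count_size.
have sz : (size b + e = size a)%N by rewrite -(perm_size pE) size_cat size_nseq.
exists e, b; split; first by rewrite mem_iota ltnS.
  by rewrite IH //; apply/and3P; split => //; rewrite leq_subRL // addnC sz.
apply: (sorted_eq tr) => //.
- by move=> x y /anti_leq/val_inj.
- by rewrite -nondecreasing_idxE.
- exact: (cat_sorted e q vs b qvs bP bA).
by rewrite perm_sym.
Qed.

Lemma words_notin q vs M a : decreasing_idx (q :: vs) -> a \in words vs M -> q \notin a.
Proof.
move=> /decreasing_idx_cons[vsP qvs]; rewrite mem_words // => /and3P[_ _ /allP aA].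
by apply/negP => /aA /= /qvs; rewrite ltnn.
Qed.

Lemma uniq_words vs M : decreasing_idx vs -> uniq (words vs M).
Proof.
elim: vs M => [//|q vs IH] M qP; have [vsP _] := decreasing_idx_cons qP.
apply: allpairs_uniq_dep; first exact: iota_uniq.
  by move=> e _; exact: IH.
have wq (p : {x : nat & seq I}) : p \in
    [seq @Tagged nat x (fun=> seq I) y | x <- iota 0 M.+1, y <- words vs (M - x)%N] ->
    q \notin tagged p.
  by move=> /allpairsPdep[x [y [_ yP ->]]]; exact: words_notin qP yP.
move=> [e a] [e' a'] eP eP' E; have qa := wq _ eP; have qa' := wq _ eP'; rewrite /= in qa qa' E.
have ee : e = e'.
  have := congr1 (count_mem q) E; rewrite !count_cat !count_nseq /= eqxx !mul1n.
  by rewrite (count_memPn qa) (count_memPn qa').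
have sz : size a = size a'.
  by have := congr1 size E; rewrite !size_cat !size_nseq ee; exact: addIn.
by move: E; rewrite -ee => /eqP; rewrite eqseq_cat // => /andP[/eqP -> _].
Qed.

Lemma gamma_idx_cat q e a : q \notin a -> gamma_idx (a ++ nseq e q) = (gamma_idx a * e`!)%N.
Proof.
move=> qa; rewrite /gamma_idx (bigD1 q) //= [in RHS](bigD1 q) //= mulnAC.
rewrite count_cat count_nseq /= eqxx mul1n (count_memPn qa) add0n fact0 mul1n; congr (_ * _)%N.
by apply: eq_bigr => p pq; rewrite count_cat count_nseq /= eq_sym (negbTE pq) addn0.
Qed.

Section TaylorPolynomial.
Variables (F : fieldType) (g : seq I -> F) (del : I -> F).

(* The iterated one-variable Taylor sums, in the order of the sequence [vs];
   [b] is the word of the derivatives already taken. *)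
Fixpoint tpoly vs b M : F :=
  if vs is q :: vs' then
    \sum_(e < M.+1) del q ^+ e / e`!%:R * tpoly vs' (nseq e q ++ b) (M - e)%N
  else g b.

(** The factorials split because the block [nseq e q] holds all occurrences of [q]. It is put next
    to [b], on the side where [pderiven] differentiates first, so the words of derivatives agree
    literally. *)
Lemma tpoly_words vs b M : decreasing_idx vs ->
  tpoly vs b M = \sum_(a <- words vs M) (gamma_idx a)%:R^-1 * g (a ++ b) * \prod_(q <- a) del q.
Proof.
elim: vs b M => [|q vs IH] b M qP.
  rewrite big_seq1 big_nil mulr1 /gamma_idx big1 ?invr1 ?mul1r // => i _.
have [vsP _] := decreasing_idx_cons qP.
have -> : words (q :: vs) M =
    [seq a ++ nseq e q | e <- index_iota 0 M.+1, a <- words vs (M - e)%N].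
  by rewrite /index_iota subn0.
rewrite [LHS]/= big_allpairs_dep big_mkord.
apply: eq_bigr => e _; rewrite IH // mulr_sumr big_seq [RHS]big_seq; apply: eq_bigr => a aP.
have qa := words_notin qP aP.
rewrite gamma_idx_cat // natrM invfM -catA big_cat /=.
rewrite (_ : \prod_(p <- nseq e q) del p = del q ^+ e); first by ring.
by rewrite big_nseq iter_mulr_1.
Qed.

(** Links the sums over tuples in [A0_row] with the recursive enumeration behind [tpoly]. *)
Lemma sum_tuples_words (G : seq I -> F) vs M : decreasing_idx vs -> (forall q, q \in vs) ->
  \sum_(0 <= m < M.+1) \sum_(b : m.-tuple I | nondecreasing_idx b) G b =
  \sum_(a <- words vs M) G a.
Proof.
move=> vsP vsT; rewrite big_mkord.
pose W := [seq val (tagged x) | x : {m : 'I_M.+1 & m.-tuple I} <- enum {: {m : 'I_M.+1 & m.-tuple I}}].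
rewrite (sig_big_dep _ _ (fun (m : 'I_M.+1) (b : m.-tuple I) => G b)) /=.
transitivity (\sum_(a <- seq.filter (fun a => nondecreasing_idx a) W) G a).
  by rewrite big_filter /W big_map big_enum_cond /=.
apply: perm_big; apply: uniq_perm.
- apply: filter_uniq; rewrite map_inj_uniq ?enum_uniq //.
  move=> [m b] [m' b'] /= E.
  have mm : m = m' by apply: val_inj; rewrite /= -(size_tuple b) E size_tuple.
  by rewrite -{m'}mm in b' E *; congr (existT _ _ _); apply: val_inj.
- exact: uniq_words.
move=> a; rewrite mem_filter mem_words //.
have -> : all (mem vs) a by apply/allP => q _; exact: vsT.
rewrite andbT andbC; congr (_ && _); apply/mapP/idP => [[[m b] _ ->] /=|aM].
  by rewrite size_tuple -ltnS.
have aM' : (size a < M.+1)%N by rewrite ltnS.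
exists (existT (fun m : 'I_M.+1 => m.-tuple I) (Ordinal aM') (in_tuple a)) => //.
by rewrite mem_enum.
Qed.

End TaylorPolynomial.

End Words.

Section TaylorEstimate.
Variables (R : realType) (n k : nat) (G : seq 'I_n -> 'cV[R[i]]_n -> R[i]).
Variables (Dom : set 'cV[R[i]]_n) (L : R).
Implicit Types (x : 'cV[R[i]]_n) (z : R[i]) (p q : 'I_n) (b vs : seq 'I_n) (del : 'I_n -> R[i]).

Hypothesis L0 : 0 <= L.
Hypothesis Dom_segment : forall x p z (t : R), 0 <= t <= 1 ->
  Dom x -> Dom (x + z *: delta_mx p 0) -> Dom (x + (t%:C * z) *: delta_mx p 0).
Hypothesis G_der : forall b x p z, (size b < k)%N ->
  Dom x -> Dom (x + z *: delta_mx p 0) ->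
  hasder 1 (fun t => G b (x + (t%:C * z) *: delta_mx p 0))
    (fun t => z * G (p :: b) (x + (t%:C * z) *: delta_mx p 0)).
Hypothesis G_lip : forall b x p z, (size b <= k)%N ->
  Dom x -> Dom (x + z *: delta_mx p 0) -> nc (G b (x + z *: delta_mx p 0) - G b x) <= L * nc z.

(** The complex increment [z] is followed along a real segment, on which the successive derivatives
    are [z ^+ e] times those of [G]; so the one-variable estimate applies on [[0, 1]]. *)
Lemma taylor_coord b x p z M : (size b + M <= k)%N ->
  Dom x -> Dom (x + z *: delta_mx p 0) ->
  nc (G b (x + z *: delta_mx p 0)
      - \sum_(e < M.+1) z ^+ e / e`!%:R * G (nseq e p ++ b) x) <= L * nc z ^+ M.+1.
Proof.
move=> bM xD xzD.
pose psi e (t : R) := z ^+ e * G (nseq e p ++ b) (x + (t%:C * z) *: delta_mx p 0).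
have psiP e : (e < M)%N -> hasder 1 (psi e) (psi e.+1).
  move=> eM; apply: (eq_hasder (hasderZ (z ^+ e) (G_der (b := nseq e p ++ b) _ xD xzD))) => //.
    by rewrite size_cat size_nseq addnC (leq_trans _ bM) // ltn_add2l.
  by move=> t _; rewrite /psi exprSr mulrA.
have psiL t : 0 <= t <= 1 -> nc (psi M t - psi M 0) <= L * nc z ^+ M.+1.
  move=> t01; rewrite /psi mul0r scale0r addr0 -mulrBr ncM ncX exprS.
  rewrite mulrC [L * _]mulrA ler_wpM2r ?exprn_ge0 ?nc_ge0 //.
  apply: (le_trans (G_lip _ xD (Dom_segment t01 xD xzD))).
    by rewrite size_cat size_nseq addnC.
  rewrite ler_wpM2l // ncM ncR ger0_norm; last by case/andP: t01.
  by rewrite ler_piMl ?nc_ge0 //; case/andP: t01.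
have := taylor1 ler01 psiP psiL; rewrite expr1n mulr1.
rewrite {1}/psi expr0 mul1r mul1r; apply: le_trans; rewrite le_eqVlt; apply/predU1P; left.
congr (nc (_ - _)); apply: eq_bigr => e _.
by rewrite /psi expr1n mul0r scale0r addr0 mul1r mulrA; congr (_ * _); rewrite mulrC.
Qed.

Definition pt x del vs := x + \sum_(p <- vs) del p *: delta_mx p 0.

Lemma pt_cons x del q vs : pt x del (q :: vs) = pt x del vs + del q *: delta_mx q 0.
Proof. by rewrite /pt big_cons addrCA addrC. Qed.

Lemma fact_ler (a : R) e : 0 <= a -> a / e`!%:R <= a.
Proof.
move=> a0; rewrite ler_pdivrMr ?ltr0n ?fact_gt0 // ler_peMr // ler1n.
exact: fact_gt0.
Qed.

(** The head variable has its own bound [H], apart from [D]: below, the time increment is of size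
    [t] while those in space are also of size [eps]. *)
Lemma tpoly_cons_bound b x del q vs M D H B : 0 <= H -> 0 <= B -> 0 <= D -> nc (del q) <= H ->
  (forall e, (e <= M)%N -> nc (G (nseq e q ++ b) (pt x del vs)
    - tpoly (fun b => G b x) del vs (nseq e q ++ b) (M - e)) <= B * D ^+ (M - e).+1) ->
  nc (\sum_(e < M.+1) del q ^+ e / e`!%:R * G (nseq e q ++ b) (pt x del vs)
      - tpoly (fun b => G b x) del (q :: vs) b M)
    <= \sum_(e < M.+1) H ^+ e * (B * D ^+ (M - e).+1).
Proof.
move=> H0 B0 D0 dH eP; rewrite /= -sumrB; apply: (le_trans (nc_sum _ _ _)).
apply: ler_sum => e _; rewrite -mulrBr ncM ncM ncX ncV nc_nat.
apply: ler_pM; rewrite ?nc_ge0 ?mulr_ge0 ?exprn_ge0 ?invr_ge0 ?nc_ge0 //.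
  apply: le_trans (fact_ler _ _) _; first by rewrite exprn_ge0 ?nc_ge0.
  by rewrite lerXn2r ?nnegrE ?nc_ge0.
by apply: eP; rewrite -ltnS.
Qed.

(** Along a staircase path: expand in the head variable, then expand each coefficient in the others,
    to order [M - e]. This makes one remainder plus [M + 1 <= k + 1] inherited ones, whence a factor
    [k + 2] per variable. *)
Lemma taylor_multi b x del vs M D : (size b + M <= k)%N -> 0 <= D ->
  (forall i, Dom (pt x del (drop i vs))) -> (forall p, p \in vs -> nc (del p) <= D) ->
  nc (G b (pt x del vs) - tpoly (fun b => G b x) del vs b M)
    <= k.+2%:R ^+ size vs * L * D ^+ M.+1.
Proof.
move=> + D0; elim: vs b M => [|q vs IH] b M bM vsD delD.
  by rewrite /pt big_nil addr0 subrr nc0 !mulr_ge0 // exprn_ge0 //.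
have vsD' i : Dom (pt x del (drop i vs)) := vsD i.+1.
have D1 : Dom (pt x del vs) by have := vsD' 0%N; rewrite drop0.
have D2 : Dom (pt x del vs + del q *: delta_mx q 0) by rewrite -pt_cons; exact: (vsD 0%N).
have dq : nc (del q) <= D by apply: delD; rewrite mem_head.
pose S1 := \sum_(e < M.+1) del q ^+ e / e`!%:R * G (nseq e q ++ b) (pt x del vs).
rewrite -[_ - _](subrKA S1) pt_cons; apply: (le_trans (ncD _ _)).
have c0 : 0 <= k.+2%:R ^+ size vs * L by rewrite mulr_ge0 // exprn_ge0.
have P1 := taylor_coord bM D1 D2.
have P2 : nc (S1 - tpoly (fun b => G b x) del (q :: vs) b M) <=
    \sum_(e < M.+1) D ^+ e * (k.+2%:R ^+ size vs * L * D ^+ (M - e).+1).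
  apply: tpoly_cons_bound => // e eM; apply: IH => //.
    by rewrite size_cat size_nseq addnAC subnKC // addnC.
  by move=> p pvs; apply: delD; rewrite inE pvs orbT.
apply: (le_trans (lerD P1 P2)).
have -> : \sum_(e < M.+1) D ^+ e * (k.+2%:R ^+ size vs * L * D ^+ (M - e).+1) =
    M.+1%:R * (k.+2%:R ^+ size vs * L * D ^+ M.+1).
  rewrite -[in RHS](card_ord M.+1) mulr_natl -sumr_const; apply: eq_bigr => e _.
  have eM : (e <= M)%N by rewrite -ltnS ltn_ord.
  by rewrite mulrCA -exprD addnS subnKC // card_ord.
have dM : nc (del q) ^+ M.+1 <= D ^+ M.+1 by rewrite lerXn2r ?nnegrE ?nc_ge0.
apply: (le_trans (lerD (ler_wpM2l L0 dM) (lexx _))).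
have DM : 0 <= D ^+ M.+1 by rewrite exprn_ge0.
have c1 : 1 <= (k.+2%:R : R) ^+ size vs by rewrite exprn_ege1 // ler1n.
have -> : L * D ^+ M.+1 + M.+1%:R * (k.+2%:R ^+ size vs * L * D ^+ M.+1) =
  (1 + M.+1%:R * k.+2%:R ^+ size vs) * (L * D ^+ M.+1) by ring.
rewrite /= -mulrA ler_wpM2r ?mulr_ge0 // exprS -(nat1r k.+1) mulrDl mul1r lerD //.
by rewrite ler_wpM2r ?exprn_ge0 // ler_nat ltnS (leq_trans _ bM) // leq_addl.
Qed.

End TaylorEstimate.

(** * Partial derivatives of the augmented vector field *)

Section Slopes.
Variable R : realType.

Lemma tnbhsP (T t : R) (P : R -> Prop) : (\forall h \near tnbhs T t, P h) <->
  exists2 D : R, 0 < D & forall h, `|h| < D -> h != 0 -> 0 <= t + h <= T -> P h.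
Proof.
split.
  rewrite /tnbhs /within /= => /nbhs_ballP[D /= D0 DP]; exists D => // h hD h0 hT.
  by apply: DP => //; rewrite /ball /= sub0r normrN.
move=> [D D0 DP]; rewrite /tnbhs /within /=; apply/nbhs_ballP; exists D => // h.
by rewrite /ball /= sub0r normrN => hD h0 hT; exact: DP.
Qed.

Lemma tnbhs_proper (T t : R) : 0 < T -> 0 <= t <= T -> ProperFilter (tnbhs T t).
Proof.
move=> T0 /andP[t0 tT]; apply: Build_ProperFilter_ex.
move=> P /tnbhsP[D D0 DP].
pose m : R := Num.min D T / 2.
have m0 : 0 < m by rewrite divr_gt0 // lt_min D0.
have mE : 2 * m = Num.min D T by rewrite /m mulrC divfK // pnatr_eq0.
have [mD mT] : 2 * m <= D /\ 2 * m <= T by rewrite mE !ge_min !lexx ?orbT.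
have [tm|tm] := lerP t m.
  exists m; apply: DP; rewrite ?gtr0_norm ?gt_eqF //; first lra.
  by apply/andP; split; lra.
exists (- m); apply: DP; rewrite ?normrN ?gtr0_norm ?oppr_eq0 ?gt_eqF //; first lra.
by apply/andP; split; lra.
Qed.

Lemma cnbhsP (P : R[i] -> Prop) : (\forall h \near (0 : (R[i] : numFieldType))^', P h) ->
  exists2 D : R, 0 < D & forall h, nc h < D -> h != 0 -> P h.
Proof.
move=> /nbhs_ballP[_ /pos_complexP[D D0 ->] DP]; exists D => // h hD h0.
by apply: DP => //; rewrite /ball /= sub0r normrN normE ltcR.
Qed.

Lemma hasder_tslope m (T : R) (g dg : R -> 'cV[R[i]]_m) i :
  (forall t, 0 <= t <= T -> tslope g t h @[h --> tnbhs T t] -->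
    (dg t : ('cV[R[i]]_m : normedModType R[i]))) ->
  hasder T (fun t => g t i 0) (fun t => dg t i 0).
Proof.
move=> gP; split=> t tT e e0.
have /cvg_mxP/(_ i 0 e e0)/tnbhsP[D D0 DP] := gP t tT.
exists D => // s sT sD.
have [->|st] := eqVneq s t; first by rewrite !subrr mul0r subrr nc0 normr0 mulr0.
have sE : t + (s - t) = s by ring.
have := DP (s - t) sD; rewrite subr_eq0 sE => /(_ st sT).
rewrite /tslope sE !mxE => B.
have st0 : ((s - t)%:C : R[i]) != 0 by rewrite fmorph_eq0 subr_eq0.
rewrite (_ : _ - _ = (s - t)%:C * (((s - t)^-1)%:C * (g s i 0 - g t i 0) - dg t i 0)).
  by rewrite ncM ncR mulrC ler_wpM2r.
by rewrite mulrBr mulrA fmorphV mulfV // mul1r.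
Qed.

Lemma hasder_derivable d m (g dg : 'cV[R[i]]_d -> 'cV[R[i]]_m) v u (z : R[i]) i :
  (forall u, derivable g u v) -> (forall u, 'D_v g u = dg u) ->
  hasder 1 (fun t => g (u + (t%:C * z) *: v) i 0) (fun t => z * dg (u + (t%:C * z) *: v) i 0).
Proof.
move=> gP dgP; have [->|z0] := eqVneq z 0.
  apply: (eq_hasder (hasder_cst 1 (g u i 0))) => t _; last by rewrite mul0r.
  by rewrite mulr0 scale0r addr0.
split=> t tT e e0; set x := u + _.
have /cvg_mxP : h^-1 *: (g (h *: v + x) - g x) @[h --> (0 : (R[i] : numFieldType))^'] -->
    (dg x : ('cV[R[i]]_m : normedModType R[i])).
  by rewrite -dgP; exact: gP.
have nz : 0 < nc z.
  by rewrite lt_neqAle nc_ge0 andbT eq_sym; apply: contra_neq z0 => zz; apply: nc_eq0; rewrite zz.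
have ez : 0 < e / nc z by rewrite divr_gt0.
move=> /(_ i 0 _ ez)/cnbhsP[D D0 DP].
exists (D / nc z); first by rewrite divr_gt0.
move=> s sT sD.
have [->|st] := eqVneq s t; first by rewrite !subrr !mul0r subrr nc0 normr0 mulr0.
set w : R[i] := (s - t)%:C * z.
have w0 : w != 0 by rewrite mulf_neq0 // fmorph_eq0 subr_eq0.
have wn : nc w = `|s - t| * nc z by rewrite ncM ncR.
have := DP w; rewrite wn -ltr_pdivlMr // => /(_ sD w0).
have -> : w *: v + x = u + (s%:C * z) *: v.
  by rewrite /w /x addrCA -scalerDl -mulrDl -rmorphD subrK.
rewrite !mxE => B.
rewrite (_ : _ - _ = w * (w^-1 * (g (u + (s%:C * z) *: v) i 0 - g x i 0) - dg x i 0)).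
  rewrite ncM wn -mulrA [e * _]mulrC ler_wpM2l //.
  by rewrite mulrC -ler_pdivlMr.
by rewrite [RHS]mulrBr mulVKf // /w mulrA.
Qed.

Lemma scaleB_entry m (c : R[i]) (A B : 'cV[R[i]]_m) i :
  (c *: (A - B)) i 0 = c * (A i 0 - B i 0).
Proof. by rewrite !mxE. Qed.

Lemma derive_col_mx d m n (f : 'cV[R[i]]_d -> 'cV[R[i]]_m) (c : 'cV[R[i]]_n) u v :
  derivable f u v -> derivable (fun u => col_mx (f u) c) u v /\
  'D_v (fun u => col_mx (f u) c) u = col_mx ('D_v f u) 0.
Proof.
move=> fP.
have H : h^-1 *: (col_mx (f (h *: v + u)) c - col_mx (f u) c) @[h --> (0 : (R[i] : numFieldType))^'] -->
    (col_mx ('D_v f u) 0 : ('cV[R[i]]_(m + n) : normedModType R[i])).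
  apply/cvg_mxP => i j e e0; rewrite !ord1.
  have /cvg_mxP : h^-1 *: (f (h *: v + u) - f u) @[h --> (0 : (R[i] : numFieldType))^'] -->
    ('D_v f u : ('cV[R[i]]_m : normedModType R[i])) by exact: fP.
  case: (split_ordP i) => l -> => [/(_ l 0 e e0)|_]; last first.
    by near=> h; rewrite scaleB_entry !col_mxEd mxE subrr mulr0 subr0 nc0 ltW.
  by apply: filterS => h; rewrite !scaleB_entry !col_mxEu.
split; first by apply/cvg_ex; exists (col_mx ('D_v f u) 0).
exact: cvg_lim H.
Unshelve. all: by end_near.
Qed.

Lemma tslope_col_mx m n (T t : R) (f : R -> 'cV[R[i]]_m) g (c : 'cV[R[i]]_n) l :
  (forall t, 0 <= t <= T -> g t = col_mx (f t) c) -> 0 <= t <= T ->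
  tslope f t h @[h --> tnbhs T t] --> (l : ('cV[R[i]]_m : normedModType R[i])) ->
  tslope g t h @[h --> tnbhs T t] --> (col_mx l 0 : ('cV[R[i]]_(m + n) : normedModType R[i])).
Proof.
move=> gE tT fl; apply/cvg_mxP => i j e e0; rewrite !ord1.
case: (split_ordP i) => q ->.
  have /cvg_mxP/(_ q 0 e e0)/tnbhsP[D D0 DP] := fl.
  apply/tnbhsP; exists D => // h hD h0 hT; have := DP h hD h0 hT.
  by rewrite /tslope !gE // !scaleB_entry !col_mxEu.
apply/tnbhsP; exists 1 => // h _ _ hT.
by rewrite /tslope !gE // scaleB_entry !col_mxEd mxE subrr mulr0 subr0 nc0 ltW.
Qed.

End Slopes.

Section Smoothness.
Variables (R : realType) (T : R) (d k : nat) (F : 'cV[R[i]]_d -> R -> 'cV[R[i]]_d).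
Hypothesis T0 : 0 < T.
Hypothesis FP : smooth_lipschitz T k F.
Local Notation I := 'I_(d + 1).
Local Notation tt := (rshift d ord0 : I).
Implicit Types (b : seq I) (q : I) (u : 'cV[R[i]]_d) (t : R).

Lemma pderiven_augf_step b q u t : (size b < k)%N -> 0 <= t <= T ->
  (forall u t, 0 <= t <= T ->
    pderiven T b (augf F) u t = col_mx (pderiven T b F u t) (const_mx (b == [::])%:R)) ->
  pderivable T q (pderiven T b (augf F)) u t /\
  pderiven T (q :: b) (augf F) u t = col_mx (pderiven T (q :: b) F u t) 0.
Proof.
move=> bk tT bE; have := FP.1 b q u t bk tT; rewrite /pderivable /= /pderive.
case: (fintype.split q) => j.
  move=> /(derive_col_mx (const_mx (b == [::])%:R : 'cV_1))[].
  rewrite (_ : (fun u => col_mx _ _) = (pderiven T b (augf F))^~ t) //.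
  by apply/funext => v; rewrite bE.
move=> fl; have pr := tnbhs_proper T0 tT.
have H := tslope_col_mx (fun t tT => bE u t tT) tT fl.
split; first exact: cvgP H.
exact: cvg_lim H.
Qed.

(** The time row of the field is the constant 1, and any derivative turns it into 0. *)
Lemma pderiven_augf b u t : (size b <= k)%N -> 0 <= t <= T ->
  pderiven T b (augf F) u t = col_mx (pderiven T b F u t) (const_mx (b == [::])%:R).
Proof.
elim: b u t => [//|q b IH] u t bk tT.
have [_ ->] := pderiven_augf_step q u bk tT (fun u t => IH u t (ltnW bk)).
by congr col_mx; apply/matrixP => i j; rewrite !mxE.
Qed.

Lemma pderivable_augf b q u t : (size b < k)%N -> 0 <= t <= T ->
  pderivable T q (pderiven T b (augf F)) u t.
Proof.
move=> bk tT.
by have [] := pderiven_augf_step q u bk tT (fun u t => pderiven_augf u (ltnW bk)).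
Qed.

Definition paug b q u t : R[i] := pderiven T b (augf F) u t q 0.

Lemma paug_time b u t : (size b <= k)%N -> 0 <= t <= T ->
  paug b tt u t = (b == [::])%:R.
Proof. by move=> bk tT; rewrite /paug pderiven_augf // col_mxEd mxE. Qed.

Lemma hasder_paug_time b q u : (size b < k)%N ->
  hasder T (paug b q u) (paug (tt :: b) q u).
Proof.
move=> bk; apply: hasder_tslope => t tT.
have := pderivable_augf tt u bk tT; rewrite /pderivable /= /pderive.
by rewrite -[tt]/(unsplit (inr ord0)) unsplitK.
Qed.

Lemma hasder_paug_space b q j u (z : R[i]) t : (size b < k)%N -> 0 <= t <= T ->
  hasder 1 (fun s => paug b q (u + (s%:C * z) *: delta_mx j 0) t)
    (fun s => z * paug (lshift 1 j :: b) q (u + (s%:C * z) *: delta_mx j 0) t).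
Proof.
move=> bk tT; apply: (hasder_derivable (g := (pderiven T b (augf F))^~ t)
  (dg := (pderiven T (lshift 1 j :: b) (augf F))^~ t)) => v.
  have := pderivable_augf (lshift 1 j) v bk tT; rewrite /pderivable.
  by rewrite -[lshift 1 j]/(unsplit (inl j)) unsplitK.
rewrite /= /pderive.
by rewrite -[lshift 1 j]/(unsplit (inl j)) unsplitK.
Qed.

End Smoothness.

Section Uniform.
Variables (R : realType) (I : finType) (k : nat).

(** Words of length at most [k] form the finite type [k.-bseq I], so the constants of single words
    can be added up. *)
Lemma uniform_words (P : seq I -> R -> Prop) :
  (forall b L L', L <= L' -> P b L -> P b L') ->
  (forall b, (size b <= k)%N -> exists L, P b L) ->
  exists2 L, 0 <= L & forall b, (size b <= k)%N -> P b L.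
Proof.
move=> Pmono PP.
have /choice[f fP] (b : k.-bseq I) : exists L, P b L by apply: PP; exact: size_bseq.
exists (\sum_(b : k.-bseq I) `|f b|); first exact: sumr_ge0.
move=> b bk; apply: (Pmono _ (f (Bseq bk))); last exact: (fP (Bseq bk)).
rewrite (bigD1 (Bseq bk)) //=; apply: (le_trans (ler_norm _)).
by rewrite lerDl sumr_ge0.
Qed.

End Uniform.

Section VectorNorm.
Variables (R : realType) (m : nat).
Implicit Types v : 'cV[R[i]]_m.

Lemma enorm_ge0 v : 0 <= enorm v.
Proof. exact: sqrtr_ge0. Qed.

Lemma nc_le_enorm v j : nc (v j 0) <= enorm v.
Proof.
rewrite /enorm -[leLHS](ger0_norm (nc_ge0 _)) -sqrtr_sqr ler_wsqrtr //.
by rewrite (bigD1 j) //= lerDl sumr_ge0 // => i _; exact: sqr_ge0.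
Qed.

Lemma enorm_le_sum v : enorm v <= \sum_j nc (v j 0).
Proof.
have s0 : 0 <= \sum_j nc (v j 0) by apply: sumr_ge0 => j _; exact: nc_ge0.
rewrite /enorm -[leRHS](ger0_norm s0) -sqrtr_sqr ler_wsqrtr // expr2 mulr_suml.
apply: ler_sum => j _; rewrite expr2 ler_wpM2l ?nc_ge0 //.
by rewrite (bigD1 j) //= lerDl sumr_ge0 // => i _; exact: nc_ge0.
Qed.

Lemma sum_nc_le v B : (forall j, nc (v j 0) <= B) -> \sum_j nc (v j 0) <= m%:R * B.
Proof.
move=> vB; apply: (@le_trans _ _ (\sum_(j < m) B)); first exact: ler_sum.
by rewrite sumr_const card_ord mulr_natl.
Qed.

End VectorNorm.

Lemma hasder_affine (R : realType) (T a c : R) (f df : R -> R[i]) : 0 <= a <= T -> 0 <= a + c <= T ->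
  hasder T f df -> hasder 1 (fun t => f (a + t * c)) (fun t => c%:C * df (a + t * c)).
Proof.
move=> aT acT fP; split=> t t01 e e0.
have P s : 0 <= s <= 1 -> 0 <= a + s * c <= T.
  move=> /andP[s0 s1]; move: aT acT => /andP[a0 aT] /andP[ac0 acT].
  have -> : a + s * c = (1 - s) * a + s * (a + c) by ring.
  apply/andP; split; first by rewrite addr_ge0 // mulr_ge0 // subr_ge0.
  have -> : T = (1 - s) * T + s * T by ring.
  by rewrite lerD // ler_wpM2l // subr_ge0.
have c1 : 0 < `|c| + 1 by rewrite ltr_wpDl.
have ec : 0 < e / (`|c| + 1) by rewrite divr_gt0.
have [D D0 DP] := hasder_near fP (P t t01) ec.
exists (D / (`|c| + 1)); first by rewrite divr_gt0.
move=> s s01; rewrite ltr_pdivlMr // => sD.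
have sE : a + s * c - (a + t * c) = (s - t) * c by ring.
have sc : `|s - t| * `|c| <= `|s - t| * (`|c| + 1) by rewrite ler_wpM2l // lerDl.
have := DP _ (P s s01); rewrite sE normrM => /(_ (le_lt_trans sc sD)).
rewrite rmorphM mulrA => B; apply: (le_trans B).
rewrite -mulrA ler_wpM2l ?(ltW e0) // mulrC ler_pdivrMr //.
Qed.

(** * Bounds for the jets of the augmented field on bounded sets *)

Section Jets.
Variables (R : realType) (T : R) (d k : nat) (F : 'cV[R[i]]_d -> R -> 'cV[R[i]]_d).
Hypothesis T0 : 0 < T.
Hypothesis FP : smooth_lipschitz T k F.
Local Notation I := 'I_(d + 1).
Local Notation tt := (rshift d ord0 : I).
Implicit Types (b : seq I) (q p : I) (u v : 'cV[R[i]]_d) (t : R).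

Lemma paug_lip (r : R) : 0 <= r -> exists2 L, 0 <= L & forall b, (size b <= k)%N ->
  forall q u v t s, (forall j, nc (u j 0) <= r) -> (forall j, nc (v j 0) <= r) ->
  0 <= t <= T -> 0 <= s <= T ->
  nc (paug T F b q u t - paug T F b q v s) <= L * (\sum_j nc (u j 0 - v j 0) + `|t - s|).
Proof.
move=> r0; apply: uniform_words => [b L L' LL' LP q u v t s ur vr tT sT|b bk].
  apply: (le_trans (LP q u v t s ur vr tT sT)); rewrite ler_wpM2r // addr_ge0 //.
  by apply: sumr_ge0 => j _; exact: nc_ge0.
(* Entries bounded by [r] give a Euclidean norm of at most [d%:R * r]. *)
have [L LP] := FP.2 b bk (d%:R * r); exists `|L| => q u v t s ur vr tT sT.
have s0 : 0 <= \sum_j nc (u j 0 - v j 0) by apply: sumr_ge0 => j _; exact: nc_ge0.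
have [j ->|j ->] := split_ordP q; last first.
  by rewrite ord1 !(paug_time T0 FP) // subrr nc0 mulr_ge0 // addr_ge0.
rewrite /paug !(pderiven_augf T0 FP) // !col_mxEu.
have -> : pderiven T b F u t j 0 - pderiven T b F v s j 0 =
  (pderiven T b F u t - pderiven T b F v s) j 0 by rewrite !mxE.
apply: (le_trans (nc_le_enorm _ _)).
have uE (w : 'cV[R[i]]_d) : (forall j, nc (w j 0) <= r) -> enorm w <= d%:R * r.
  by move=> wr; apply: (le_trans (enorm_le_sum _)); exact: sum_nc_le.
apply: (le_trans (LP u v t s (uE u ur) (uE v vr) tT sT)).
apply: (@le_trans _ _ (`|L| * Num.sqrt (enorm (u - v) ^+ 2 + (t - s) ^+ 2))).
  by rewrite ler_wpM2r ?sqrtr_ge0 // ler_norm.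
rewrite ler_wpM2l //; apply: (@le_trans _ _ (enorm (u - v) + `|t - s|)).
  have n0 : 0 <= enorm (u - v) + `|t - s| by rewrite addr_ge0 // enorm_ge0.
  rewrite -[leRHS](ger0_norm n0) -sqrtr_sqr; apply: ler_wsqrtr; rewrite [leRHS]sqrrD -addrA lerD2l.
  by rewrite real_normK ?num_real // lerDr mulrn_wge0 // mulr_ge0 // enorm_ge0.
rewrite lerD2r; apply: (le_trans (enorm_le_sum _)); rewrite le_eqVlt; apply/predU1P; left.
by apply: eq_bigr => i _; rewrite !mxE.
Qed.

Lemma paug_bound (r : R) : 0 <= r -> exists2 B, 0 <= B & forall b, (size b <= k)%N ->
  forall q u t, (forall j, nc (u j 0) <= r) -> 0 <= t <= T -> nc (paug T F b q u t) <= B.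
Proof.
move=> r0; have [L L0 LP] := paug_lip r0.
apply: uniform_words => [b B B' BB' BP q u t ur tT|b bk].
  exact: le_trans (BP q u t ur tT) BB'.
exists (\sum_q nc (paug T F b q 0 0) + L * (d%:R * r + T)) => q u t ur tT.
rewrite -[paug _ _ _ _ _ _](subrK (paug T F b q 0 0)) addrC.
apply: (le_trans (ncD _ _)); apply: lerD.
  by rewrite (bigD1 q) //= lerDl sumr_ge0 // => i _; exact: nc_ge0.
have z0 : forall j, nc ((0 : 'cV[R[i]]_d) j 0) <= r by move=> j; rewrite mxE nc0.
have t0 : 0 <= (0 : R) <= T by rewrite lexx ltW.
apply: (le_trans (LP b bk q u 0 t 0 ur z0 tT t0)); rewrite ler_wpM2l // lerD //.
  rewrite -[leRHS]/(_) (eq_bigr (fun j => nc (u j 0))); last by move=> j _; rewrite mxE subr0.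
  exact: sum_nc_le.
by rewrite subr0 ger0_norm; case/andP: tT.
Qed.

(** The time entry must be real and in [[0, T]]: [pderivenf] reads its real part only, and time
    derivatives are relative to that interval. *)
Definition dom (r : R) (x : 'cV[R[i]]_(d + 1)) :=
  (forall j, nc (x (lshift 1 j) 0) <= r) /\
  exists2 t : R, 0 <= t <= T & x tt 0 = t%:C.

Lemma shift_time (x : 'cV[R[i]]_(d + 1)) (z : R[i]) :
  usubmx (x + z *: delta_mx tt 0) = usubmx x /\ (x + z *: delta_mx tt 0) tt 0 = x tt 0 + z.
Proof.
split; last by rewrite !mxE !eqxx mulr1.
by apply/matrixP => i j; rewrite !mxE eq_lrshift mulr0 addr0.
Qed.

Lemma shift_space (x : 'cV[R[i]]_(d + 1)) (z : R[i]) j :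
  usubmx (x + z *: delta_mx (lshift 1 j) 0) = usubmx x + z *: delta_mx j 0 /\
  (x + z *: delta_mx (lshift 1 j) 0) tt 0 = x tt 0.
Proof.
split; last by rewrite !mxE eq_rlshift mulr0 addr0.
by apply/matrixP => i l; rewrite !mxE eq_lshift.
Qed.

Lemma dom_segment r x p (z : R[i]) (t : R) : 0 <= t <= 1 ->
  dom r x -> dom r (x + z *: delta_mx p 0) -> dom r (x + (t%:C * z) *: delta_mx p 0).
Proof.
move=> /andP[t0 t1] [xr [a aT xa]] [xr' [a' aT' xa']]; split.
  move=> j; set y := x (lshift 1 j) 0; set y' := (x + z *: delta_mx p 0) (lshift 1 j) 0.
  have -> : (x + (t%:C * z) *: delta_mx p 0) (lshift 1 j) 0 = (1 - t)%:C * y + t%:C * y'.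
    by rewrite /y' /y !mxE rmorphB /=; ring.
  apply: (le_trans (ncD _ _)); rewrite !ncM !ncR !ger0_norm ?subr_ge0 //.
  have -> : r = (1 - t) * r + t * r by ring.
  by rewrite lerD // ler_wpM2l ?subr_ge0 // ?xr ?xr'.
exists ((1 - t) * a + t * a').
  move: aT aT' => /andP[a0 aT] /andP[a0' aT']; apply/andP; split.
    by rewrite addr_ge0 // mulr_ge0 // subr_ge0.
  have -> : T = (1 - t) * T + t * T by ring.
  by rewrite lerD // ler_wpM2l // subr_ge0.
rewrite rmorphD !rmorphM /= -xa -xa' rmorphB /= !mxE; ring.
Qed.

Lemma hasder_pderivenf r b q x p (z : R[i]) : (size b < k)%N ->
  dom r x -> dom r (x + z *: delta_mx p 0) ->
  hasder 1 (fun t => pderivenf T F b q (x + (t%:C * z) *: delta_mx p 0))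
    (fun t => z * pderivenf T F (p :: b) q (x + (t%:C * z) *: delta_mx p 0)).
Proof.
move=> bk [xr [a aT xa]] [xr' [a' aT' xa']].
have [j pE|j pE] := split_ordP p; rewrite {}pE ?ord1 in xr' xa' *.
  apply: (eq_hasder (hasder_paug_space T0 FP q j (usubmx x) z bk aT)) => t _;
    by rewrite /pderivenf; have [-> ->] := shift_space x (t%:C * z) j; rewrite xa.
have zE : z = (a' - a)%:C.
  by rewrite rmorphB /= -xa -xa'; have [_ ->] := shift_time x z; rewrite addrC addKr.
have aa : 0 <= a + (a' - a) <= T by rewrite addrC subrK.
apply: (eq_hasder (hasder_affine aT aa (hasder_paug_time T0 FP q (usubmx x) bk))) => t _;
  rewrite /pderivenf; have [-> ->] := shift_time x (t%:C * z); rewrite xa zE -rmorphM -rmorphD //.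
Qed.

Lemma pderivenf_lip r : 0 <= r -> exists2 L, 0 <= L & forall b q x p z, (size b <= k)%N ->
  dom r x -> dom r (x + z *: delta_mx p 0) ->
  nc (pderivenf T F b q (x + z *: delta_mx p 0) - pderivenf T F b q x) <= L * nc z.
Proof.
move=> r0; have [L L0 LP] := paug_lip r0; exists L => // b q x p z bk.
move=> [xr [a aT xa]] [xr' [a' aT' xa']].
have ur j : nc (usubmx x j 0) <= r by rewrite mxE.
have ur' j : nc (usubmx (x + z *: delta_mx p 0) j 0) <= r by rewrite mxE.
have := LP b bk q _ _ a' a ur' ur aT' aT.
rewrite /pderivenf xa xa' => H; apply: (le_trans H); rewrite ler_wpM2l //.
move: {H ur' xr'} xa'; have [j ->|j ->] := split_ordP p.
  have [-> ->] := shift_space x z j; rewrite xa => /complexI ->.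
  rewrite subrr normr0 addr0 (bigD1 j) //= big1 => [|l lj].
    by rewrite !mxE !eqxx mulr1 addr0 addrAC subrr add0r.
  by rewrite !mxE (negbTE lj) mulr0 addr0 subrr nc0.
rewrite ord1; have [-> ->] := shift_time x z; rewrite xa => zE.
rewrite big1 => [|l _]; last by rewrite subrr nc0.
have -> : z = a'%:C - a%:C by rewrite -zE; ring.
by rewrite add0r -rmorphB ncR.
Qed.

End Jets.

(** * Eigen-coordinates *)

Section Spectral.
Variables (R : realType) (d : nat).
Local Notation I := 'I_(d + 1).
Local Notation tt := (rshift d ord0 : I).

(* [N] diagonalizes the augmented matrix and leaves the time variable alone. *)
Record spectral (A : 'M[R[i]]_d) (N Ni : I -> I -> R[i]) (lam : I -> R[i]) : Prop := Spectral {
  spectral_inv : forall q m, \sum_r Ni q r * N r m = (q == m)%:R;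
  spectral_invr : forall q m, \sum_r N q r * Ni r m = (q == m)%:R;
  spectral_row : forall p m, \sum_q N p q * augmx A q m = lam p * N p m;
  spectral_col : forall q p, \sum_m augmx A q m * Ni m p = Ni q p * lam p;
  spectral_re : forall p, complex.Re (lam p) = 0;
  spectral_lam_time : lam tt = 0;
  spectral_time_row : forall m, N tt m = (m == tt)%:R;
  spectral_time_col : forall j, N (lshift 1 j) tt = 0;
  spectral_inv_time : forall m, Ni tt m = (m == tt)%:R }.

Lemma diagonalizable_spectral (A : 'M[R[i]]_d) : diagonalizable A ->
  (forall a : R[i], eigenvalue A a -> complex.Re a = 0) ->
  exists N Ni lam, spectral A N Ni lam.
Proof.
move=> [P Pu /diagonalizable_forPex[D /(simmxP Pu) PA]] eA.
pose Nm : 'M[R[i]]_(d + 1) := block_mx P 0 0 1%:M.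
pose Nim : 'M[R[i]]_(d + 1) := block_mx (invmx P) 0 0 1%:M.
pose Dm : 'rV[R[i]]_(d + 1) := row_mx D 0.
have NiN : Nim *m Nm = 1%:M.
  by rewrite mulmx_block !(mulmx0, mul0mx) mulVmx // mulmx1 !addr0 add0r -scalar_mx_block.
have NNi : Nm *m Nim = 1%:M.
  by rewrite mulmx_block !(mulmx0, mul0mx) mulmxV // mulmx1 !addr0 add0r -scalar_mx_block.
have DmE : diag_mx Dm = block_mx (diag_mx D) 0 0 0 by rewrite diag_mx_row [diag_mx 0]linear0.
have NA : Nm *m augmx A = diag_mx Dm *m Nm.
  by rewrite DmE !mulmx_block !(mulmx0, mul0mx) !addr0 PA.
have AN : augmx A *m Nim = Nim *m diag_mx Dm.
  rewrite -[augmx A]mul1mx -NiN -!mulmxA [Nm *m _]mulmxA NA -[diag_mx Dm *m _ *m _]mulmxA.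
  by rewrite NNi mulmx1.
exists (fun q m => Nm q m), (fun q m => Nim q m), (fun p => Dm 0 p); split.
- by move=> q m; have := congr1 (fun M : 'M[R[i]]_(d + 1) => M q m) NiN; rewrite !mxE.
- by move=> q m; have := congr1 (fun M : 'M[R[i]]_(d + 1) => M q m) NNi; rewrite !mxE.
- move=> p m; have := congr1 (fun M : 'M[R[i]]_(d + 1) => M p m) NA.
  by rewrite mul_diag_mx [in LHS]mxE => ->; rewrite mxE.
- move=> q p; have := congr1 (fun M : 'M[R[i]]_(d + 1) => M q p) AN.
  by rewrite mul_mx_diag [in LHS]mxE => ->; rewrite mxE.
- move=> p; have [j ->|j ->] := split_ordP p; last by rewrite row_mxEr mxE.
  rewrite row_mxEl; apply: eA; apply/eigenvalueP; exists (row j P).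
    by apply/rowP => m; rewrite -row_mul PA mul_diag_mx !mxE.
  apply/negP => /eqP P0; have := mulmxV Pu => /(congr1 (row j)); rewrite row_mul P0 mul0mx.
  move=> /rowP/(_ j); rewrite !mxE eqxx => /eqP; rewrite eq_sym oner_eq0 //.
- by rewrite row_mxEr mxE.
- move=> m; have [j ->|j ->] := split_ordP m; first by rewrite block_mxEdl mxE eq_lrshift.
  by rewrite block_mxEdr mxE !ord1 !eqxx.
- by move=> j; rewrite block_mxEur mxE.
- move=> m; have [j ->|j ->] := split_ordP m; first by rewrite block_mxEdl mxE eq_lrshift.
  by rewrite block_mxEdr mxE !ord1 !eqxx.
Qed.

End Spectral.

(** * Absence of resonant forcing *)

Section Resonance.
Variables (R : realType) (d k : nat) (T nu : R).
Variables (A : 'M[R[i]]_d) (uin : 'cV[R[i]]_d) (F : 'cV[R[i]]_d -> R -> 'cV[R[i]]_d).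
Local Notation I := 'I_(d + 1).
Local Notation tt := (rshift d ord0 : I).
Hypothesis T0 : 0 < T.
Hypothesis FP : smooth_lipschitz T k F.

Definition xaug (u : R -> 'cV[R[i]]_d) (t : R) : 'cV[R[i]]_(d + 1) :=
  col_mx (u t) (const_mx t%:C).

Lemma xaug_space u t j : xaug u t (lshift 1 j) 0 = u t j 0.
Proof. by rewrite col_mxEu. Qed.

Lemma xaug_time u t : xaug u t tt 0 = t%:C.
Proof. by rewrite col_mxEd mxE. Qed.

Lemma augmx_time q : augmx A q tt = 0.
Proof.
by have [j ->|j ->] := split_ordP q; rewrite ?block_mxEur ?block_mxEdr mxE.
Qed.

Lemma augmx_time_row m : augmx A tt m = 0.
Proof.
by have [j ->|j ->] := split_ordP m; rewrite ?block_mxEdl ?block_mxEdr mxE.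
Qed.

Lemma hasder_xaug eps u q : is_solution T nu A uin F eps u ->
  hasder T (fun t => xaug u t q 0) (fun t =>
    (eps^-1)%:C * \sum_m augmx A q m * xaug u t m 0 + paug T F [::] q (u t) t).
Proof.
move=> [_ uP]; have [j ->|j ->] := split_ordP q.
  have H := hasder_tslope (g := u) (dg := fun t => (eps^-1)%:C *: (A *m u t) + F (u t) t) j uP.
  apply: (eq_hasder H) => t _; first by rewrite xaug_space.
  rewrite /paug /= /augf col_mxEu !mxE; congr (_ * _ + _).
  rewrite big_split_ord /= [X in _ + X]big1 ?addr0 => [|l _].
    by apply: eq_bigr => l _; rewrite block_mxEul xaug_space.
  by rewrite block_mxEur mxE mul0r.
rewrite ord1; apply: (eq_hasder (hasder_id T)) => t _; first by rewrite xaug_time.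
rewrite big1 ?mulr0 ?add0r => [|m _]; last by rewrite augmx_time_row mul0r.
by rewrite /paug /= /augf col_mxEd mxE.
Qed.

Variables (u : R -> R -> 'cV[R[i]]_d) (C0 : R).
Hypothesis uP : forall eps : R, 0 < eps <= 1 -> is_solution T nu A uin F eps (u eps).
Hypothesis uC : forall eps : R, 0 < eps <= 1 ->
  forall t : R, 0 <= t <= T -> enorm (u eps t) <= C0 * eps.
Variables (N Ni : I -> I -> R[i]) (lam : I -> R[i]).
Hypothesis sp : spectral A N Ni lam.

Lemma C0_ge0 : 0 <= C0.
Proof.
have e1 : 0 < (1 : R) <= 1 by rewrite ltr01 lexx.
have t0 : 0 <= (0 : R) <= T by rewrite lexx ltW.
by have := le_trans (enorm_ge0 _) (uC e1 t0); rewrite mulr1.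
Qed.

(* A resonant component only sees the mean of the forcing, whose size is that of
   the solution, hence [O(eps)] for every [eps]. *)
Lemma resonance j t : lam (lshift 1 j) = 0 -> 0 <= t <= T ->
  \sum_q N (lshift 1 j) q * paug T F [::] q 0 t = 0.
Proof.
move=> lam0 tT; set p := lshift 1 j; set kap := \sum_q _.
have C00 := C0_ge0.
have [L L0 LP] := paug_lip T0 FP C00.
pose nN := \sum_q nc (N p q).
have nN0 : 0 <= nN by apply: sumr_ge0 => q _; exact: nc_ge0.
have z0 i : nc ((0 : 'cV[R[i]]_d) i 0) <= C0 by rewrite mxE nc0.
have sumN (x : I -> R[i]) B : (forall q, nc (x q) <= B) -> nc (\sum_q N p q * x q) <= nN * B.
  move=> xB; apply: (le_trans (nc_sum _ _ _)); rewrite mulr_suml; apply: ler_sum => q _.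
  by rewrite ncM ler_wpM2l ?nc_ge0.
have sumNx eps s : 0 < eps <= 1 -> 0 <= s <= T ->
    nc (\sum_q N p q * xaug (u eps) s q 0) <= nN * (C0 * eps).
  move=> e1 sT; have -> : \sum_q N p q * xaug (u eps) s q 0 =
      \sum_q N p q * (if q == tt then 0 else xaug (u eps) s q 0).
    apply: eq_bigr => q _; case: eqP => // ->.
    by rewrite (spectral_time_col sp) !mul0r.
  apply: sumN => q; have [l ->|l ->] := split_ordP q.
    by rewrite eq_lrshift xaug_space (le_trans (nc_le_enorm _ _)) ?uC.
  by rewrite ord1 eqxx nc0 mulr_ge0 //; case/andP: e1 => /ltW.
(* On a window of length [eta] around [t] the forcing differs from its value at [t] by [O(eta)];
   afterwards [eta] tends to 0. *)
suff main eta : 0 < eta <= T -> nc kap <= nN * (L * eta).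
  apply: nc_eq0; apply/ler_addgt0Pl => e e0; rewrite addr0.
  pose eta := Num.min T (e / (nN * L + 1)).
  have m0 : 0 < nN * L + 1 by rewrite ltr_wpDl ?mulr_ge0.
  have eta0 : 0 < eta <= T by rewrite /eta lt_min T0 divr_gt0 //= ge_min lexx.
  apply: (le_trans (main _ eta0)).
  have : eta <= e / (nN * L + 1) by rewrite /eta ge_min lexx orbT.
  rewrite ler_pdivlMr // mulrA => H; apply: le_trans H.
  by rewrite mulrC ler_wpM2l ?lerDl //; case/andP: eta0 => /ltW.
move=> /andP[eta0 etaT].
have [a [a0 aT at1 at2]] : exists a, [/\ 0 <= a, a + eta <= T, a <= t & t <= a + eta].
  move: tT => /andP[t0 tT]; have [le|le] := lerP t (T - eta).
    by exists t; split=> //; lra.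
  by exists (T - eta); split=> //; lra.
rewrite -(ler_pM2r eta0); apply/ler_addgt0Pl => e e0.
(* [c * eps] collects the effect of reading the forcing at the solution instead of 0, and the two
   end values of the solution. The window being fixed, [eps] is free to tend to 0. *)
pose c := nN * (L * (d%:R * C0)) * eta + 2 * (nN * C0).
have c0 : 0 <= c by rewrite !(addr_ge0, mulr_ge0) // ltW.
pose eps := Num.min 1 (e / (c + 1)).
have m0 : 0 < c + 1 by rewrite ltr_wpDl.
have eps1 : 0 < eps <= 1 by rewrite /eps lt_min ltr01 divr_gt0 //= ge_min lexx.
have ceps : c * eps <= e.
  have : eps <= e / (c + 1) by rewrite /eps ge_min lexx orbT.
  rewrite ler_pdivlMr // mulrC => H; apply: le_trans H.
  by rewrite ler_wpM2r ?lerDl //; case/andP: eps1 => /ltW.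
have eps0 : 0 <= eps by case/andP: eps1 => /ltW.
pose phi s := \sum_q N p q * xaug (u eps) (a + s) q 0 - kap * s%:C.
have phiP : hasder eta phi (fun s => \sum_q N p q *
    (paug T F [::] q (u eps (a + s)) (a + s) - paug T F [::] q 0 t)).
  have H q := hasder_shift a0 (hasder_le aT (hasder_xaug q (uP eps1))).
  have := hasderB (hasder_sum (index_enum I) (P := xpredT)
    (fun q _ => hasderZ (N p q) (H q))) (hasderZ kap (hasder_id eta)).
  move/eq_hasder; apply => s _ //.
  rewrite mulr1 /kap -sumrB.
  (* The row [p] of [N] is a left eigenvector for the eigenvalue 0, so it removes the stiff term. *)
  have E0 : \sum_q N p q * ((eps^-1)%:C * \sum_m augmx A q m * xaug (u eps) (a + s) m 0) = 0.
    transitivity ((eps^-1)%:C * \sum_m (\sum_q N p q * augmx A q m) * xaug (u eps) (a + s) m 0).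
      rewrite mulr_sumr; under eq_bigr do rewrite !mulr_sumr.
      rewrite exchange_big; apply: eq_bigr => m _; rewrite mulr_suml mulr_sumr.
      by apply: eq_bigr => q _; ring.
    rewrite big1 ?mulr0 // => m _.
    by rewrite (spectral_row sp) lam0 !mul0r.
  under eq_bigr do rewrite mulrDr -addrA -mulrBr.
  by rewrite big_split /= E0 add0r.
have phiB s : 0 <= s <= eta -> nc (\sum_q N p q *
    (paug T F [::] q (u eps (a + s)) (a + s) - paug T F [::] q 0 t)) <=
    nN * (L * (d%:R * (C0 * eps) + eta)).
  move=> /andP[s0 s1]; apply: sumN => q.
  have asT : 0 <= a + s <= T by apply/andP; split; lra.
  have ur i : nc (u eps (a + s) i 0) <= C0 * eps by apply: le_trans (nc_le_enorm _ _) _; apply: uC.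
  have ur' i : nc (u eps (a + s) i 0) <= C0.
    by apply: (le_trans (ur i)); rewrite ler_piMr //; case/andP: eps1.
  apply: (le_trans (LP [::] isT q _ _ _ _ ur' z0 asT tT)); rewrite ler_wpM2l // lerD //.
    apply: (@le_trans _ _ (\sum_i nc (u eps (a + s) i 0))); last exact: sum_nc_le.
    by apply: ler_sum => i _; rewrite mxE subr0.
  by rewrite ler_norml; apply/andP; split; lra.
have := hasder_bound (ltW eta0) phiP phiB => B.
have aeT : 0 <= a + eta <= T by apply/andP; split; lra.
have aT' : 0 <= a <= T by apply/andP; split; lra.
have E : kap * eta%:C = \sum_q N p q * xaug (u eps) (a + eta) q 0
    - \sum_q N p q * xaug (u eps) a q 0 - (phi eta - phi 0).
  rewrite /phi addr0 mulr0 subr0; ring.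
have -> : nc kap * eta = nc (kap * eta%:C) by rewrite ncM ncR gtr0_norm.
rewrite E; apply: (le_trans (ncB _ _)).
have B2 := le_trans (ncB _ _) (lerD (sumNx _ _ eps1 aeT) (sumNx _ _ eps1 aT')).
apply: (le_trans (lerD B2 B)); apply: le_trans (lerD ceps (lexx _)).
by rewrite le_eqVlt; apply/predU1P; left; rewrite /c; ring.
Qed.

End Resonance.

(** * One step of the scheme *)

Section VariableOrder.
Variable d : nat.
Local Notation I := 'I_(d + 1).

(* Space variables in decreasing order; the time is the largest variable, so the
   scheme takes the time derivatives first. *)
Definition space_vars : seq I := rev [seq lshift 1 j | j <- enum 'I_d].
Definition all_vars : seq I := rshift d ord0 :: space_vars.

Lemma val_rev_all_vars : [seq val q | q <- rev all_vars] = iota 0 d.+1.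
Proof.
rewrite /all_vars rev_cons revK map_rcons -map_comp.
rewrite (eq_map (g := val)) // val_enum_ord -[in RHS](addn1 d) iotaD add0n -cats1.
by congr (_ ++ [:: _]); rewrite /= addn0.
Qed.

Lemma all_vars_decreasing : decreasing_idx all_vars.
Proof.
rewrite /decreasing_idx -[all_vars]revK rev_sorted.
by have := iota_ltn_sorted 0 d.+1; rewrite -val_rev_all_vars sorted_map.
Qed.

Lemma uniq_all_vars : uniq all_vars.
Proof. by rewrite -rev_uniq -(map_inj_uniq val_inj) val_rev_all_vars iota_uniq. Qed.

Lemma mem_all_vars q : q \in all_vars.
Proof.
have [j ->|j ->] := split_ordP q; rewrite inE ?ord1 ?eqxx //.
by rewrite mem_rev map_f ?orbT // mem_enum.
Qed.

Lemma time_notin_space : rshift d ord0 \notin space_vars.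
Proof. by have := uniq_all_vars; rewrite /= => /andP[]. Qed.

Lemma size_space_vars : size space_vars = d.
Proof. by rewrite size_rev size_map size_enum_ord. Qed.

End VariableOrder.

Lemma pt_entry (R : realType) n (x : 'cV[R[i]]_n) del ws p : uniq ws ->
  pt x del ws p 0 = x p 0 + (p \in ws)%:R * del p.
Proof.
rewrite /pt mxE summxE => uw; congr (_ + _); elim: ws uw => [_|q ws IH /= /andP[qw uw]].
  by rewrite big_nil mul0r.
rewrite big_cons IH // inE !mxE eqxx andbT.
by case: eqVneq => [->|_]; rewrite ?(negbTE qw) /= !(mulr1, mul1r, mulr0, mul0r, addr0, add0r).
Qed.

Section LocalStep.
Variables (R : realType) (d k : nat) (T nu0 : R).
Variables (A : 'M[R[i]]_d) (uin : 'cV[R[i]]_d) (F : 'cV[R[i]]_d -> R -> 'cV[R[i]]_d).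
Local Notation I := 'I_(d + 1).
Local Notation tt := (rshift d ord0 : I).
Hypothesis T0 : 0 < T.
Hypothesis FP : smooth_lipschitz T k F.
Variables (N Ni : I -> I -> R[i]) (lam : I -> R[i]).
Hypothesis sp : spectral A N Ni lam.
Variables (nu K r B L : R).
Hypothesis nu1 : 1 <= nu.
Hypothesis N_nu : forall p, \sum_m nc (N p m) <= nu.
Hypothesis Ni_nu : forall p, \sum_m nc (Ni p m) <= nu.
Hypothesis A_nu : forall p, \sum_m nc (augmx A p m) <= nu.
Hypothesis lam_nu : forall p, nc (lam p) <= nu.
Hypothesis lamV_nu : forall p, nc (lam p)^-1 <= nu.
Hypothesis K0 : 0 <= K.
(** Radius of the shifted solution in units of [eps]: [K] for the exact solution, and for the free
    flow the initial difference [2 * K], carried through [N] and [Ni]. *)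
Local Notation K2 := (K + nu * (nu * (2 * K))).
Hypothesis rP : K2 <= r.
Hypothesis B0 : 0 <= B.
Hypothesis L0 : 0 <= L.
Hypothesis F_B : forall b, (size b <= k)%N -> forall q (u : 'cV[R[i]]_d) t,
  (forall j, nc (u j 0) <= r) -> 0 <= t <= T -> nc (paug T F b q u t) <= B.
Hypothesis F_L : forall b, (size b <= k)%N -> forall q (u v : 'cV[R[i]]_d) t s,
  (forall j, nc (u j 0) <= r) -> (forall j, nc (v j 0) <= r) ->
  0 <= t <= T -> 0 <= s <= T ->
  nc (paug T F b q u t - paug T F b q v s) <= L * (\sum_j nc (u j 0 - v j 0) + `|t - s|).
Hypothesis G_L : forall b q x p z, (size b <= k)%N ->
  dom T r x -> dom T r (x + z *: delta_mx p 0) ->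
  nc (pderivenf T F b q (x + z *: delta_mx p 0) - pderivenf T F b q x) <= L * nc z.

Variables (eps h that : R) (X : 'cV[R[i]]_(d + 1)) (u : R -> 'cV[R[i]]_d).
Hypothesis eps0 : 0 < eps.
Hypothesis eps1 : eps <= 1.
Hypothesis h0 : 0 < h.
Hypothesis that0 : 0 <= that.
Hypothesis thatT : that + h <= T.
Hypothesis X_time : X tt 0 = that%:C.
Hypothesis X_K : forall j, nc (X (lshift 1 j) 0) <= K * eps.
Hypothesis u_sol : is_solution T nu0 A uin F eps u.
Hypothesis u_K : forall t, 0 <= t <= T -> forall j, nc (u t j 0) <= K * eps.
Variable a : R.
Local Notation x := (xaug u).
Definition eig_err p : R[i] := \sum_l N p l * (X l 0 - x that l 0).
Hypothesis eig_err_a : forall p, nc (eig_err p) <= a.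
Hypothesis a_K : a <= nu * (2 * K * eps).
Hypothesis res : forall j t, lam (lshift 1 j) = 0 -> 0 <= t <= T ->
  \sum_q N (lshift 1 j) q * paug T F [::] q 0 t = 0.

(* The exact solution shifted by the free flow of the initial error; at the
   initial time it coincides with [X], and it solves the same equation up to the
   Lipschitz error of the forcing. *)
Definition xfree q (t : R) : R[i] :=
  x (that + t) q 0 + \sum_m Ni q m * (cis (complex.Im (lam m) / eps) t * eig_err m).

Definition fsol q (t : R) : R[i] := paug T F [::] q (u (that + t)) (that + t).

Lemma a_ge0 : 0 <= a.
Proof. exact: le_trans (nc_ge0 _) (eig_err_a tt). Qed.

Lemma nu_ge0 : 0 <= nu.
Proof. exact: le_trans ler01 nu1. Qed.

Lemma r_ge0 : 0 <= r.
Proof. by apply: le_trans rP; rewrite !(addr_ge0, mulr_ge0) ?nu_ge0. Qed.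

Lemma time_in t : 0 <= t <= h -> 0 <= that + t <= T.
Proof.
move=> /andP[t0 th]; rewrite addr_ge0 //=; apply: le_trans thatT.
by rewrite lerD2l.
Qed.

Lemma that_in : 0 <= that <= T.
Proof. by have := @time_in 0; rewrite addr0 lexx ltW // => ->. Qed.

Lemma xfree0 q : xfree q 0 = X q 0.
Proof.
rewrite /xfree addr0 (eq_bigr (fun m => Ni q m * eig_err m)); last first.
  by move=> m _; rewrite cis0 mul1r.
have -> : \sum_m Ni q m * eig_err m = \sum_l (\sum_m Ni q m * N m l) * (X l 0 - x that l 0).
  under eq_bigr do rewrite mulr_sumr.
  rewrite exchange_big; apply: eq_bigr => l _; rewrite mulr_suml.
  by apply: eq_bigr => m _; rewrite mulrA.
rewrite (bigD1 q) //= (spectral_inv sp) eqxx mul1r big1 ?addr0 => [|l lq].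
  by rewrite addrC subrK.
by rewrite (spectral_inv sp) eq_sym (negbTE lq) mul0r.
Qed.

Lemma im_lam m : 'i * (complex.Im (lam m) / eps)%:C = (eps^-1)%:C * lam m.
Proof.
have := spectral_re sp m; case: (lam m) => p q /= ->.
by apply/eqP; rewrite eq_complex /=; apply/andP; split; apply/eqP; ring.
Qed.

Lemma hasder_xfree q : hasder h (xfree q)
  (fun t => (eps^-1)%:C * \sum_m augmx A q m * xfree m t + fsol q t).
Proof.
have xP := hasder_shift that0 (hasder_le thatT (hasder_xaug q u_sol)).
have cP := hasder_sum (index_enum I) (P := xpredT)
  (fun m _ => hasderZ (Ni q m * eig_err m) (hasder_cis h (complex.Im (lam m) / eps))).
apply: (eq_hasder (hasderD xP cP)) => t _.
  by rewrite /xfree; congr (_ + _); apply: eq_bigr => m _; ring.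
rewrite /xfree /fsol addrAC; congr (_ + _).
under [in RHS]eq_bigr do rewrite mulrDr.
rewrite big_split mulrDr /=; congr (_ + _).
under [in RHS]eq_bigr do rewrite mulr_sumr.
rewrite exchange_big mulr_sumr; apply: eq_bigr => m _ /=.
rewrite im_lam; set c := cis _ _.
transitivity ((eps^-1)%:C * ((Ni q m * lam m) * (c * eig_err m))); first by ring.
rewrite -(spectral_col sp) mulr_suml; congr (_ * _).
by apply: eq_bigr => l _; rewrite -mulrA.
Qed.

Lemma eig_err_time : eig_err tt = 0.
Proof.
rewrite /eig_err (bigD1 tt) //= big1 ?addr0 => [|l lt].
  by rewrite X_time xaug_time subrr mulr0.
by rewrite (spectral_time_row sp) (negbTE lt) mul0r.
Qed.

Lemma xfree_time t : xfree tt t = (that + t)%:C.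
Proof.
rewrite /xfree xaug_time big1 ?addr0 // => m _; rewrite (spectral_inv_time sp).
by case: eqP => [->|_]; rewrite ?eig_err_time ?mulr0 ?mul0r.
Qed.

Lemma xfree_near q t : nc (xfree q t - x (that + t) q 0) <= nu * a.
Proof.
rewrite /xfree addrAC subrr add0r; apply: (le_trans (nc_sum _ _ _)).
apply: (@le_trans _ _ (\sum_m nc (Ni q m) * a)).
  by apply: ler_sum => m _; rewrite !ncM nc_cis mul1r ler_wpM2l ?nc_ge0.
by rewrite -mulr_suml ler_wpM2r ?a_ge0.
Qed.

Lemma xfree_small j t : 0 <= t <= h -> nc (xfree (lshift 1 j) t) <= K2 * eps.
Proof.
move=> th; rewrite -[xfree _ _](subrK (x (that + t) (lshift 1 j) 0)) addrC.
apply: (le_trans (ncD _ _)); rewrite mulrDl xaug_space lerD ?u_K ?time_in //.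
have := xfree_near (lshift 1 j) t; rewrite xaug_space => H; apply: (le_trans H).
rewrite -!mulrA ler_wpM2l ?nu_ge0 //.
by apply: (le_trans a_K); rewrite !mulrA.
Qed.

Lemma K2_ge0 : 0 <= K2.
Proof. by rewrite !(addr_ge0, mulr_ge0) ?nu_ge0. Qed.

Lemma le_eps_1 (c : R) : 0 <= c -> c * eps <= c.
Proof. by move=> c0; rewrite ler_piMr. Qed.

Lemma xfree_r j t : 0 <= t <= h -> nc (xfree (lshift 1 j) t) <= r.
Proof.
move=> th; apply: (le_trans (xfree_small j th)); apply: le_trans rP.
by rewrite le_eps_1 ?K2_ge0.
Qed.

Lemma K_r : K <= r.
Proof. by apply: le_trans rP; rewrite lerDl !mulr_ge0 ?nu_ge0. Qed.

Lemma X_r j : nc (X (lshift 1 j) 0) <= r.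
Proof. by apply: (le_trans (X_K j)); apply: le_trans K_r; exact: le_eps_1. Qed.

Lemma u_r t j : 0 <= t <= T -> nc (u t j 0) <= r.
Proof. by move=> tT; apply: (le_trans (u_K tT j)); apply: le_trans K_r; exact: le_eps_1. Qed.

(** One constant for two bounds of the increment: [K + K2] for its space entries in units of [eps],
    [nu * K2 + B] for its velocity. The [1] allows exponents to be raised. *)
Definition incr_cst : R := 1 + (K + K2) + (nu * K2 + B).

Lemma incr_cst_ge1 : 1 <= incr_cst.
Proof. by rewrite /incr_cst -addrA lerDl !(addr_ge0, mulr_ge0) ?nu_ge0. Qed.

Definition del t q : R[i] := xfree q t - X q 0.

Lemma del_time t : del t tt = t%:C.
Proof. by rewrite /del xfree_time X_time rmorphD /= addrC addKr. Qed.

Lemma del_eps j t : 0 <= t <= h -> nc (del t (lshift 1 j)) <= incr_cst * eps.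
Proof.
move=> th; apply: (le_trans (ncB _ _)).
apply: (le_trans (lerD (xfree_small j th) (X_K j))); rewrite -mulrDl ler_wpM2r ?(ltW eps0) //.
rewrite /incr_cst [K2 + K]addrC -addrA addrCA lerDl addr_ge0 //.
by rewrite !(addr_ge0, mulr_ge0) ?nu_ge0.
Qed.

(** The velocity is bounded uniformly in [eps], because the space entries of the shifted solution
    are [O(eps)] and the column of [A1] at the time variable is 0. *)
Lemma del_t q t : 0 <= t <= h -> nc (del t q) <= incr_cst * t.
Proof.
move=> /andP[t0 th]; rewrite /del -(xfree0 q).
apply: (hasder_bound t0 (hasder_le th (hasder_xfree q))) => s /andP[s0 st].
have sh : 0 <= s <= h by rewrite s0 (le_trans st).
apply: (le_trans (ncD _ _)); apply: (@le_trans _ _ (nu * K2 + B)); last first.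
  by rewrite /incr_cst lerDr !(addr_ge0, mulr_ge0) ?nu_ge0.
apply: lerD; last by rewrite F_B ?time_in // => j; rewrite u_r ?time_in.
rewrite ncM ncR gtr0_norm ?invr_gt0 // mulrC ler_pdivrMr //.
apply: (le_trans (nc_sum _ _ _)).
apply: (@le_trans _ _ (\sum_m nc (augmx A q m) * (K2 * eps))); last first.
  by rewrite -mulr_suml -mulrA ler_wpM2r // mulr_ge0 ?K2_ge0 // ltW.
apply: ler_sum => m _; rewrite ncM.
have [j ->|j ->] := split_ordP m; first by rewrite ler_wpM2l ?nc_ge0 ?xfree_small.
by rewrite ord1 augmx_time nc0 !mul0r.
Qed.

(** * Taylor expansion of the forcing along the increment *)

Local Notation vs := (all_vars d).
Local Notation vu := (space_vars d).
Local Notation G q := (fun b => pderivenf T F b q).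

Definition ufree t : 'cV[R[i]]_d := \col_j xfree (lshift 1 j) t.

Lemma ufree_r t j : 0 <= t <= h -> nc (ufree t j 0) <= r.
Proof. by move=> th; rewrite mxE xfree_r. Qed.

Lemma dom_pt t ws : 0 <= t <= h -> uniq ws -> dom T r (pt X (del t) ws).
Proof.
move=> th uw; split=> [j|].
  rewrite pt_entry //; case: (_ \in ws); rewrite ?mul0r ?addr0 ?X_r // mul1r.
  by rewrite addrC subrK xfree_r.
rewrite pt_entry // X_time del_time; case: (_ \in ws).
  by exists (that + t); rewrite ?time_in // mul1r rmorphD.
by exists that; rewrite ?that_in // mul0r addr0.
Qed.

Lemma uniq_drop_vars i : uniq (drop i vs).
Proof. exact/drop_uniq/uniq_all_vars. Qed.

Lemma jet_at_vs t b q : G q b (pt X (del t) vs) = paug T F b q (ufree t) (that + t).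
Proof.
rewrite /pderivenf; congr (pderiven _ _ _ _ _ _ _).
  apply/matrixP => i j; rewrite ord1 mxE [RHS]mxE.
  by rewrite pt_entry ?uniq_all_vars // mem_all_vars mul1r addrC subrK.
by rewrite pt_entry ?uniq_all_vars // mem_all_vars mul1r X_time del_time -rmorphD.
Qed.

Lemma jet_at_vu t b q : G q b (pt X (del t) vu) = paug T F b q (ufree t) that.
Proof.
have uw : uniq vu by have := uniq_all_vars d => /andP[].
rewrite /pderivenf; congr (pderiven _ _ _ _ _ _ _).
  apply/matrixP => i j; rewrite ord1 mxE [RHS]mxE pt_entry //.
  have -> : lshift 1 i \in vu by rewrite mem_rev map_f // mem_enum.
  by rewrite mul1r addrC subrK.
by rewrite pt_entry // (negbTE (time_notin_space d)) mul0r addr0 X_time.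
Qed.

Definition jet_poly q M t : R[i] := tpoly (fun b => G q b X) (del t) vs [::] M.

Definition near_cst : R := L * (d%:R * nu).

Lemma fsol_near q t : 0 <= t <= h ->
  nc (fsol q t - paug T F [::] q (ufree t) (that + t)) <= near_cst * a.
Proof.
move=> th; have tT := time_in th.
have ur j : nc (u (that + t) j 0) <= r by exact: u_r.
have ur' j : nc (ufree t j 0) <= r by exact: ufree_r.
rewrite /fsol; apply: (le_trans (F_L (b := [::]) isT q ur ur' tT tT)).
rewrite subrr normr0 addr0 /near_cst -!mulrA ler_wpM2l // mulrA.
apply: (@le_trans _ _ (\sum_(j < d) nu * a)); last by rewrite sumr_const card_ord mulr_natl mulrnAl.
apply: ler_sum => j _; rewrite ncBC mxE; have := xfree_near (lshift 1 j) t.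
by rewrite xaug_space.
Qed.

Definition taylor_cst : R := k.+2%:R ^+ d.+1 * L * incr_cst ^+ k.+1.

Lemma incr_cst_ge0 : 0 <= incr_cst.
Proof. exact: le_trans ler01 incr_cst_ge1. Qed.

Lemma taylor_err q M t : (M <= k)%N -> 0 <= t <= h ->
  nc (paug T F [::] q (ufree t) (that + t) - jet_poly q M t) <= taylor_cst * t ^+ M.+1.
Proof.
move=> Mk th; have t0 : 0 <= t by case/andP: th.
rewrite -jet_at_vs.
have := taylor_multi L0 (@dom_segment _ T d r) (fun b => hasder_pderivenf T0 FP q (r := r) (b := b))
  (fun b x p z => @G_L b q x p z) (b := [::]) (x := X) (del := del t) (vs := vs) (M := M) (D := incr_cst * t)
  Mk (mulr_ge0 incr_cst_ge0 t0) (fun i => dom_pt th (uniq_drop_vars i)) (fun p _ => del_t p th).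
move=> H; apply: (le_trans H); rewrite /taylor_cst [size _]/= size_space_vars exprMn mulrA.
rewrite ler_wpM2r ?exprn_ge0 // ler_wpM2l ?mulr_ge0 ?exprn_ge0 //.
by rewrite ler_weXn2l ?incr_cst_ge1 // ltnS.
Qed.

Lemma rem_err q M t : (M <= k)%N -> 0 <= t <= h ->
  nc (fsol q t - jet_poly q M t) <= (near_cst + taylor_cst) * (a + t ^+ M.+1).
Proof.
move=> Mk th; have t0 : 0 <= t by case/andP: th.
rewrite -[_ - _](subrKA (paug T F [::] q (ufree t) (that + t))).
apply: (le_trans (ncD _ _)); apply: (le_trans (lerD (fsol_near q th) (taylor_err q Mk th))).
have ta : 0 <= t ^+ M.+1 by rewrite exprn_ge0.
have near0 : 0 <= near_cst by rewrite !mulr_ge0 ?nu_ge0.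
have c20 : 0 <= taylor_cst by rewrite !mulr_ge0 ?exprn_ge0 ?incr_cst_ge0.
by rewrite mulrDl !mulrDr; apply: lerD; rewrite ?lerDl ?lerDr mulr_ge0 ?a_ge0.
Qed.

(** * Comparison with the time Taylor remainder at zero *)

Definition time_cst : R := (1 + T) ^+ k.

Lemma time_cst_ge1 : 1 <= time_cst.
Proof. by rewrite exprn_ege1 // lerDl ltW. Qed.

Lemma pow_le M t : (0 < M <= k)%N -> 0 <= t <= h -> t ^+ M <= time_cst * t.
Proof.
case: M => // M /= Mk th; have /andP[t0 _] := th; have := time_in th => /andP[_ tT].
rewrite exprSr ler_wpM2r //; apply: (@le_trans _ _ ((1 + T) ^+ M)).
  have T1 : 0 <= 1 + T by rewrite addr_ge0 // ltW.
  rewrite lerXn2r ?nnegrE //; apply: (@le_trans _ _ T); last by rewrite lerDr.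
  by apply: le_trans tT; rewrite lerDr.
by apply: ler_weXn2l; [rewrite lerDl ltW | exact: ltnW].
Qed.

(** The only part of the Taylor remainder controlled neither by [a] nor by [eps]: it depends on time
    alone and does not see the solution. *)
Definition rem0 q M t : R[i] := paug T F [::] q 0 (that + t)
  - \sum_(e < M.+1) t%:C ^+ e / e`!%:R * paug T F (nseq e tt) q 0 that.

Lemma zero_r j : nc ((0 : 'cV[R[i]]_d) j 0) <= r.
Proof. by rewrite mxE nc0 r_ge0. Qed.

Definition zero_cst : R := L * (d%:R * K2).

Lemma zero_cst_ge0 : 0 <= zero_cst.
Proof. by rewrite !mulr_ge0 ?K2_ge0. Qed.

Lemma paug_diff b q t s : (size b <= k)%N -> 0 <= t <= h -> 0 <= s <= T ->
  nc (paug T F b q (ufree t) s - paug T F b q 0 s) <= zero_cst * eps.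
Proof.
move=> bk th sT; apply: (le_trans (F_L bk q (fun j => ufree_r j th) zero_r sT sT)).
rewrite subrr normr0 addr0 /zero_cst -!mulrA ler_wpM2l //.
apply: (@le_trans _ _ (\sum_(j < d) K2 * eps)); last by rewrite sumr_const card_ord [leRHS]mulr_natl.
by apply: ler_sum => j _; rewrite !mxE subr0 xfree_small.
Qed.

Lemma nc_term (e : nat) (t Z : R) (z : R[i]) : 0 <= t -> nc z <= Z ->
  nc (t%:C ^+ e / e`!%:R * z) <= t ^+ e * Z.
Proof.
move=> t0 zZ; rewrite !ncM ncX ncV nc_nat ncR ger0_norm //.
by apply: ler_pM; rewrite ?nc_ge0 ?divr_ge0 ?exprn_ge0 // fact_ler // exprn_ge0.
Qed.

(** With [ufree t] frozen, the values and the terms of order 0 form an increment of [phi], whose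
    time derivative is [O(eps)] by the Lipschitz bound in [u]. Every other term has a factor [t] and
    a difference [O(eps)]. *)
Lemma time_rem_err q M t : (0 < M <= k)%N -> 0 <= t <= h ->
  nc (paug T F [::] q (ufree t) (that + t)
    - \sum_(e < M.+1) t%:C ^+ e / e`!%:R * paug T F (nseq e tt) q (ufree t) that
    - rem0 q M t) <= k.+1%:R * time_cst * zero_cst * (eps * t).
Proof.
move=> Mk th; have /andP[t0 t1] := th; have /andP[M0 Mk'] := Mk.
have k0 : (0 < k)%N by exact: leq_trans M0 Mk'.
pose phi s := paug T F [::] q (ufree t) (that + s) - paug T F [::] q 0 (that + s).
have thatt : that + t <= T by have /andP[] := time_in th.
have phiP : hasder t phi (fun s => paug T F [:: tt] q (ufree t) (that + s)
    - paug T F [:: tt] q 0 (that + s)).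
  by apply: hasderB; apply: (hasder_shift that0); apply: (hasder_le thatt);
    exact: (hasder_paug_time T0 FP q _ (b := [::])).
have phiB s : 0 <= s <= t -> nc (paug T F [:: tt] q (ufree t) (that + s)
    - paug T F [:: tt] q 0 (that + s)) <= zero_cst * eps.
  move=> /andP[s0 st]; apply: paug_diff => //.
  by apply: time_in; rewrite s0 (le_trans st).
have P1 := hasder_bound t0 phiP phiB.
have -> : paug T F [::] q (ufree t) (that + t)
    - \sum_(e < M.+1) t%:C ^+ e / e`!%:R * paug T F (nseq e tt) q (ufree t) that
    - rem0 q M t = (phi t - phi 0) - \sum_(e < M) t%:C ^+ e.+1 / e.+1`!%:R *
      (paug T F (nseq e.+1 tt) q (ufree t) that - paug T F (nseq e.+1 tt) q 0 that).
  rewrite /rem0 /phi addr0 !big_ord_recl /= !expr0 fact0 divr1 !mul1r.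
  under [X in _ = _ - X]eq_bigr do rewrite mulrBr.
  have aux (p1 p2 p3 p4 s1 s2 : R[i]) :
    p1 - (p2 + s1) - (p3 - (p4 + s2)) = p1 - p3 - (p2 - p4) - (s1 - s2) by ring.
  by rewrite sumrB aux.
apply: (le_trans (ncB _ _)).
apply: (@le_trans _ _ (zero_cst * eps * t + M%:R * (time_cst * t * (zero_cst * eps)))).
  apply: (lerD P1); apply: (le_trans (nc_sum _ _ _)).
  apply: (@le_trans _ _ (\sum_(e < M) time_cst * t * (zero_cst * eps))); last first.
    by rewrite sumr_const card_ord mulr_natl.
  apply: ler_sum => e _.
  have eM : (e.+1 <= k)%N by rewrite (leq_trans _ Mk') // ltn_ord.
  apply: le_trans (nc_term e.+1 t0 (paug_diff (b := nseq e.+1 tt) q _ th that_in)) _.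
    by rewrite size_nseq.
  by rewrite ler_wpM2r ?pow_le // mulr_ge0 ?zero_cst_ge0 ?(ltW eps0).
have p0 : 0 <= zero_cst * (eps * t) by rewrite mulr_ge0 ?zero_cst_ge0 // mulr_ge0 // ltW.
have -> : zero_cst * eps * t + M%:R * (time_cst * t * (zero_cst * eps)) =
  (1 + M%:R * time_cst) * (zero_cst * (eps * t)) by ring.
rewrite -[leRHS]mulrA ler_wpM2r // -nat1r mulrDl mul1r lerD ?time_cst_ge1 //.
rewrite ler_wpM2r ?ler_nat //; exact: le_trans ler01 time_cst_ge1.
Qed.

Lemma space_rem_err q M t : (0 < M <= k)%N -> 0 <= t <= h ->
  nc (\sum_(e < M.+1) t%:C ^+ e / e`!%:R * paug T F (nseq e tt) q (ufree t) that - jet_poly q M t)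
    <= k.+1%:R * (k.+2%:R ^+ d * L * incr_cst ^+ k.+1 * time_cst) * (eps * t).
Proof.
move=> Mk th; have /andP[t0 t1] := th; have /andP[M0 Mk'] := Mk.
(* The remainder in space has at least one space increment: one of them is bounded by [eps], the
   others by [t]. *)
pose Dm := incr_cst * Num.min eps t.
have Dm0 : 0 <= Dm by rewrite mulr_ge0 ?incr_cst_ge0 // le_min t0 ltW.
have uvu i : uniq (drop i vu) by have := uniq_drop_vars i.+1.
have H := tpoly_cons_bound (G := G q) (b := [::]) (x := X) (del := del t) (q := tt) (vs := vu)
  (M := M) (D := Dm) (H := t) (B := k.+2%:R ^+ d * L) t0 _ Dm0.
have -> : \sum_(e < M.+1) t%:C ^+ e / e`!%:R * paug T F (nseq e tt) q (ufree t) that =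
    \sum_(e < M.+1) del t tt ^+ e / e`!%:R * G q (nseq e tt ++ [::]) (pt X (del t) vu).
  by apply: eq_bigr => e _; rewrite jet_at_vu cats0 del_time.
rewrite /jet_poly; apply: le_trans (H _ _ _) _.
- by rewrite mulr_ge0 ?exprn_ge0.
- by rewrite del_time ncR ger0_norm.
- move=> e eM.
  have := taylor_multi L0 (@dom_segment _ T d r)
    (fun b => hasder_pderivenf T0 FP q (r := r) (b := b))
    (fun b x p z => @G_L b q x p z) (b := nseq e tt ++ [::]) (x := X) (del := del t) (vs := vu)
    (M := (M - e)%N) (D := Dm).
  rewrite size_space_vars; apply => //.
  + by rewrite size_cat size_nseq addn0 subnKC.
  + by move=> i; exact: dom_pt.
  + move=> p; rewrite mem_rev => /mapP[j _ ->]; rewrite /Dm minElt; case: ifP => _.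
      exact: del_eps.
    exact: del_t.
have e0 := ltW eps0.
apply: (@le_trans _ _ (\sum_(e < M.+1) k.+2%:R ^+ d * L * incr_cst ^+ k.+1 * time_cst * (eps * t))).
  apply: ler_sum => e _.
  have eM : (e <= M)%N by rewrite -ltnS ltn_ord.
  have -> : k.+2%:R ^+ d * L * incr_cst ^+ k.+1 * time_cst * (eps * t) =
    k.+2%:R ^+ d * L * (incr_cst ^+ k.+1 * (time_cst * t * eps)) by ring.
  rewrite mulrCA ler_wpM2l ?mulr_ge0 ?exprn_ge0 //.
  rewrite /Dm exprMn mulrCA; apply: ler_pM.
  + by rewrite exprn_ge0 ?incr_cst_ge0.
  + by rewrite !mulr_ge0 ?exprn_ge0 ?le_min ?t0 ?e0.
  + by rewrite ler_weXn2l ?incr_cst_ge1 // ltnS (leq_trans (leq_subr _ _)).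
  apply: (@le_trans _ _ (t ^+ e * (t ^+ (M - e) * eps))).
    rewrite ler_wpM2l ?exprn_ge0 // exprSr ler_pM ?exprn_ge0 ?le_min ?t0 ?e0 //.
      by rewrite lerXn2r ?nnegrE ?le_min ?t0 ?e0 // ge_min lexx orbT.
    by rewrite ge_min lexx.
  by rewrite mulrA -exprD subnKC // ler_wpM2r // pow_le.
rewrite sumr_const card_ord -[leRHS]mulrA -[leLHS]mulr_natl ler_wpM2r ?ler_nat //.
have w0 := le_trans ler01 time_cst_ge1; have dd := incr_cst_ge0.
by rewrite !mulr_ge0 ?exprn_ge0 // addr_ge0 // ltW.
Qed.

Definition rem_cst : R := near_cst + k.+1%:R * time_cst * zero_cst
  + k.+1%:R * (k.+2%:R ^+ d * L * incr_cst ^+ k.+1 * time_cst).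

Lemma rem_diff q M t : (0 < M <= k)%N -> 0 <= t <= h ->
  nc (fsol q t - jet_poly q M t - rem0 q M t) <= rem_cst * (a + eps * t).
Proof.
move=> Mk th; have /andP[t0 t1] := th.
set S := \sum_(e < M.+1) t%:C ^+ e / e`!%:R * paug T F (nseq e tt) q (ufree t) that.
set f := paug T F [::] q (ufree t) (that + t).
have -> : fsol q t - jet_poly q M t - rem0 q M t = (fsol q t - f) + (f - S - rem0 q M t) + (S - jet_poly q M t).
  by ring.
apply: (le_trans (ncD _ _)); apply: le_trans (lerD (ncD _ _) (lexx _)) _.
apply: (le_trans (lerD (lerD (fsol_near q th) (time_rem_err q Mk th)) (space_rem_err q Mk th))).
have et0 : 0 <= eps * t by rewrite mulr_ge0 // ltW.
have near0 : 0 <= near_cst by rewrite !mulr_ge0 ?nu_ge0.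
have w0 : 0 <= time_cst by rewrite (le_trans ler01) ?time_cst_ge1.
have a0 := a_ge0.
have c40 := zero_cst_ge0; have dd := incr_cst_ge0.
have c60 : 0 <= k.+1%:R * time_cst * zero_cst by rewrite mulr_ge0 // mulr_ge0.
have c70 : 0 <= k.+1%:R * (k.+2%:R ^+ d * L * incr_cst ^+ k.+1 * time_cst).
  by rewrite mulr_ge0 // mulr_ge0 // mulr_ge0 ?exprn_ge0 // mulr_ge0 // exprn_ge0.
rewrite /rem_cst !mulrDl; apply: lerD; last by rewrite ler_wpM2l // lerDr.
by apply: lerD; rewrite ler_wpM2l // ?lerDr ?lerDl.
Qed.

Definition drem0 q M t : R[i] := paug T F [:: tt] q 0 (that + t)
  - \sum_(e < M) t%:C ^+ e / e`!%:R * paug T F (nseq e.+1 tt) q 0 that.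

Lemma hasder_rem0 q M : (0 < k)%N -> hasder h (rem0 q M) (drem0 q M).
Proof.
move=> k0; apply: hasderB; last first.
  exact: (hasder_texp h M (fun e => paug T F (nseq e tt) q 0 that)).
apply: (hasder_shift that0); apply: (hasder_le thatT).
exact: (hasder_paug_time T0 FP q 0 (b := [::])).
Qed.

Definition rem0_cst : R := L + k%:R * (time_cst * B).

Lemma rem0_cst_ge0 : 0 <= rem0_cst.
Proof. by rewrite addr_ge0 // mulr_ge0 // mulr_ge0 // (le_trans ler01) ?time_cst_ge1. Qed.

(** One power of [t] here, and hence two for [rem0], is all the corrector needs, whatever [M] is.
    The term of order 0 is handled by the Lipschitz bound in time. *)
Lemma drem0_bound q M t : (0 < M <= k)%N -> 0 <= t <= h -> nc (drem0 q M t) <= rem0_cst * t.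
Proof.
case: M => // M /= Mk th; have /andP[t0 t1] := th.
have k0 : (0 < k)%N by exact: leq_trans Mk.
rewrite /drem0 big_ord_recl expr0 fact0 divr1 mul1r opprD addrA.
apply: (le_trans (ncB _ _)); rewrite mulrDl; apply: lerD.
  apply: (le_trans (F_L (b := [:: tt]) k0 q zero_r zero_r (time_in th) that_in)).
  rewrite big1 => [|j _]; last by rewrite subrr nc0.
  by rewrite add0r addrAC subrr add0r ger0_norm.
apply: (le_trans (nc_sum _ _ _)).
apply: (@le_trans _ _ (\sum_(e < M) time_cst * B * t)).
  apply: ler_sum => e _; rewrite !lift0.
  have eM : (e.+1 < k)%N by rewrite (leq_trans _ Mk) // ltnS ltn_ord.
  apply: le_trans (nc_term e.+1 t0 (F_B (b := nseq e.+2 tt) _ q zero_r that_in)) _.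
    by rewrite size_nseq.
  by rewrite mulrAC ler_wpM2r // pow_le //= ltnW.
rewrite sumr_const card_ord -[leLHS]mulr_natl -[leRHS]mulrA ler_wpM2r ?ler_nat ?(ltnW Mk) //.
by rewrite mulr_ge0 // mulr_ge0 // (le_trans ler01) ?time_cst_ge1.
Qed.

Lemma rem0_at0 q M : rem0 q M 0 = 0.
Proof.
rewrite /rem0 addr0 big_ord_recl expr0 fact0 divr1 mul1r big1 ?addr0 ?subrr // => e _.
by rewrite lift0 exprS !mul0r.
Qed.

Lemma rem0_bound q M t : (0 < M <= k)%N -> 0 <= t <= h -> nc (rem0 q M t) <= rem0_cst * t * t.
Proof.
move=> Mk th; have /andP[t0 t1] := th; have /andP[M0 Mk'] := Mk.
have k0 : (0 < k)%N by exact: leq_trans M0 Mk'.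
rewrite -[rem0 _ _ _]subr0 -(rem0_at0 q M).
apply: (hasder_bound t0 (hasder_le t1 (hasder_rem0 q M k0))) => s /andP[s0 st].
apply: le_trans (drem0_bound q Mk _) _; first by rewrite s0 (le_trans st).
by rewrite ler_wpM2l ?rem0_cst_ge0.
Qed.

(** The resonant combination vanishes on all of [[0, T]], so it may be differentiated in time. *)
Lemma res_time j e t : lam (lshift 1 j) = 0 -> (e <= k)%N -> 0 <= t <= T ->
  \sum_q N (lshift 1 j) q * paug T F (nseq e tt) q 0 t = 0.
Proof.
move=> lam0; elim: e t => [|e IH] t ek tT; first exact: res.
have P1 := hasder_sum (index_enum I) (P := xpredT)
  (fun q _ => hasderZ (N (lshift 1 j) q) (hasder_paug_time T0 FP q 0 (b := nseq e tt) _)).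
have P2 : hasder T (fun t => \sum_q N (lshift 1 j) q * paug T F (nseq e tt) q 0 t) (fun=> 0).
  by apply: (eq_hasder (hasder_cst T 0)) => // s sT; rewrite IH // ltnW.
apply: (hasder_unique T0 (P1 _) P2 tT).
by rewrite size_nseq.
Qed.

Lemma rem0_res p M t : (M <= k)%N -> 0 <= t <= h -> lam p = 0 ->
  \sum_q N p q * rem0 q M t = 0.
Proof.
move=> Mk th; have [j ->|j ->] := split_ordP p => lam0.
  rewrite /rem0; under eq_bigr do rewrite mulrBr mulr_sumr.
  rewrite sumrB (res_time lam0 (e := 0) isT (time_in th)) exchange_big big1 ?subr0 // => e _.
  transitivity (t%:C ^+ e / e`!%:R * \sum_q N (lshift 1 j) q * paug T F (nseq e tt) q 0 that).
    by rewrite mulr_sumr; apply: eq_bigr => q _; rewrite mulrCA.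
  by rewrite res_time ?mulr0 ?that_in // (leq_trans _ Mk) // -ltnS ltn_ord.
(* The time variable has eigenvalue 0 too; its forcing is the constant 1, which equals its Taylor
   sum. *)
rewrite ord1 (bigD1 tt) //= big1 ?addr0 => [|q qt]; last first.
  by rewrite (spectral_time_row sp) (negbTE qt) mul0r.
rewrite /rem0 (paug_time T0 FP) ?time_in //= big_ord_recl big1 => [|e _].
  by rewrite (paug_time T0 FP) ?that_in //= expr0 fact0 divr1 mul1r addr0 subrr mulr0.
rewrite (paug_time T0 FP) ?that_in ?mulr0 // size_nseq lift0.
by rewrite (leq_trans _ Mk) // ltn_ord.
Qed.

(** * Monomials of the shifted solution against the flow of the scheme *)

Variable s : seq (seq I).
Hypothesis s_listing : is_listing k s.
Variables A1X A0X : 'M[R[i]]_(size s).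
Hypothesis A1P : represents X (A1_row (augmx A) X) A1X.
Hypothesis A0P : represents X (A0_row T k F X) A0X.

Definition flow t : 'cV[R[i]]_(size s) :=
  expmx (t%:C *: ((eps^-1)%:C *: A1X + A0X)) *m e1 R (size s).

(** On one-letter words at time [h] this is the shifted solution minus the new numerical value. *)
Definition eta t (c : seq I) : R[i] := \prod_(q <- c) del t q - ext (flow t) c.

Definition coefX (b : seq I) q : R[i] := (gamma_idx b)%:R^-1 * pderivenf T F b q X.

Definition Elin (H : seq I -> R[i]) q c : R[i] :=
  (eps^-1)%:C * stiff X (augmx A) H q c + jet k coefX H q c.

Lemma Elin_sub H H' q c : Elin (fun b => H b - H' b) q c = Elin H q c - Elin H' q c.
Proof.
rewrite /Elin /stiff /jet.
have -> : \sum_m augmx A q m * (H (m :: c) - H' (m :: c) + X m 0 * (H c - H' c)) =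
    \sum_m augmx A q m * (H (m :: c) + X m 0 * H c) -
    \sum_m augmx A q m * (H' (m :: c) + X m 0 * H' c).
  by rewrite -sumrB; apply: eq_bigr => m _; ring.
have -> : \sum_(0 <= m < (k - size c).+1) \sum_(b : m.-tuple I | nondecreasing_idx b)
      coefX b q * (H (c ++ b) - H' (c ++ b)) =
    \sum_(0 <= m < (k - size c).+1) \sum_(b : m.-tuple I | nondecreasing_idx b)
      coefX b q * H (c ++ b) -
    \sum_(0 <= m < (k - size c).+1) \sum_(b : m.-tuple I | nondecreasing_idx b)
      coefX b q * H' (c ++ b).
  rewrite -sumrB; apply: eq_bigr => m _; rewrite -sumrB.
  by apply: eq_bigr => b _; rewrite mulrBr.
by rewrite mulrBr opprD addrACA.
Qed.

Lemma jet_del q c t :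
  jet k coefX (fun b => \prod_(p <- b) del t p) q c =
  \prod_(p <- c) del t p * jet_poly q (k - size c) t.
Proof.
rewrite /jet_poly tpoly_words ?all_vars_decreasing //.
rewrite -(sum_tuples_words (fun b => (gamma_idx b)%:R^-1 * pderivenf T F (b ++ [::]) q X
  * \prod_(p <- b) del t p) _ (all_vars_decreasing d) (@mem_all_vars d)).
rewrite /jet mulr_sumr; apply: eq_bigr => m _; rewrite mulr_sumr.
apply: eq_bigr => b _; rewrite cats0 big_cat /coefX; exact: mulrCA.
Qed.

(** The monomials reproduce the stiff rows exactly, since [del t m + X m 0] is the shifted solution.
    In the other rows only the Taylor polynomial of the forcing is available, to the order that
    words of length at most [k] allow. *)
Lemma hasder_eta c : (size c <= k)%N -> hasder h (eta^~ c) (fun t =>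
  dsum (Elin (eta t)) c +
  dsum (fun q c => \prod_(p <- c) del t p * (fsol q t - jet_poly q (k - size c) t)) c).
Proof.
move=> ck.
have dP q : hasder h (fun t => del t q)
    (fun t => (eps^-1)%:C * \sum_m augmx A q m * xfree m t + fsol q t).
  by apply: (eq_hasder (hasderB (hasder_xfree q) (hasder_cst h (X q 0)))) => t _ //; rewrite subr0.
apply: (eq_hasder (hasderB (hasder_mono c dP)
  (hasder_ext s_listing h ((eps^-1)%:C) (e1 R (size s)) A1P A0P ck))) => t th //.
rewrite -dsumD -dsumB; apply: eq_dsum => q b _.
rewrite (_ : Elin (eta t) q b = Elin (fun b => \prod_(p <- b) del t p) q b
  - Elin (ext (flow t)) q b); last exact: Elin_sub.
rewrite {1}/Elin jet_del.
have -> : stiff X (augmx A) (fun b => \prod_(p <- b) del t p) q b =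
    \prod_(p <- b) del t p * \sum_m augmx A q m * xfree m t.
  rewrite mulr_sumr; apply: eq_bigr => m _; rewrite big_cons /del.
  by rewrite -mulrDl subrK mulrA mulrC.
rewrite /Elin /coefX /flow; ring.
Qed.

Lemma nth_listing : nth [::] s 0 = [::] /\ forall q : I, nth [::] s q.+1 = [:: q].
Proof.
case: s_listing => _ _ E.
have nE i : (i < (d + 1).+1)%N -> nth [::] s i = nth [::] ([::] :: [seq [:: q] | q <- enum I]) i.
  by move=> id; rewrite -E nth_take.
split; first by rewrite nE.
move=> q; rewrite nE ?ltnS ?ltn_ord //= (nth_map q) ?size_enum_ord ?ltn_ord //.
by rewrite nth_ord_enum.
Qed.

Lemma size_listing : (d + 1 < size s)%N.
Proof.
case: s_listing => _ _ /(congr1 size); rewrite /= size_map size_enum_ord size_take.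
by case: ltnP => [lt _|_ ->]; [exact: ltnW | exact: ltnSn].
Qed.

Lemma flow0 c : (size c <= k)%N -> ext (flow 0) c = (c == [::])%:R.
Proof.
move=> ck; rewrite /flow expmx0 mul1mx (ext_index s_listing _ ck) mxE /=.
have us : uniq s by case: s_listing.
have s0 := leq_ltn_trans (leq0n _) size_listing.
congr (_%:R); congr nat_of_bool; apply/eqP/eqP => [E|->].
  have := nth_index [::] (wsort_in_listing s_listing ck); rewrite E nth_listing.1 => c0.
  by apply: size0nil; rewrite -(perm_size (perm_wsort c)) -c0.
by rewrite -[X in index X _]nth_listing.1 index_uniq.
Qed.

Lemma eta0 c : (size c <= k)%N -> eta 0 c = 0.
Proof.
move=> ck; rewrite /eta flow0 //; case: c ck => [|q c] _; first by rewrite big_nil subrr.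
by rewrite big_cons /del xfree0 subrr mul0r subr0.
Qed.

Lemma flow_step q : (X + Pi2 R (d + 1) (size s) *m flow h) q 0 = X q 0 + ext (flow h) [:: q].
Proof.
rewrite mxE; congr (_ + _); rewrite mxE.
have qs : (q.+1 < size s)%N by rewrite (leq_ltn_trans _ size_listing) // ltn_ord.
rewrite (bigD1 (Ordinal qs)) //= mxE eqxx mul1r big1 ?addr0 => [|i iq].
  by rewrite -nth_listing.2 -(ext_nth s_listing _ (Ordinal qs)).
by rewrite mxE -val_eqE /= in iq *; rewrite (negbTE iq) mul0r.
Qed.

(** * The defect in eigen-coordinates *)

Definition eig_state p : R[i] := \sum_m N p m * X m 0.
Definition eig_del t p : R[i] := \sum_m N p m * del t m.
Definition eig_eta (b : seq I) t : R[i] := tens N (eta t) b.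
Definition freq (b : seq I) : R[i] := (eps^-1)%:C * \sum_(p <- b) lam p.

(** What the linear system contains besides its imaginary diagonal. The affine stiff term carries
    [eps^-1 * eig_state p], bounded because [X] is [O(eps)] in space and [lam] is 0 at the time
    variable. *)
Definition Slin (H : seq I -> R[i]) (b : seq I) : R[i] :=
  dsum (fun p c => (eps^-1)%:C * (lam p * eig_state p) * tens N H c
    + tens N (fun c' => \sum_q N p q * jet k coefX H q c') c) b.

Definition forcing (b : seq I) t : R[i] :=
  dsum (fun p c => \prod_(q <- c) eig_del t q * \sum_q N p q * (fsol q t - jet_poly q (k - size c) t)) b.

Lemma swapinv_eta t : swapinv (eta t).
Proof.
move=> w p q c; rewrite /eta.
have P : perm_eq (w ++ p :: q :: c) (w ++ q :: p :: c).
  by rewrite perm_cat2l; apply/permPl; exact: (perm_catCA [:: p] [:: q] c).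
by rewrite (perm_big _ P) (ext_perm _ P).
Qed.

Lemma tens_Elin H p c : tens N (fun c' => \sum_q N p q * Elin H q c') c =
  (eps^-1)%:C * (lam p * tens N H (p :: c)) +
  ((eps^-1)%:C * (lam p * eig_state p) * tens N H c
    + tens N (fun c' => \sum_q N p q * jet k coefX H q c') c).
Proof.
have E c' : \sum_q N p q * Elin H q c' =
    (eps^-1)%:C * lam p * (\sum_m N p m * H (m :: c')) +
    ((eps^-1)%:C * (lam p * eig_state p) * H c' + \sum_q N p q * jet k coefX H q c').
  rewrite /Elin; under eq_bigr do rewrite mulrDr.
  rewrite big_split addrA; congr (_ + _).
  transitivity ((eps^-1)%:C * \sum_m (\sum_q N p q * augmx A q m) * (H (m :: c') + X m 0 * H c')).
    rewrite mulr_sumr; under eq_bigr do rewrite /stiff mulrCA mulr_sumr mulr_sumr.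
    rewrite exchange_big; apply: eq_bigr => m _; rewrite mulr_suml mulr_sumr.
    by apply: eq_bigr => q _; congr (_ * _); rewrite mulrA.
  have -> : \sum_m (\sum_q N p q * augmx A q m) * (H (m :: c') + X m 0 * H c') =
      lam p * (\sum_m N p m * H (m :: c')) + lam p * eig_state p * H c'.
    rewrite /eig_state !mulr_sumr mulr_suml -big_split; apply: eq_bigr => m _.
    by rewrite (spectral_row sp) /=; ring.
  by rewrite mulrDr !mulrA.
rewrite (eq_tens N (G := fun c' => (eps^-1)%:C * lam p * (\sum_m N p m * H (m :: c')) +
    ((eps^-1)%:C * (lam p * eig_state p) * H c' + \sum_q N p q * jet k coefX H q c'))); last first.
  by move=> c' _; exact: E.
rewrite tensD tensZ tensD tensZ tens_sum; congr (_ + _).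
by rewrite -mulrA.
Qed.

Lemma hasder_eig_eta b : (size b <= k)%N ->
  hasder h (eig_eta b) (fun t => freq b * eig_eta b t + (Slin (eta t) b + forcing b t)).
Proof.
move=> bk.
have H := hasder_tens N (b := b) (H := eta) (fun c (cb : size c = size b) =>
  hasder_eta (eq_ind_r (fun n => (n <= k)%N) bk cb)).
apply: (eq_hasder H) => t th0 //; rewrite tensD addrA; congr (_ + _).
  rewrite tens_dsum /Slin /freq -mulrA -(dsum_eigen lam b (swapinv_tens N (swapinv_eta t))).
  rewrite -dsumZ -dsumD; apply: eq_dsum => p c _; exact: tens_Elin.
rewrite tens_dsum; apply: eq_dsum => p c sc.
rewrite (eq_tens N (G := fun c' => (\sum_q N p q * (fsol q t - jet_poly q (k - size c) t))
    * \prod_(p <- c') del t p)).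
  by rewrite tensZ tens_prod mulrC.
move=> c' sc'; rewrite sc' mulr_suml; apply: eq_bigr => q _; ring.
Qed.

Lemma eig_eta0 b : (size b <= k)%N -> eig_eta b 0 = 0.
Proof.
move=> bk; rewrite /eig_eta (eq_tens N (G := fun=> 0 * 0)) => [|c cb].
  by rewrite tensZ mul0r.
by rewrite eta0 ?mul0r // cb.
Qed.

Lemma freq_re b : complex.Re (freq b) = 0.
Proof.
rewrite /freq ReRM; elim: b => [|p b IH]; first by rewrite big_nil mulr0.
by rewrite big_cons ReD mulrDr IH (spectral_re sp) mulr0 addr0.
Qed.

Lemma nc_sumN p (x : I -> R[i]) Z : (forall q, nc (x q) <= Z) ->
  nc (\sum_q N p q * x q) <= nu * Z.
Proof.
move=> xZ; apply: (le_trans (nc_sum _ _ _)).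
have Z0 : 0 <= Z by exact: le_trans (nc_ge0 _) (xZ tt).
apply: (@le_trans _ _ (\sum_q nc (N p q) * Z)).
  by apply: ler_sum => q _; rewrite ncM ler_wpM2l ?nc_ge0.
by rewrite -mulr_suml ler_wpM2r.
Qed.

(* The time column of [N] vanishes outside of the time row. *)
Lemma nc_sumN_space j (x : I -> R[i]) Z : 0 <= Z -> (forall j, nc (x (lshift 1 j)) <= Z) ->
  nc (\sum_q N (lshift 1 j) q * x q) <= nu * Z.
Proof.
move=> Z0 xZ.
have -> : \sum_q N (lshift 1 j) q * x q =
    \sum_q N (lshift 1 j) q * (if q == tt then 0 else x q).
  by apply: eq_bigr => q _; case: eqP => // ->; rewrite (spectral_time_col sp) !mul0r.
apply: nc_sumN => q; have [l ->|l ->] := split_ordP q.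
  by rewrite eq_lrshift.
by rewrite ord1 eqxx nc0.
Qed.

Lemma nc_stiffX p : nc ((eps^-1)%:C * (lam p * eig_state p)) <= nu * (nu * K).
Proof.
rewrite !ncM ncR gtr0_norm ?invr_gt0 //.
have [j ->|j ->] := split_ordP p; last first.
  by rewrite ord1 (spectral_lam_time sp) nc0 mul0r mulr0 !mulr_ge0 ?nu_ge0.
rewrite mulrC ler_pdivrMr // -mulrA; apply: ler_pM; rewrite ?nc_ge0 // -mulrA.
by apply: nc_sumN_space => //; rewrite mulr_ge0 // ltW.
Qed.

Definition jet_cst : R := k.+1%:R * (d + 1)%:R ^+ k.

Lemma nc_jet H q c Z : 0 <= Z -> (size c <= k)%N -> (forall b, (size b <= k)%N -> nc (H b) <= Z) ->
  nc (jet k coefX H q c) <= jet_cst * (B * Z).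
Proof.
move=> Z0 ck HZ; apply: (le_trans (nc_sum _ _ _)); rewrite big_mkord.
have d1 : 1 <= (d + 1)%:R :> R by rewrite ler1n addn1.
apply: (@le_trans _ _ (\sum_(m < (k - size c).+1) (d + 1)%:R ^+ k * (B * Z))); last first.
  rewrite sumr_const card_ord -[leLHS]mulr_natl /jet_cst -[leRHS]mulrA ler_wpM2r ?ler_nat ?ltnS ?leq_subr //.
  by rewrite !mulr_ge0 ?exprn_ge0.
apply: ler_sum => m _; apply: (le_trans (nc_sum _ _ _)).
have mk : (m <= k - size c)%N by rewrite -ltnS ltn_ord.
apply: (@le_trans _ _ (\sum_(b : m.-tuple I) B * Z)).
  rewrite [leRHS](bigID (fun b : m.-tuple I => nondecreasing_idx b)) /=.
  rewrite ler_wpDr ?sumr_ge0 // => [b _|]; first by rewrite mulr_ge0.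
  apply: ler_sum => b _; rewrite ncM.
  have bk : (size b <= k)%N by rewrite size_tuple (leq_trans mk) ?leq_subr.
  have cbk : (size (c ++ b) <= k)%N by rewrite size_cat size_tuple -leq_subRL.
  apply: ler_pM; rewrite ?nc_ge0 ?HZ // /coefX ncM ncV nc_nat.
  rewrite -[leRHS]mul1r; apply: ler_pM; rewrite ?invr_ge0 ?nc_ge0 //.
    rewrite invf_le1 ?ltr0n ?ler1n.
      by rewrite prodn_gt0 // => i; rewrite fact_gt0.
    by rewrite prodn_gt0 // => i; rewrite fact_gt0.
  rewrite /pderivenf X_time; apply: (F_B bk q _ that_in) => j; rewrite mxE; exact: X_r.
rewrite sumr_const card_tuple card_ord -[leLHS]mulr_natl ler_wpM2r ?mulr_ge0 // natrX.
by rewrite ler_weXn2l // (leq_trans mk) ?leq_subr.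
Qed.

Lemma nu_pow i : (i <= k)%N -> nu ^+ i <= nu ^+ k.
Proof. by move=> ik; rewrite ler_weXn2l. Qed.

Definition coupling_cst : R := k%:R * (nu * (nu * K) + nu ^+ k * (nu * (jet_cst * (B * nu ^+ k)))).

Lemma coupling_cst_ge0 : 0 <= coupling_cst.
Proof.
by rewrite mulr_ge0 // addr_ge0 // !mulr_ge0 ?exprn_ge0 ?nu_ge0.
Qed.

Lemma nc_Slin H b Z : (size b <= k)%N -> (forall c, (size c <= k)%N -> nc (tens N H c) <= Z) ->
  nc (Slin H b) <= coupling_cst * Z.
Proof.
move=> bk HZ.
have Z0 : 0 <= Z := le_trans (nc_ge0 _) (HZ [::] isT).
(* The jets are written in the original variables, so the bound is first transported back by the
   tensor powers of [Ni]. *)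
have HZ' c : (size c <= k)%N -> nc (H c) <= nu ^+ k * Z.
  move=> ck; rewrite -(tens_inv H c (spectral_inv sp)).
  apply: le_trans (nc_tens (B := Z) Ni_nu _) _ => [c' cc'|]; first by rewrite HZ // cc'.
  by rewrite ler_wpM2r // nu_pow.
apply: le_trans (nc_dsum (B := (nu * (nu * K) + nu ^+ k * (nu * (jet_cst * (B * nu ^+ k)))) * Z) _) _.
  move=> p c cb _; have ck : (size c < k)%N by rewrite cb.
  apply: (le_trans (ncD _ _)); rewrite mulrDl; apply: lerD.
    by rewrite ncM ler_pM ?nc_ge0 ?nc_stiffX // HZ // ltnW.
  apply: le_trans (nc_tens (B := nu * (jet_cst * (B * (nu ^+ k * Z)))) N_nu _) _.
    move=> c' cc'; apply: nc_sumN => q; apply: nc_jet => //.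
      by rewrite mulr_ge0 // exprn_ge0 // nu_ge0.
    by rewrite cc' ltnW.
  rewrite (_ : nu ^+ k * (nu * (jet_cst * (B * nu ^+ k))) * Z =
    nu ^+ k * (nu * (jet_cst * (B * (nu ^+ k * Z)))));
    last by ring.
  rewrite ler_wpM2r ?nu_pow ?(ltnW ck) //.
  by rewrite !mulr_ge0 ?exprn_ge0 ?nu_ge0.
rewrite /coupling_cst -[leRHS]mulrA ler_wpM2r ?ler_nat //.
by rewrite mulr_ge0 // addr_ge0 // !mulr_ge0 ?exprn_ge0 ?nu_ge0.
Qed.

Lemma nc_eig_del t p : 0 <= t <= h -> nc (eig_del t p) <= nu * (incr_cst * t).
Proof. by move=> tin; apply: nc_sumN => q; exact: del_t. Qed.

Lemma nc_eig_del_space t j : 0 <= t <= h -> nc (eig_del t (lshift 1 j)) <= nu * (incr_cst * eps).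
Proof.
move=> tin; apply: nc_sumN_space => [|l]; last exact: del_eps.
by rewrite mulr_ge0 ?incr_cst_ge0 // ltW.
Qed.

Lemma eig_del_time t : eig_del t tt = t%:C.
Proof.
rewrite /eig_del (bigD1 tt) //= big1 ?addr0 => [|q qt].
  by rewrite (spectral_time_row sp) eqxx mul1r del_time.
by rewrite (spectral_time_row sp) (negbTE qt) mul0r.
Qed.

Lemma pow_le_cst i t : (i <= k)%N -> 0 <= t <= h -> t ^+ i <= time_cst.
Proof.
move=> ik th0; have /andP[t0 _] := th0; have /andP[_ tT] := time_in th0.
have T1 : 0 <= 1 + T by rewrite addr_ge0 // ltW.
apply: (@le_trans _ _ ((1 + T) ^+ i)); last by rewrite ler_weXn2l ?lerDl // ltW.
rewrite lerXn2r ?nnegrE //; apply: (@le_trans _ _ T); last by rewrite lerDr.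
by apply: le_trans tT; rewrite lerDr.
Qed.

Lemma near_taylor_ge0 : 0 <= near_cst + taylor_cst.
Proof.
rewrite addr_ge0 // /near_cst /taylor_cst mulr_ge0 ?mulr_ge0 ?nu_ge0 ?exprn_ge0 ?incr_cst_ge0 //.
Qed.

Lemma time_cst_ge0 : 0 <= time_cst.
Proof. exact: le_trans ler01 time_cst_ge1. Qed.

Lemma nu_incr_ge1 : 1 <= nu * incr_cst.
Proof. by rewrite mulr_ege1 ?incr_cst_ge1. Qed.

Definition forcing_cst : R := k%:R * ((nu * incr_cst) ^+ k * (nu * (near_cst + taylor_cst)) * time_cst).

(** The increments along [c] give [t ^+ size c], and the truncated jet leaves
    [t ^+ (k - size c).+1]; the exponents add up to [k.+1] for every word. *)
Lemma nc_forcing b t : (size b <= k)%N -> 0 <= t <= h -> nc (forcing b t) <= forcing_cst * (a + h ^+ k.+1).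
Proof.
move=> bk tin; have /andP[t0 t1] := tin.
have a0 := a_ge0; have nup := nu_ge0; have w0 := time_cst_ge0; have c0 := near_taylor_ge0.
have nd0 : 0 <= nu * incr_cst := le_trans ler01 nu_incr_ge1.
have r0 : 0 <= (nu * incr_cst) ^+ k * (nu * (near_cst + taylor_cst)) * time_cst * (a + h ^+ k.+1).
  have e1' : 0 <= a + h ^+ k.+1 by apply: addr_ge0 => //; rewrite exprn_ge0 // ltW.
  by rewrite mulr_ge0 // mulr_ge0 // mulr_ge0 ?exprn_ge0 // mulr_ge0.
apply: le_trans (nc_dsum
  (B := (nu * incr_cst) ^+ k * (nu * (near_cst + taylor_cst)) * time_cst * (a + h ^+ k.+1)) _) _; last first.
  by rewrite /forcing_cst -[leRHS]mulrA ler_wpM2r // ler_nat.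
move=> p c cb _; have ck : (size c < k)%N by rewrite cb.
have tc : 0 <= t ^+ size c by rewrite exprn_ge0.
rewrite ncM.
have P1 : nc (\prod_(q <- c) eig_del t q) <= (nu * incr_cst) ^+ k * t ^+ size c.
  apply: (@le_trans _ _ ((nu * incr_cst) ^+ size c * t ^+ size c)).
    elim: c {cb ck tc} => [|q c IH]; first by rewrite big_nil nc1 !expr0 mulr1.
    by rewrite big_cons ncM !exprS mulrACA ler_pM ?nc_ge0 // -mulrA nc_eig_del.
  by rewrite ler_wpM2r // ler_weXn2l ?nu_incr_ge1 // ltnW.
have P2 : nc (\sum_q N p q * (fsol q t - jet_poly q (k - size c) t)) <=
    nu * ((near_cst + taylor_cst) * (a + t ^+ (k - size c).+1)).
  by apply: nc_sumN => q; apply: rem_err => //; exact: leq_subr.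
apply: (le_trans (ler_pM _ _ P1 P2)); rewrite ?nc_ge0 //.
have -> : (nu * incr_cst) ^+ k * t ^+ size c * (nu * ((near_cst + taylor_cst) * (a + t ^+ (k - size c).+1))) =
  (nu * incr_cst) ^+ k * (nu * (near_cst + taylor_cst)) * (t ^+ size c * (a + t ^+ (k - size c).+1)) by ring.
rewrite -[leRHS]mulrA ler_wpM2l ?mulr_ge0 ?exprn_ge0 //.
rewrite !mulrDr -exprD (addnS (size c)) subnKC ?(ltnW ck) //; apply: lerD.
  by rewrite ler_wpM2r // pow_le_cst // ltnW.
apply: (@le_trans _ _ (h ^+ k.+1)); first by rewrite lerXn2r ?nnegrE // ltW.
by rewrite ler_peMl ?time_cst_ge1 // exprn_ge0 // ltW.
Qed.

(** The old error is multiplied by a number of modulus 1, so it does not grow; the step adds only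
    the defect of a one-letter word. *)
Lemma eig_err_next p : \sum_l N p l * ((X + Pi2 R (d + 1) (size s) *m flow h) l 0 - x (that + h) l 0) =
  cis (complex.Im (lam p) / eps) h * eig_err p - eig_eta [:: p] h.
Proof.
have E l : (X + Pi2 R (d + 1) (size s) *m flow h) l 0 - x (that + h) l 0 =
    \sum_m Ni l m * (cis (complex.Im (lam m) / eps) h * eig_err m) - eta h [:: l].
  rewrite flow_step /eta big_seq1 /del /xfree; ring.
under eq_bigr do rewrite E mulrBr mulr_sumr.
rewrite sumrB; congr (_ - _); rewrite exchange_big.
transitivity (\sum_m (\sum_l N p l * Ni l m) * (cis (complex.Im (lam m) / eps) h * eig_err m)).
  by apply: eq_bigr => m _; rewrite mulr_suml; apply: eq_bigr => l _; rewrite -[RHS]mulrA.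
rewrite (bigD1 p) //= (spectral_invr sp) eqxx mul1r big1 ?addr0 // => m mp.
by rewrite (spectral_invr sp) eq_sym (negbTE mp) mul0r.
Qed.

Definition gronwall_cst : R := #|{: k.-bseq I}|%:R * expR (#|{: k.-bseq I}|%:R * coupling_cst * T + 1).

Lemma h_le_T : h <= T.
Proof. by apply: le_trans thatT; rewrite lerDr. Qed.

Lemma gronwall_cst_le h' : 0 <= h' <= T ->
  #|{: k.-bseq I}|%:R * expR (#|{: k.-bseq I}|%:R * coupling_cst * h' + 1) <= gronwall_cst.
Proof.
move=> /andP[h'0 h'T]; rewrite /gronwall_cst ler_wpM2l // ler_expR lerD2r ler_wpM2l //.
by rewrite mulr_ge0 ?coupling_cst_ge0.
Qed.

(** The estimate of full order: [gronwall_skew] over all words in [k.-bseq I], read at the word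
    [[:: p]]. *)
Lemma step_E1 p : (0 < k)%N ->
  nc (\sum_l N p l * ((X + Pi2 R (d + 1) (size s) *m flow h) l 0 - x (that + h) l 0))
    <= nc (eig_err p) + h * (forcing_cst * (a + h ^+ k.+1) * gronwall_cst).
Proof.
move=> k0; rewrite eig_err_next; apply: (le_trans (ncB _ _)).
rewrite ncM nc_cis mul1r lerD2l.
have c70 : 0 <= forcing_cst * (a + h ^+ k.+1).
  have z0 : 0 <= (0 : R) <= h by rewrite lexx ltW.
  exact: le_trans (nc_ge0 _) (nc_forcing (b := [::]) isT z0).
have pk : (size [:: p] <= k)%N by [].
have H := @gronwall_skew R (k.-bseq I) h (fun b t => eig_eta b t)
  (fun b t => Slin (eta t) b + forcing b t) (fun b => freq b) coupling_cst
  (forcing_cst * (a + h ^+ k.+1)) h0 coupling_cst_ge0 c70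
  (fun b => freq_re b) (fun b => hasder_eig_eta (size_bseq b)) (fun b => eig_eta0 (size_bseq b)).
have {}H := H _ (Bseq pk); rewrite [leRHS]mulrA; apply: le_trans (H _) _.
  move=> t Z tin HZ b; apply: (le_trans (ncD _ _)); apply: lerD.
    by apply: nc_Slin => [|c ck]; [exact: size_bseq | exact: (HZ (Bseq ck))].
  by apply: nc_forcing => //; exact: size_bseq.
by apply: ler_wpM2l; [rewrite mulr_ge0 // ltW | rewrite gronwall_cst_le // h_le_T ltW].
Qed.

(** * The corrector for the oscillating forcing *)

Definition istime (c : seq I) : R[i] := (all (pred1 tt) c)%:R.
Definition R0 p (c : seq I) t : R[i] := \sum_q N p q * rem0 q (k - size c) t.
Definition dR0 p (c : seq I) t : R[i] := \sum_q N p q * drem0 q (k - size c) t.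

(* Solves [freq b * rcor b = forcing] for the part of the forcing which is only
   bounded by the step and not by [eps]. *)
Definition rcor (b : seq I) t : R[i] :=
  dsum (fun p c => istime c * (eps%:C / lam p) * (t%:C ^+ size c * R0 p c t)) b.
Definition drcor (b : seq I) t : R[i] :=
  dsum (fun p c => istime c * (eps%:C / lam p) *
    ((size c)%:R * t%:C ^+ (size c).-1 * 1 * R0 p c t + t%:C ^+ size c * dR0 p c t)) b.

Lemma hasder_rcor b : (size b <= k)%N -> hasder h (rcor b) (drcor b).
Proof.
move=> bk; apply: hasder_dsum => p c cb; apply: hasderZ; apply: hasderM.
  exact: (hasderX (size c) (hasder_id h)).
apply: hasder_sum => q _; apply: hasderZ; apply: hasder_rem0.
by apply: leq_trans bk; rewrite -cb.
Qed.

(** When the letters left are all time letters, whose eigenvalue is 0, the frequency of [b] reduces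
    to [lam p / eps]. So a single eigenvalue is divided out. *)
Lemma freq_rcor b t : (size b <= k)%N -> 0 <= t <= h ->
  freq b * rcor b t = dsum (fun p c => istime c * (t%:C ^+ size c * R0 p c t)) b.
Proof.
move=> bk tin; rewrite /freq -mulrA -[\sum_(p <- b) _]add0r /rcor dsum_weight -dsumZ.
apply: eq_dsum => p c cb; rewrite add0r /istime.
case: (boolP (all _ c)) => [ct|_]; last by rewrite !mul0r !mulr0.
have -> : \sum_(q <- c) lam q = 0.
  rewrite big_seq big1 // => q /(allP ct) /eqP ->; exact: (spectral_lam_time sp).
rewrite addr0 !mul1r.
have eE : (eps^-1)%:C * eps%:C = 1 :> R[i] by rewrite -rmorphM mulVf // gt_eqF.
(* For a zero eigenvalue nothing can be divided out, and nothing has to be: [R0 p c t] vanishes by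
   the absence of resonance. *)
have [l0|l0] := eqVneq (lam p) 0.
  rewrite {2}/R0 rem0_res ?leq_subr // mulr0 /R0 rem0_res ?leq_subr // !mulr0 //.
transitivity ((eps^-1)%:C * eps%:C * (lam p * (lam p)^-1) * (t%:C ^+ size c * R0 p c t)).
  by ring.
by rewrite eE mulfV // !mul1r.
Qed.

Lemma istime_le c : nc (istime c) <= 1.
Proof. by rewrite nc_nat lern1 leq_b1. Qed.

Lemma eps_lam p : nc (eps%:C / lam p) <= eps * nu.
Proof. by rewrite ncM ncR gtr0_norm // ler_wpM2l // ltW. Qed.

Lemma sub_size_pos (c : seq I) : (size c < k)%N -> (0 < k - size c <= k)%N.
Proof. by move=> ck; rewrite subn_gt0 ck leq_subr. Qed.

Lemma nc_R0 p c t : (size c < k)%N -> 0 <= t <= h -> nc (R0 p c t) <= nu * (rem0_cst * h * h).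
Proof.
move=> ck tin; have /andP[t0 t1] := tin; apply: nc_sumN => q.
apply: (le_trans (rem0_bound q (sub_size_pos ck) tin)).
have c60 := rem0_cst_ge0; apply: ler_pM => //; first exact: mulr_ge0.
exact: ler_wpM2l.
Qed.

Lemma nc_dR0 p c t : (size c < k)%N -> 0 <= t <= h -> nc (dR0 p c t) <= nu * (rem0_cst * h).
Proof.
move=> ck tin; have /andP[t0 t1] := tin; apply: nc_sumN => q.
apply: (le_trans (drem0_bound q (sub_size_pos ck) tin)).
by rewrite ler_wpM2l ?rem0_cst_ge0.
Qed.

Lemma nc_tpow i t : (i <= k)%N -> 0 <= t <= h -> nc (t%:C ^+ i) <= time_cst.
Proof.
move=> ik tin; have /andP[t0 t1] := tin.
by rewrite ncX ncR ger0_norm // pow_le_cst.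
Qed.

Definition rcor_cst : R := k%:R * (nu * (time_cst * (nu * rem0_cst))).

Lemma nc_rcor b t : (size b <= k)%N -> 0 <= t <= h -> nc (rcor b t) <= rcor_cst * (eps * h * h).
Proof.
move=> bk tin; have nup := nu_ge0; have w0 := time_cst_ge0; have c60 := rem0_cst_ge0.
have e0 := ltW eps0; have h0' := ltW h0.
have B1 : 0 <= eps * nu * (time_cst * (nu * (rem0_cst * h * h))) by rewrite !mulr_ge0.
apply: le_trans (nc_dsum (B := eps * nu * (time_cst * (nu * (rem0_cst * h * h)))) _) _.
  move=> p c cb _; have ck : (size c < k)%N by rewrite cb.
  rewrite ncM; apply: ler_pM; rewrite ?nc_ge0 //.
    rewrite ncM -[leRHS]mul1r; apply: ler_pM; rewrite ?nc_ge0 ?istime_le ?eps_lam //.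
  rewrite ncM; apply: ler_pM; rewrite ?nc_ge0 ?nc_R0 ?nc_tpow //; exact: ltnW.
apply: (@le_trans _ _ (k%:R * (eps * nu * (time_cst * (nu * (rem0_cst * h * h)))))).
  by rewrite ler_wpM2r // ler_nat.
by rewrite le_eqVlt; apply/predU1P; left; rewrite /rcor_cst; ring.
Qed.

Definition drcor_cst : R := k%:R * (nu * (time_cst * nu * rem0_cst * (k%:R * T + 1))).

Lemma nc_drcor b t : (size b <= k)%N -> 0 <= t <= h -> nc (drcor b t) <= drcor_cst * (eps * h).
Proof.
move=> bk tin; have nup := nu_ge0; have w0 := time_cst_ge0; have c60 := rem0_cst_ge0.
have e0 := ltW eps0; have h0' := ltW h0; have T0' := ltW T0.
have B1 : 0 <= eps * nu * (time_cst * nu * rem0_cst * (k%:R * T + 1) * h).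
  by rewrite !mulr_ge0 // addr_ge0 // mulr_ge0.
apply: le_trans (nc_dsum (B := eps * nu * (time_cst * nu * rem0_cst * (k%:R * T + 1) * h)) _) _.
  move=> p c cb _; have ck : (size c < k)%N by rewrite cb.
  rewrite ncM; apply: ler_pM; rewrite ?nc_ge0 //.
    rewrite ncM -[leRHS]mul1r; apply: ler_pM; rewrite ?nc_ge0 ?istime_le ?eps_lam //.
  apply: (le_trans (ncD _ _)).
  have -> : time_cst * nu * rem0_cst * (k%:R * T + 1) * h =
    k%:R * time_cst * (nu * (rem0_cst * T * h)) + time_cst * (nu * (rem0_cst * h)) by ring.
  apply: lerD; last by rewrite ncM; apply: ler_pM; rewrite ?nc_ge0 ?nc_dR0 ?nc_tpow //; exact: ltnW.
  rewrite mulr1 ncM; apply: ler_pM; rewrite ?nc_ge0 //.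
    rewrite ncM nc_nat; apply: ler_pM; rewrite ?nc_ge0 ?ler_nat ?nc_tpow //; first exact: ltnW.
    by rewrite (leq_trans (leq_pred _)) // ltnW.
  apply: (le_trans (nc_R0 p ck tin)); rewrite ler_wpM2l // ler_wpM2r // ler_wpM2l //.
  exact: h_le_T.
apply: (@le_trans _ _ (k%:R * (eps * nu * (time_cst * nu * rem0_cst * (k%:R * T + 1) * h)))).
  by rewrite ler_wpM2r // ler_nat.
by rewrite le_eqVlt; apply/predU1P; left; rewrite /drcor_cst; ring.
Qed.

(** One space letter already brings the factor [eps], so the corrector can be confined to words of
    time letters by [istime]. *)
Lemma nc_eig_del_mixed c t : (size c <= k)%N -> 0 <= t <= h -> ~~ all (pred1 tt) c ->
  nc (\prod_(q <- c) eig_del t q) <= (nu * incr_cst * (1 + T)) ^+ k * eps.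
Proof.
move=> ck tin; have /andP[t0 t1] := tin; have T1 : 1 <= 1 + T by rewrite lerDl ltW.
have nd1 := nu_incr_ge1; have nd0 := le_trans ler01 nd1; have e0 := ltW eps0.
have m1 : 1 <= nu * incr_cst * (1 + T) by rewrite mulr_ege1.
have m0 := le_trans ler01 m1.
have ndT q : nc (eig_del t q) <= nu * incr_cst * (1 + T).
  apply: (le_trans (nc_eig_del q tin)); rewrite mulrA ler_wpM2l //.
  by have /andP[_ tT] := time_in tin; apply: le_trans (le_trans _ tT) _; rewrite ?lerDr.
move=> cN; suff : nc (\prod_(q <- c) eig_del t q) <= (nu * incr_cst * (1 + T)) ^+ size c * eps.
  by move/le_trans; apply; rewrite ler_wpM2r // ler_weXn2l.
elim: c cN {ck} => //= q c IH; rewrite negb_and big_cons ncM exprS => qc.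
have all_le : nc (\prod_(q <- c) eig_del t q) <= (nu * incr_cst * (1 + T)) ^+ size c.
  elim: c {IH qc} => [|q' c IH]; first by rewrite big_nil nc1 expr0.
  by rewrite big_cons ncM exprS ler_pM ?nc_ge0.
have [qt|qt] := boolP (q == tt); last first.
  rewrite mulrAC; apply: ler_pM; rewrite ?nc_ge0 //.
  move: qt; have [j ->|j ->] := split_ordP q; last by rewrite ord1 eqxx.
  move=> _; apply: (le_trans (nc_eig_del_space j tin)); rewrite mulrA ler_wpM2r //.
  by rewrite ler_peMr.
rewrite -mulrA; apply: ler_pM; rewrite ?nc_ge0 // IH //.
by move: qc; rewrite qt.
Qed.

Definition residual_cst : R :=
  k%:R * (time_cst * (nu * rem_cst)
    + (nu * incr_cst * (1 + T)) ^+ k * (nu * (near_cst + taylor_cst)) * (1 + time_cst * T)).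

Lemma rem_cst_ge0 : 0 <= rem_cst.
Proof.
have c40 := zero_cst_ge0; have dd := incr_cst_ge0; have w0 := time_cst_ge0; have nup := nu_ge0.
have c60 : 0 <= k.+1%:R * time_cst * zero_cst by rewrite mulr_ge0 // mulr_ge0.
have c70 : 0 <= k.+1%:R * (k.+2%:R ^+ d * L * incr_cst ^+ k.+1 * time_cst).
  by rewrite mulr_ge0 // mulr_ge0 // mulr_ge0 ?exprn_ge0 // mulr_ge0 // exprn_ge0.
by rewrite addr_ge0 // addr_ge0 // /near_cst mulr_ge0 // mulr_ge0.
Qed.

(** If [c] has only time letters, the corrector cancels [rem0] and [rem_diff] bounds the rest.
    Otherwise [c] brings a factor [eps], and the remainder of [rem_err], whose power of [t] is at
    least 2 as [size c < k], brings a factor [h]. *)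
Lemma nc_forcing_cor b t : (size b <= k)%N -> 0 <= t <= h ->
  nc (forcing b t - freq b * rcor b t) <= residual_cst * (a + eps * h).
Proof.
move=> bk tin; have /andP[t0 t1] := tin; rewrite freq_rcor // /forcing -dsumB.
have nup := nu_ge0; have w0 := time_cst_ge0; have c50 := rem_cst_ge0; have c120 := near_taylor_ge0.
have e0 := ltW eps0; have h0' := ltW h0; have T0' := ltW T0; have a0 := a_ge0.
have nd0 := le_trans ler01 nu_incr_ge1.
have m0 : 0 <= nu * incr_cst * (1 + T) by rewrite mulr_ge0 // addr_ge0.
have mk0 : 0 <= (nu * incr_cst * (1 + T)) ^+ k by rewrite exprn_ge0.
have wT : 0 <= time_cst * T by rewrite mulr_ge0.
have x1 : 0 <= time_cst * (nu * rem_cst) by rewrite mulr_ge0 // mulr_ge0.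
have x2 : 0 <= (nu * incr_cst * (1 + T)) ^+ k * (nu * (near_cst + taylor_cst)) * (1 + time_cst * T).
  by rewrite mulr_ge0 ?addr_ge0 // mulr_ge0 // mulr_ge0.
have eh : 0 <= eps * h by rewrite mulr_ge0.
have aeh : 0 <= a + eps * h by rewrite addr_ge0.
apply: le_trans (nc_dsum (B := (time_cst * (nu * rem_cst) +
  (nu * incr_cst * (1 + T)) ^+ k * (nu * (near_cst + taylor_cst)) * (1 + time_cst * T))
  * (a + eps * h)) _) _; last first.
  by rewrite /residual_cst -[leRHS]mulrA ler_wpM2r ?ler_nat // mulr_ge0 // addr_ge0.
move=> p c cb _; have ck : (size c < k)%N by rewrite cb.
have Mk := sub_size_pos ck.
rewrite /istime mulrDl; case: (boolP (all _ c)) => [ct|ct]; rewrite ?mul1r ?mul0r ?subr0.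
  have -> : \prod_(q <- c) eig_del t q = t%:C ^+ size c.
    rewrite (eq_big_seq (fun=> t%:C)) => [|q /(allP ct) /eqP ->]; last by rewrite eig_del_time.
    by rewrite big_const_seq count_predT iter_mulr_1.
  rewrite -[leLHS]/(nc _) -mulrBr ncM /R0 -sumrB.
  apply: ler_wpDr; first exact: mulr_ge0.
  rewrite -mulrA; apply: ler_pM; rewrite ?nc_ge0 ?nc_tpow //; first exact: ltnW.
  under eq_bigr do rewrite -mulrBr.
  rewrite -mulrA; apply: nc_sumN => q; apply: (le_trans (rem_diff q Mk tin)).
  by rewrite ler_wpM2l // lerD2l ler_wpM2l.
apply: ler_wpDl; first exact: mulr_ge0.
rewrite ncM; apply: le_trans (ler_pM _ _ (nc_eig_del_mixed (ltnW ck) tin ct)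
  (nc_sumN p (fun q => rem_err q (leq_subr _ _) tin))) _; rewrite ?nc_ge0 //.
have -> : (nu * incr_cst * (1 + T)) ^+ k * eps * (nu * ((near_cst + taylor_cst) * (a + t ^+ (k - size c).+1))) =
  (nu * incr_cst * (1 + T)) ^+ k * (nu * (near_cst + taylor_cst)) * (eps * (a + t ^+ (k - size c).+1)) by ring.
rewrite -[leRHS]mulrA ler_wpM2l ?mulr_ge0 //.
have tp1 : t ^+ (k - size c).+1 <= time_cst * T * h.
  rewrite exprSr; apply: ler_pM; rewrite ?exprn_ge0 //.
  apply: (le_trans (pow_le Mk tin)); rewrite ler_wpM2l //.
  by apply: le_trans h_le_T.
rewrite mulrDr mulrDl mul1r; apply: (@le_trans _ _ (a + time_cst * T * (eps * h))).
  apply: lerD; first by rewrite ler_piMl.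
  by rewrite mulrCA ler_wpM2l.
apply: lerD; first by rewrite lerDl.
by rewrite ler_wpM2l // lerDr.
Qed.

Definition step_cst : R := (coupling_cst * (rcor_cst * T) + residual_cst + drcor_cst) * gronwall_cst + rcor_cst.

Lemma rcor_cst_ge0 : 0 <= rcor_cst.
Proof.
by rewrite mulr_ge0 // mulr_ge0 ?nu_ge0 // mulr_ge0 ?time_cst_ge0 // mulr_ge0 ?nu_ge0 ?rem0_cst_ge0.
Qed.

Lemma rcor0 b : (size b <= k)%N -> rcor b 0 = 0.
Proof.
move=> bk; rewrite /rcor (eq_dsum (E' := fun _ _ => 0)) ?dsum0 // => p c cb.
by rewrite /R0 big1 ?mulr0 // => q _; rewrite rem0_at0 mulr0.
Qed.

(** Gronwall for [eig_eta + rcor], which has the same frequencies: [forcing] is replaced by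
    [forcing - freq b * rcor b], at the price of the derivative [drcor]. *)
Lemma step_E2 p : (0 < k)%N ->
  nc (\sum_l N p l * ((X + Pi2 R (d + 1) (size s) *m flow h) l 0 - x (that + h) l 0))
    <= nc (eig_err p) + h * (step_cst * (a + eps * h)).
Proof.
move=> k0; rewrite eig_err_next; apply: (le_trans (ncB _ _)).
rewrite ncM nc_cis mul1r lerD2l.
have e0 := ltW eps0; have h0' := ltW h0; have T0' := ltW T0; have a0 := a_ge0.
have c80 := rcor_cst_ge0; have cs0 := coupling_cst_ge0.
have z0 : 0 <= (0 : R) <= h by rewrite lexx.
have hh : 0 <= h <= h by rewrite lexx h0'.
have eh : 0 <= eps * h by rewrite mulr_ge0.
have c100 : 0 <= residual_cst * (a + eps * h).
  exact: le_trans (nc_ge0 _) (nc_forcing_cor (b := [::]) isT z0).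
have c90 : 0 <= drcor_cst * (eps * h).
  exact: le_trans (nc_ge0 _) (nc_drcor (b := [::]) isT z0).
pose r2 := coupling_cst * (rcor_cst * (eps * h * h)) + (residual_cst * (a + eps * h) + drcor_cst * (eps * h)).
have r20 : 0 <= r2.
  by rewrite addr_ge0 ?addr_ge0 // mulr_ge0 // mulr_ge0 // mulr_ge0.
have pk : (size [:: p] <= k)%N by [].
pose z (b : k.-bseq I) t := eig_eta b t + rcor b t.
pose S (b : k.-bseq I) t := Slin (eta t) b + ((forcing b t - freq b * rcor b t) + drcor b t).
have zP b : hasder h (z b) (fun t => freq b * z b t + S b t).
  apply: (eq_hasder (hasderD (hasder_eig_eta (size_bseq b)) (hasder_rcor (size_bseq b)))) => t _ //.
  by rewrite /z /S; ring.
have z00 b : z b 0 = 0 by rewrite /z eig_eta0 ?rcor0 ?addr0 // size_bseq.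
have H := @gronwall_skew R (k.-bseq I) h z S (fun b => freq b) coupling_cst r2 h0 cs0 r20
  (fun b => freq_re b) zP z00.
have {}H := H _ (Bseq pk).
have zh : nc (z (Bseq pk) h) <= h * r2 * gronwall_cst.
  apply: le_trans (H _) _; last by apply: ler_wpM2l; [rewrite mulr_ge0 | rewrite gronwall_cst_le // h_le_T h0'].
  move=> t Z tin HZ b; apply: (le_trans (ncD _ _)); rewrite /r2 addrA -mulrDr; apply: lerD.
    apply: nc_Slin => [|c ck]; first exact: size_bseq.
    (* The coupling acts on the defect and not on [z], which adds the size of the corrector to the
       source [r2]. *)
    have -> : tens N (eta t) c = z (Bseq ck) t - rcor c t by rewrite /z /eig_eta addrK.
    apply: (le_trans (ncB _ _)); apply: lerD; first exact: HZ.
    exact: nc_rcor.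
  apply: (le_trans (ncD _ _)); apply: lerD.
    by apply: nc_forcing_cor => //; exact: size_bseq.
  by apply: nc_drcor => //; exact: size_bseq.
have -> : eig_eta [:: p] h = z (Bseq pk) h - rcor [:: p] h by rewrite /z addrK.
apply: (le_trans (ncB _ _)); apply: le_trans (lerD zh (nc_rcor pk hh)) _.
have CG0 : 0 <= gronwall_cst by rewrite mulr_ge0 // expR_ge0.
have ehT : eps * h * h <= T * (a + eps * h).
  rewrite [_ * h]mulrC; apply: ler_pM => //; first exact: h_le_T.
  by rewrite lerDr.
have aeh : 0 <= a + eps * h by rewrite addr_ge0.
have c90' : drcor_cst * (eps * h) <= drcor_cst * (a + eps * h).
  rewrite ler_wpM2l ?lerDr //.
  have w0 := time_cst_ge0; have nup := nu_ge0; have c60 := rem0_cst_ge0.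
  rewrite /drcor_cst mulr_ge0 // mulr_ge0 // mulr_ge0 ?addr_ge0 ?mulr_ge0 //.
have r2b : r2 <= (coupling_cst * (rcor_cst * T) + residual_cst + drcor_cst) * (a + eps * h).
  rewrite /r2 addrA !mulrDl; apply: lerD => //; apply: lerD => //.
  by rewrite -[leRHS]mulrA ler_wpM2l // -[leRHS]mulrA ler_wpM2l.
rewrite /step_cst mulrDl mulrDr; apply: lerD.
  rewrite -mulrA ler_wpM2l // [leRHS]mulrAC; exact: ler_wpM2r.
have -> : rcor_cst * (eps * h * h) = h * (rcor_cst * (eps * h)) by ring.
by rewrite ler_wpM2l // ler_wpM2l // lerDr.
Qed.

(** * The time component of the scheme *)

Lemma flow_nil t : 0 <= t <= h -> ext (flow t) [::] = 1.
Proof.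
move=> tin.
have H := hasder_ext s_listing h ((eps^-1)%:C) (e1 R (size s)) A1P A0P (a := [::]) isT.
have -> : ext (flow t) [::] = ext (flow 0) [::] := hasder_const H (fun _ _ => erefl) tin.
exact: flow0.
Qed.

Lemma coefX_time b : (size b <= k)%N -> coefX b tt = (b == [::])%:R.
Proof.
move=> bk; rewrite /coefX -[pderivenf _ _ _ _ _]/(paug _ _ _ _ _ _) X_time.
rewrite (paug_time T0 FP) ?that_in //; case: eqP => [->|_]; last by rewrite mulr0.
by rewrite /gamma_idx big1 ?invr1 ?mulr1.
Qed.

Lemma jet_time t : 0 <= t <= h -> jet k coefX (ext (flow t)) tt [::] = 1.
Proof.
move=> tin; rewrite /jet subn0 big_ltn // [X in _ + X]big_nat [X in _ + X]big1 ?addr0.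
  rewrite (big_pred1 [tuple]) => [|b]; last by rewrite tuple0 [RHS]eqxx.
  by rewrite coefX_time //= mul1r flow_nil.
move=> m /andP[m0 mk]; rewrite big1 // => b _.
by rewrite coefX_time ?size_tuple // -size_eq0 size_tuple eqn0Ngt m0 mul0r.
Qed.

(** Time is integrated exactly: it has no stiff part, and its jet is the constant 1. So the last
    entry of each iterate is the real time at which the derivatives are read. *)
Lemma flow_time : (0 < k)%N -> ext (flow h) [:: tt] = h%:C.
Proof.
move=> k0; have hh : 0 <= h <= h by rewrite lexx ltW.
have H := hasder_ext s_listing h ((eps^-1)%:C) (e1 R (size s)) A1P A0P (a := [:: tt]) k0.
have D0 t : 0 <= t <= h -> dsum (fun q c => (eps^-1)%:C * stiff X (augmx A) (ext (flow t)) q c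
    + jet k coefX (ext (flow t)) q c) [:: tt] - 1 = 0.
  move=> tin; rewrite /= addr0 jet_time // /stiff big1 ?mulr0 ?add0r ?subrr // => m _.
  by rewrite augmx_time_row mul0r.
have E : ext (flow h) [:: tt] - h%:C = ext (flow 0) [:: tt] - 0%:C :=
  hasder_const (hasderB H (hasder_id h)) D0 hh.
by apply/eqP; rewrite -subr_eq0 E flow0 // subr0.
Qed.

End LocalStep.

(** * Convergence *)

Section Convergence.
Variables (R : realType) (d k : nat) (nu0 T : R).
Variables (A : 'M[R[i]]_d) (uin : 'cV[R[i]]_d) (F : 'cV[R[i]]_d -> R -> 'cV[R[i]]_d).
Variables (s : seq (seq 'I_(d + 1))).
Variables (A1k A0k : 'cV[R[i]]_(d + 1) -> 'M[R[i]]_(size s)).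
Variables (u : R -> R -> 'cV[R[i]]_d) (C0 : R).
Local Notation I := 'I_(d + 1).
Local Notation tt := (rshift d ord0 : I).
Hypothesis k0 : (0 < k)%N.
Hypothesis T0 : 0 < T.
Hypothesis FP : smooth_lipschitz T k F.
Hypothesis s_listing : is_listing k s.
Hypothesis A1P : forall xh, represents xh (A1_row (augmx A) xh) (A1k xh).
Hypothesis A0P : forall xh, represents xh (A0_row T k F xh) (A0k xh).
Hypothesis uP : forall eps : R, 0 < eps <= 1 -> is_solution T nu0 A uin F eps (u eps).
Hypothesis uC : forall eps : R, 0 < eps <= 1 ->
  forall t : R, 0 <= t <= T -> enorm (u eps t) <= C0 * eps.
Variables (N Ni : I -> I -> R[i]) (lam : I -> R[i]).
Hypothesis sp : spectral A N Ni lam.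

Let C00 : 0 <= C0 := C0_ge0 T0 uC.

(** A sum in place of a maximum. The inverse of a zero eigenvalue is 0, so [nu] bounds the inverses
    of the nonzero ones only. *)
Let nu : R := 1 + \sum_p \sum_m nc (N p m) + \sum_p \sum_m nc (Ni p m)
  + \sum_p \sum_m nc (augmx A p m) + \sum_p nc (lam p) + \sum_p nc (lam p)^-1.

Let sum2_ge0 (f : I -> I -> R[i]) : 0 <= \sum_p \sum_m nc (f p m).
Proof. by apply: sumr_ge0 => p _; apply: sumr_ge0 => m _; exact: nc_ge0. Qed.

Let sum1_ge0 (f : I -> R[i]) : 0 <= \sum_p nc (f p).
Proof. by apply: sumr_ge0 => p _; exact: nc_ge0. Qed.

Let row_le (f : I -> I -> R[i]) p : \sum_m nc (f p m) <= \sum_p \sum_m nc (f p m).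
Proof.
rewrite [leRHS](bigD1 p) //= lerDl; apply: sumr_ge0 => q _.
by apply: sumr_ge0 => m _; exact: nc_ge0.
Qed.

Let entry_le (f : I -> R[i]) p : nc (f p) <= \sum_p nc (f p).
Proof. by rewrite [leRHS](bigD1 p) //= lerDl; apply: sumr_ge0 => q _; exact: nc_ge0. Qed.

Let nu_bounds : [/\ 1 <= nu, (forall p, \sum_m nc (N p m) <= nu),
  (forall p, \sum_m nc (Ni p m) <= nu), (forall p, \sum_m nc (augmx A p m) <= nu) &
  (forall p, nc (lam p) <= nu) /\ (forall p, nc (lam p)^-1 <= nu)].
Proof.
have h1 := sum2_ge0 N; have h2 := sum2_ge0 Ni; have h3 := sum2_ge0 (augmx A).
have h4 := sum1_ge0 lam; have h5 := sum1_ge0 (fun p => (lam p)^-1).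
split; [|move=> p..|split=> p].
- by rewrite /nu; lra.
- by have := row_le N p; rewrite /nu; lra.
- by have := row_le Ni p; rewrite /nu; lra.
- by have := row_le (augmx A) p; rewrite /nu; lra.
- by have := entry_le lam p; rewrite /nu; lra.
- by have := entry_le (fun p => (lam p)^-1) p; rewrite /nu; lra.
Qed.

Definition onestep eps h (X : 'cV[R[i]]_(d + 1)) : 'cV[R[i]]_(d + 1) :=
  X + Pi2 R (d + 1) (size s) *m
    expmx (h%:C *: ((eps^-1)%:C *: A1k X + A0k X)) *m e1 R (size s).

Definition err eps t X p : R[i] := eig_err N t X (u eps) p.

Definition admissible K eps h t (X : 'cV[R[i]]_(d + 1)) :=
  [/\ 0 < eps <= 1, 0 < h, 0 <= t, t + h <= T &
      X tt 0 = t%:C /\ forall j, nc (X (lshift 1 j) 0) <= K * eps].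

Lemma one_step K : C0 <= K -> exists2 C, 0 <= C & forall eps h t X,
  admissible K eps h t X ->
  [/\ onestep eps h X tt 0 = (t + h)%:C,
      (forall p, nc (err eps t X p) <= nu * (2 * K * eps)) &
      forall a, (forall p, nc (err eps t X p) <= a) -> forall p,
        nc (err eps (t + h) (onestep eps h X) p) <= a + h * (C * (a + h ^+ k.+1)) /\
        nc (err eps (t + h) (onestep eps h X) p) <= a + h * (C * (a + eps * h))].
Proof.
move=> CK; have K0 := le_trans C00 CK.
have [nu1 nuN nuNi nuA [nul nuV]] := nu_bounds.
have nup := le_trans ler01 nu1.
pose r := K + nu * (nu * (2 * K)).
have r0 : 0 <= r by rewrite addr_ge0 // mulr_ge0 // mulr_ge0 // mulr_ge0.
have [B B0 BP] := paug_bound T0 FP r0.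
have [L1 L10 LP1] := paug_lip T0 FP r0.
have [L2 L20 LP2] := pderivenf_lip T0 FP r0.
pose L := L1 + L2.
have L0 : 0 <= L by rewrite addr_ge0.
have LP b : (size b <= k)%N -> forall q (u v : 'cV[R[i]]_d) t s,
    (forall j, nc (u j 0) <= r) -> (forall j, nc (v j 0) <= r) ->
    0 <= t <= T -> 0 <= s <= T ->
    nc (paug T F b q u t - paug T F b q v s) <= L * (\sum_j nc (u j 0 - v j 0) + `|t - s|).
  move=> bk q v w t s' vr wr tT sT; apply: (le_trans (LP1 b bk q v w t s' vr wr tT sT)).
  rewrite ler_wpM2r ?lerDl // addr_ge0 // sumr_ge0 // => j _; exact: nc_ge0.
have GP b q x p z : (size b <= k)%N -> dom T r x -> dom T r (x + z *: delta_mx p 0) ->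
    nc (pderivenf T F b q (x + z *: delta_mx p 0) - pderivenf T F b q x) <= L * nc z.
  move=> bk xD xzD; apply: (le_trans (LP2 b q x p z bk xD xzD)).
  by rewrite ler_wpM2r ?nc_ge0 // lerDr.
pose E1 := forcing_cst d k T nu K B L * gronwall_cst d k T nu K B.
pose E2 := step_cst d k T nu K B L.
(* One constant for both estimates; it depends on [K] but not on [eps], [h], [t] or [X]. *)
exists (`|E1| + `|E2|); first by rewrite addr_ge0.
move=> eps h t X [/andP[e0 e1] h0 t0 thT [Xt XK]].
have e01 : 0 < eps <= 1 by rewrite e0 e1.
have uK t' : 0 <= t' <= T -> forall j, nc (u eps t' j 0) <= K * eps.
  move=> tT j; apply: (le_trans (nc_le_enorm _ _)); apply: (le_trans (uC e01 tT)).
  by rewrite ler_wpM2r // ltW.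
have tin : 0 <= t <= T by rewrite t0 /= (le_trans _ thT) // lerDl ltW.
have ab p : nc (err eps t X p) <= nu * (2 * K * eps).
  have Ke : 0 <= 2 * K * eps by rewrite mulr_ge0 ?mulr_ge0 // ltW.
  apply: (nc_sumN nuN) => q; have [j ->|j ->] := split_ordP q.
    apply: (le_trans (ncB _ _)); rewrite xaug_space.
    by rewrite -mulrA mulr_natl mulr2n lerD ?XK ?uK.
  by rewrite ord1 Xt xaug_time subrr nc0.
have res := resonance T0 FP uP uC sp.
have oE : onestep eps h X = X + Pi2 R (d + 1) (size s) *m flow eps (A1k X) (A0k X) h.
  by rewrite /onestep /flow mulmxA.
split=> [|p|a aP p]; [|exact: ab|].
  rewrite oE (flow_step eps h X s_listing) Xt.
  rewrite (flow_time T0 FP eps h0 t0 thT Xt s_listing (A1P X) (A0P X) k0).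
  by rewrite rmorphD.
(* The local estimates ask for an error bound of size [O(eps)]; since [ab] always provides one, an
   arbitrary [a] may be cut down to it. *)
pose a' := Num.min a (nu * (2 * K * eps)).
have aP' q : nc (err eps t X q) <= a' by rewrite le_min aP ab.
have a'K : a' <= nu * (2 * K * eps) by rewrite ge_min lexx orbT.
have a'a : a' <= a by rewrite ge_min lexx.
have a'0 : 0 <= a' := le_trans (nc_ge0 _) (aP' tt).
have S1 := step_E1 T0 FP sp nu1 nuN nuNi nuA nul K0 (lexx _) B0 L0 BP LP GP e0 e1 h0 t0 thT Xt XK
  (uP e01) uK aP' a'K s_listing (A1P X) (A0P X) p k0.
have S2 := step_E2 T0 FP sp nu1 nuN nuNi nuA nul nuV K0 (lexx _) B0 L0 BP LP GP e0 e1 h0 t0 thT Xt XK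
  (uP e01) uK aP' a'K (@res) s_listing (A1P X) (A0P X) p k0.
have hp := ltW h0; have ep := ltW e0.
split; rewrite /err oE.
  apply: (le_trans S1); apply: lerD; first exact: aP.
  rewrite ler_wpM2l // mulrAC -/E1.
  have hk : 0 <= h ^+ k.+1 by rewrite exprn_ge0.
  apply: (@le_trans _ _ ((`|E1| + `|E2|) * (a' + h ^+ k.+1))).
    rewrite ler_wpM2r ?addr_ge0 //; apply: (le_trans (ler_norm _)); by rewrite lerDl.
  by rewrite ler_wpM2l ?addr_ge0 // lerD2r.
apply: (le_trans S2); apply: lerD; first exact: aP.
have eh : 0 <= eps * h by rewrite mulr_ge0.
rewrite ler_wpM2l //; apply: (@le_trans _ _ ((`|E1| + `|E2|) * (a' + eps * h))).
  rewrite ler_wpM2r ?addr_ge0 //; apply: (le_trans (ler_norm _)); by rewrite lerDr.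
by rewrite ler_wpM2l ?addr_ge0 // lerD2r.
Qed.

Lemma state_from_err eps t X a j : 0 < eps <= 1 -> 0 <= t <= T -> 
  (forall p, nc (err eps t X p) <= a) ->
  nc (X (lshift 1 j) 0 - u eps t j 0) <= nu * a.
Proof.
move=> e01 tT aP; have [nu1 nuN nuNi nuA _] := nu_bounds.
have -> : X (lshift 1 j) 0 - u eps t j 0 = \sum_m Ni (lshift 1 j) m * err eps t X m.
  rewrite -(xaug_space (u eps) t j); symmetry.
  rewrite /err /eig_err; under eq_bigr do rewrite mulr_sumr.
  rewrite exchange_big (bigD1 (lshift 1 j)) //= [X in _ + X]big1 ?addr0 => [|l lj].
    under eq_bigr do rewrite mulrA.
    by rewrite -mulr_suml (spectral_inv sp) eqxx mul1r.
  under eq_bigr do rewrite mulrA.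
  by rewrite -mulr_suml (spectral_inv sp) eq_sym (negbTE lj) mul0r.
exact: (nc_sumN nuNi).
Qed.

Lemma growth_expR C h n : 0 <= C -> 0 <= h -> n%:R * h <= T -> (1 + h * C) ^+ n <= expR (C * T).
Proof.
move=> Cp hp nh; apply: (@le_trans _ _ (expR (h * C) ^+ n)).
  by rewrite lerXn2r ?nnegrE ?expR_ge0 ?addr_ge0 ?mulr_ge0 // expR_ge1Dx.
rewrite -expRM_natl ler_expR mulrA mulrC; exact: ler_wpM2l.
Qed.

(** * Propagation of the error along the iteration *)

Section Trajectory.
Variables (eps h : R) (Nn : nat).
Hypothesis eps01 : 0 < eps <= 1.
Hypothesis h0 : 0 < h.
Hypothesis hT : Nn%:R * h <= T.
Local Notation X n := (lleei A1k A0k eps h (X_init nu0 uin eps) n).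
Local Notation tm n := (n%:R * h).

Let ep : 0 <= eps. Proof. by case/andP: eps01 => /ltW. Qed.

Lemma tm_in n : (n <= Nn)%N -> 0 <= tm n <= T.
Proof.
move=> nN; rewrite mulr_ge0 ?(ltW h0) //=; apply: le_trans hT.
by rewrite ler_wpM2r ?(ltW h0) // ler_nat.
Qed.

Lemma tmS n : tm n.+1 = tm n + h.
Proof. by rewrite -natr1 mulrDl mul1r. Qed.

Lemma err_init p : err eps (tm 0) (X 0%N) p = 0.
Proof.
rewrite /err /eig_err big1 // => l _; rewrite mul0r.
have [j ->|j ->] := split_ordP l; last first.
  by rewrite ord1 xaug_time /= /X_init col_mxEd mxE subrr mulr0.
have [u0 _] := uP eps01.
by rewrite xaug_space u0 /= /X_init col_mxEu subrr mulr0.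
Qed.

Definition in_ball K n := X n tt 0 = (tm n)%:C /\ forall j, nc (X n (lshift 1 j) 0) <= K * eps.

Lemma in_ball_admissible K n : (n < Nn)%N -> in_ball K n -> admissible K eps h (tm n) (X n).
Proof.
move=> nN [Xt XK]; split=> //; first by rewrite mulr_ge0 // ltW.
by rewrite -tmS; have /andP[] := tm_in nN.
Qed.

Lemma in_ball_err K n a : (n <= Nn)%N -> X n tt 0 = (tm n)%:C ->
  (forall p, nc (err eps (tm n) (X n) p) <= a) -> C0 * eps + nu * a <= K * eps -> in_ball K n.
Proof.
move=> nN Xt aP aK; split=> // j; have tin := tm_in nN.
apply: le_trans aK; rewrite -[X n _ _](subrK (u eps (tm n) j 0)) addrC.
apply: (le_trans (ncD _ _)); apply: lerD.
  by apply: (le_trans (nc_le_enorm _ _)); exact: uC.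
exact: state_from_err.
Qed.

Lemma in_ball_init K : C0 <= K -> in_ball K 0.
Proof.
move=> CK; apply: (in_ball_err (a := 0)) => // [|p|].
- by rewrite mul0r /= /X_init col_mxEd mxE.
- by rewrite err_init nc0.
by rewrite mulr0 addr0 ler_wpM2r.
Qed.

(** A discrete Gronwall lemma: the bound plus [r] is multiplied by [1 + h * C] at each step. It
    serves with [r = eps * h] for confinement and with [r = h ^+ k.+1] for the order. *)
Lemma err_growth K C r m : 0 <= C -> 0 <= r -> (m <= Nn)%N ->
  (forall t Y, admissible K eps h t Y -> forall a, (forall p, nc (err eps t Y p) <= a) ->
    forall p, nc (err eps (t + h) (onestep eps h Y) p) <= a + h * (C * (a + r))) ->
  (forall n, (n < m)%N -> in_ball K n) ->
  forall p, nc (err eps (tm m) (X m) p) <= r * ((1 + h * C) ^+ m - 1).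
Proof.
move=> Cp r0 mN step; elim: m mN => [|m IH] mN Xm p.
  by rewrite err_init nc0 expr0 subrr mulr0.
have am := in_ball_admissible mN (Xm m (ltnSn m)).
have := step _ _ am _ (IH (ltnW mN) (fun n nm => Xm n (ltnW nm))) p.
rewrite -tmS => H; apply: (le_trans H); rewrite exprS le_eqVlt; apply/predU1P; left; ring.
Qed.

End Trajectory.

(* For small steps the error stays below [eps], so the numerical solution stays
   in a fixed ball of radius [O(eps)]. *)
Lemma small_steps : exists K h1, [/\ C0 <= K, 0 < h1 & forall eps h Nn, 0 < eps <= 1 -> 0 < h ->
  Nn%:R * h <= T -> h <= h1 -> forall n, (n <= Nn)%N -> in_ball eps h K n].
Proof.
have CK : C0 <= C0 + 1 by rewrite lerDl.
have [C C_ge0 CP] := one_step CK.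
have [nu1 _ _ _ _] := nu_bounds; have nup := lt_le_trans ltr01 nu1.
have g0 : 0 < nu * expR (C * T) by rewrite mulr_gt0 // expR_gt0.
(* At or below this threshold [nu * (eps * h * expR (C * T)) <= eps], so the error fits into the
   margin between [C0] and [C0 + 1]. *)
exists (C0 + 1), (nu * expR (C * T))^-1; split; rewrite ?invr_gt0 //.
move=> eps h Nn e01 h0 hT hh n.
have /andP[/ltW e0 _] := e01; have hp := ltW h0.
have rp : 0 <= eps * h by rewrite mulr_ge0.
(* Strong induction, because [err_growth] wants all earlier iterates in the ball. *)
have [m] := ubnP n; elim: m n => // m IH n nm nN.
case: n nm nN => [|n] nm nN; first exact: (in_ball_init e01 h0 hT).
have prev i : (i < n.+1)%N -> in_ball eps h (C0 + 1) i.
  move=> ni; apply: IH; [exact: leq_trans ni _ | exact: leq_trans (ltnW ni) _].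
have am := in_ball_admissible e01 h0 hT nN (prev n (ltnSn n)).
have [Xt _ _] := CP _ _ _ _ am.
apply: (in_ball_err e01 h0 hT nN) => [|p|].
- by rewrite tmS -Xt.
- apply: (err_growth e01 h0 hT C_ge0 rp nN _ prev) => t Y Yam a aP q.
  by have [_ _ /(_ a aP q) []] := CP _ _ _ _ Yam.
rewrite [leRHS]mulrDl mul1r lerD2l.
have nT : n.+1%:R * h <= T by have /andP[] := tm_in h0 hT nN.
apply: (@le_trans _ _ (nu * (eps * h * expR (C * T)))).
  rewrite ler_wpM2l ?(ltW nup) // ler_wpM2l //.
  by apply: le_trans (growth_expR C_ge0 hp nT); rewrite gerBl.
have -> : nu * (eps * h * expR (C * T)) = eps * (h * (nu * expR (C * T))) by ring.
by rewrite ler_piMr // -ler_pdivlMr // div1r.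
Qed.

(** No smallness of [h] is used, so the radius deteriorates at each step; this is harmless for a
    number of steps fixed in advance. *)
Lemma bounded_steps m : exists2 K, C0 <= K & forall eps h Nn, 0 < eps <= 1 -> 0 < h ->
  Nn%:R * h <= T -> forall n, (n <= Nn)%N -> (n <= m)%N -> in_ball eps h K n.
Proof.
elim: m => [|m [K CK IH]].
  exists C0 => // eps h Nn e01 h0 hT n _; rewrite leqn0 => /eqP ->.
  exact: (in_ball_init e01 h0 hT).
have [C C_ge0 CP] := one_step CK.
have [nu1 _ _ _ _] := nu_bounds; have nup := le_trans ler01 nu1.
have Kp := le_trans C00 CK; have Tp := ltW T0.
(* The second estimate of [one_step] with the crude error [nu * (2 * K * eps)] and with [h <= T], in
   units of [eps]. *)
pose a1 := nu * (2 * K) + T * (C * (nu * (2 * K) + T)).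
have a10 : 0 <= a1.
  have x0 : 0 <= nu * (2 * K) by rewrite mulr_ge0 // mulr_ge0.
  by rewrite addr_ge0 // mulr_ge0 // mulr_ge0 // addr_ge0.
exists (K + nu * a1); first by rewrite (le_trans CK) // lerDl mulr_ge0.
move=> eps h Nn e01 h0 hT n nN; rewrite leq_eqVlt => /predU1P[nm|nm]; last first.
  have [Xt XK] := IH _ _ _ e01 h0 hT _ nN nm; split=> // j; apply: (le_trans (XK j)).
  by case/andP: e01 => /ltW e0 _; rewrite ler_wpM2r // lerDl mulr_ge0.
rewrite {n}nm in nN *.
have am := in_ball_admissible e01 h0 hT nN (IH _ _ _ e01 h0 hT _ (ltnW nN) (leqnn m)).
have [Xt ab H] := CP _ _ _ _ am.
have /andP[/ltW e0 _] := e01; have hp := ltW h0.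
have hT' : h <= T.
  apply: le_trans hT; rewrite ler_peMl // ler1n; exact: leq_ltn_trans nN.
apply: (in_ball_err e01 h0 hT nN (a := a1 * eps)) => [|p|].
- by rewrite tmS -Xt.
- have [_ B] := H _ ab p; rewrite tmS; apply: (le_trans B).
  rewrite /a1 [leRHS]mulrDl; apply: lerD; first by rewrite mulrA.
  have x0 : 0 <= nu * (2 * K) by rewrite mulr_ge0 // mulr_ge0.
  apply: (@le_trans _ _ (h * (C * ((nu * (2 * K) + T) * eps)))).
    rewrite ler_wpM2l // ler_wpM2l // [leRHS]mulrDl; apply: lerD; first by rewrite mulrA.
    by rewrite mulrC ler_wpM2r.
  rewrite -!mulrA; apply: ler_wpM2r => //.
  by rewrite !mulr_ge0 // addr_ge0.
by rewrite [leRHS]mulrDl mulrA lerD2r ler_wpM2r.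
Qed.

Lemma numerical_bounded : exists2 K, C0 <= K & forall eps h Nn, 0 < eps <= 1 -> 0 < h ->
  Nn%:R * h <= T -> forall n, (n <= Nn)%N -> in_ball eps h K n.
Proof.
have [K1 [h1 [CK1 h10 P1]]] := small_steps.
have [K2 CK2 P2] := bounded_steps (Num.bound (T / h1)).
have K20 := le_trans C00 CK2; have K10 := le_trans C00 CK1.
exists (K1 + K2); first by rewrite (le_trans CK1) // lerDl.
move=> eps h Nn e01 h0 hT n nN; have /andP[/ltW e0 _] := e01.
have [hh|hh] := lerP h h1.
  have [Xt XK] := P1 _ _ _ e01 h0 hT hh n nN; split=> // j; apply: (le_trans (XK j)).
  by rewrite ler_wpM2r // lerDl.
(* Steps longer than [h1] number at most [T / h1], which does not depend on [eps]. *)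
have nb : (n <= Num.bound (T / h1))%N.
  rewrite -(ler_nat R) ltW //; apply: le_lt_trans (archi_boundP _); last first.
    by rewrite divr_ge0 ?(ltW T0) // ltW.
  rewrite ler_pdivlMr //; apply: le_trans hT.
  by apply: ler_pM; rewrite ?ler_nat // ltW.
have [Xt XK] := P2 _ _ _ e01 h0 hT n nN nb; split=> // j; apply: (le_trans (XK j)).
by rewrite ler_wpM2r // lerDr.
Qed.

Lemma convergence : exists C : R, forall (eps h : R) (Nn n : nat), 0 < eps <= 1 -> 0 < h ->
  Nn%:R * h <= T -> (n <= Nn)%N ->
  enorm (usubmx (lleei A1k A0k eps h (X_init nu0 uin eps) n) - u eps (n%:R * h)) <= C * h ^+ k.+1.
Proof.
have [K CK KP] := numerical_bounded; have [C C_ge0 CP] := one_step CK.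
have [nu1 _ _ _ _] := nu_bounds; have nup := le_trans ler01 nu1.
(* [expR (C * T)] is the accumulated error in eigen-coordinates, [nu] pays for the return to the
   original ones and [d] for passing from entries to the Euclidean norm. *)
exists (d%:R * (nu * expR (C * T))) => eps h Nn n e01 h0 hT nN.
have hp := ltW h0; have hk : 0 <= h ^+ k.+1 by rewrite exprn_ge0.
have nT := tm_in h0 hT nN.
have errP p : nc (err eps (n%:R * h) (lleei A1k A0k eps h (X_init nu0 uin eps) n) p)
    <= expR (C * T) * h ^+ k.+1.
  have := err_growth e01 h0 hT C_ge0 hk nN (K := K).
  move=> H; apply: le_trans (H _ _ _) _.
  - by move=> t Y Yam a aP q; have [_ _ /(_ a aP q) []] := CP _ _ _ _ Yam.
  - by move=> i ni; apply: (KP _ _ _ e01 h0 hT); rewrite (leq_trans (ltnW ni)).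
  rewrite mulrC ler_wpM2r //; case/andP: nT => _ nT.
  by apply: le_trans (growth_expR C_ge0 hp nT); rewrite gerBl.
apply: (le_trans (enorm_le_sum _)); rewrite -!mulrA.
apply: sum_nc_le => j; rewrite !mxE; exact: state_from_err.
Qed.

End Convergence.

Theorem theorem4p1 (R : realType) (d k : nat) (nu T : R)
    (A : 'M[R[i]]_d) (uin : 'cV[R[i]]_d) (F : 'cV[R[i]]_d -> R -> 'cV[R[i]]_d)
    (s : seq (seq 'I_(d + 1)))
    (A1k A0k : 'cV[R[i]]_(d + 1) -> 'M[R[i]]_(size s))
    (u : R -> R -> 'cV[R[i]]_d) (C0 : R) :
  (1 <= d)%N -> (1 <= k)%N -> 0 < T ->
  diagonalizable A ->
  (forall a : R[i], eigenvalue A a -> complex.Re a = 0) ->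
  smooth_lipschitz T k F ->
  is_listing k s ->
  (forall xh, represents xh (A1_row (augmx A) xh) (A1k xh)) ->
  (forall xh, represents xh (A0_row T k F xh) (A0k xh)) ->
  (forall eps : R, 0 < eps <= 1 -> is_solution T nu A uin F eps (u eps)) ->
  (forall eps : R, 0 < eps <= 1 ->
     forall t : R, 0 <= t <= T -> enorm (u eps t) <= C0 * eps) ->
  exists C : R, forall (eps : R) (N n : nat),
    0 < eps <= 1 -> (1 <= N)%N -> (n <= N)%N ->
    let h := T / N%:R in
    let X := lleei A1k A0k eps h (X_init nu uin eps) in
    enorm (usubmx (X n) - u eps (n%:R * h)) <= C * h ^+ k.+1.
Proof.
move=> _ k0 T0 Adiag Aeig FP s_listing A1P A0P uP uC.
have [N [Ni [lam sp]]] := diagonalizable_spectral Adiag Aeig.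
have [C CP] := convergence k0 T0 FP s_listing A1P A0P uP uC sp.
exists C => eps Nn n e01 N1 nN /=; apply: (CP _ _ _ _ e01 _ _ nN).
  by rewrite divr_gt0 // ltr0n.
by rewrite mulrC divfK // pnatr_eq0 -lt0n.
Qed.
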